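(* Let $\{K_t,\,t\ge0\}$ be the jump process on the torus described in the context, with transition semigroup $\{P_t,\,t\ge0\}$, and let $\nu_0$ be an initial law (probability measure on $\mathbb T$) absolutely continuous with respect to the Lebesgue measure $m_1$. Then $\nu_0P_t$ converge weakly, as $t\to+\infty$, to the measure $\mu_*:=\frac12(\delta_{k_0}+\delta_{-k_0})$. In addition, the process is completely mixing, i.e. if $\nu_0,\nu_0'$ are two initial laws that are absolutely continuous with respect to $m_1$, then $$\lim_{t\to+\infty}\|\nu_0P_t-\nu_0'P_t\|_{TV}=0 .$$
   Context: $\mathbb T$ is the one dimensional torus, i.e. the interval $[-\pi,\pi]$ with endpoints identified, and $m_1(dk)=dk/(2\pi)$ is the normalized Lebesgue measure. The function $\hat r:\mathbb T\times\mathbb T\to\mathbb R$ is continuous, satisfies $r_0^{-1}\ge\hat r(\theta,k)\ge r_0$ for some $r_0>0$, is even: $\hat r(-\theta,-k)=\hat r(\theta,k)$, and doubly stochastic: $\int_{\mathbb T}\hat r(\theta,k)d\theta=\int_{\mathbb T}\hat r(k,\theta)d\theta=1$ for all $k\in\mathbb T$. The function $\gamma:\mathbb T\to[0,+\infty)$ is Borel and even ($\gamma(-k)=\gamma(k)$), there is $k_0\in\mathbb T$ with $\gamma(k_0)=0$ and $\inf\{\gamma(k):\ \mathrm{dist}(k,\{-k_0,k_0\})\ge\delta\}>0$ for every $\delta>0$ and $\gamma>0$ off $\{-k_0,k_0\}$; moreover $\gamma(k)\le t_*^{-1}$ for some $t_*>0$, and $\int_{\mathbb T}\gamma^{-1}(k)dk=+\infty$.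 $\{K_t,\,t\ge0\}$ is the jump process on $\mathbb T$ with generator $Lf(k)=\gamma(k)\int_{\mathbb T}\hat r(\theta,k)[f(\theta)-f(k)]d\theta$ for bounded Borel $f$. It is realized as follows: $\{X_n\}$ is a Markov chain on $\mathbb T_{k_0}:=\mathbb T\setminus\{-k_0,k_0\}$ with transition probability from $k$ equal to $\hat r(\theta,k)d\theta$, $\{\rho_n\}$ is an independent i.i.d. sequence of exponential random variables of intensity $1$, $\tau(k,\rho):=\gamma^{-1}(k)\rho$, $t_0:=0$, $t_n:=\sum_{j=0}^{n-1}\tau(X_j,\rho_j)$, and $K_t:=X_n$ for $t\in[t_n,t_{n+1})$. $\nu_0P_t$ denotes the law of $K_t$ when $K_0$ has law $\nu_0$; $\|\cdot\|_{TV}$ is the total variation norm. *)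

(* Defs.v *)
From HB Require Import structures.
From mathcomp Require Import all_boot all_order all_algebra.
From mathcomp Require Import generic_quotient ring_quotient.
From mathcomp Require Import all_classical all_reals all_analysis.
From mathcomp Require Import measurable_realfun.

Set Implicit Arguments.
Unset Strict Implicit.
Unset Printing Implicit Defensive.

Import Order.TTheory GRing.Theory Num.Theory.
Import numFieldNormedType.Exports.

Local Open Scope classical_set_scope.
Local Open Scope ring_scope.

Section periods.
Variable R : realType.

Definition periods : {pred R} := [pred x | x / (2 * pi) \is a Num.int].

Lemma periods_zmod_closed : zmod_closed periods.
Proof.
split=> [|x y]; rewrite !inE ?mul0r ?rpred0// => px py.
by rewrite mulrBl rpredB.
Qed.

HB.instance Definition _ := GRing.isZmodClosed.Build R periods
  periods_zmod_closed.

End periods.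
Arguments periods : clear implicits.

(* R / 2 pi Z, i.e. [-pi, pi] with its endpoints identified, with the quotient
   group structure, the quotient topology and the Borel sigma-algebra. *)
Definition torus (R : realType) : Type :=
  quotient_topology (Quotient.quot (periods R)).

Section torus_structures.
Variable R : realType.
HB.instance Definition _ := Quotient.on (torus R).
HB.instance Definition _ := PointedTopological.on (torus R).
HB.instance Definition _ := GRing.isZmodule.Build (torus R)
  (@Quotient.addqA _ (periods R)) (@Quotient.addqC _ (periods R))
  (@Quotient.add0q _ (periods R)) (@Quotient.addNq _ (periods R)).
HB.instance Definition _ :=
  Measurable.copy (torus R) (g_sigma_algebraType (@open (torus R))).
End torus_structures.

Section torus_geometry.
Variable R : realType.
Local Notation T := (torus R).

Definition torus_proj (x : R) : T := \pi_(Quotient.quot (periods R))%qT x.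

Lemma torus_projE (x y : R) :
  torus_proj x = torus_proj y <-> (x - y) / (2 * pi) \is a Num.int.
Proof.
have := @Quotient.idealrBE _ (periods R) x y.
rewrite -[LHS]/((x - y) / (2 * pi) \is a Num.int) => ->.
by split=> [xy|/eqP//]; exact/eqP.
Qed.

Lemma torus_projN (x : R) : torus_proj (- x) = - torus_proj x.
Proof. exact: Quotient.pi_opp. Qed.

Lemma torus_projD (x y : R) :
  torus_proj (x + y) = torus_proj x + torus_proj y.
Proof. exact: Quotient.pi_add. Qed.

Lemma continuous_torus_proj : continuous torus_proj.
Proof. exact: pi_continuous. Qed.

Lemma measurable_torus_proj : measurable_fun [set: R] torus_proj.
Proof.
apply: (@measurability _ _ _ _ _ _ (@open T)) => //.
move=> _ [U oU <-]; rewrite setTI; apply: open_measurable.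
by move/continuousP : continuous_torus_proj; exact.
Qed.

Definition torus_dist (k l : T) : R :=
  inf [set `|x| | x in [set x | torus_proj x = k - l]].

End torus_geometry.

Section torus_measure.
Variable R : realType.
Local Notation T := (torus R).
Local Notation I := (`[- pi, pi]%classic : set R).

(* dk, of total mass 2 pi; the endpoints -pi and pi are negligible *)
Definition torus_lebesgue (A : set T) : \bar R :=
  lebesgue_measure (@torus_proj R @^-1` A `&` I).

Let mI : measurable I. Proof. exact: measurable_itv. Qed.

Let mu0 : torus_lebesgue set0 = 0%E.
Proof. by rewrite /torus_lebesgue preimage_set0 set0I measure0. Qed.

Let mu_ge0 A : (0 <= torus_lebesgue A)%E. Proof. exact: measure_ge0. Qed.

Let mu_sigma_additive : semi_sigma_additive torus_lebesgue.
Proof.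
have := @measure_semi_sigma_additive _ _ _
  (pushforward (mrestr (@lebesgue_measure R) mI) (@torus_proj R)).
apply.
exact: measurable_torus_proj.
Qed.

HB.instance Definition _ := isMeasure.Build _ T R torus_lebesgue
  mu0 mu_ge0 mu_sigma_additive.

Lemma torus_lebesgueT : torus_lebesgue setT = (2 * pi)%:E.
Proof.
rewrite /torus_lebesgue preimage_setT setTI lebesgue_measure_itv/= lte_fin.
by rewrite gtrN ?pi_gt0// -EFinD opprK -mulr2n mulr_natl.
Qed.

Let mu_fin : fin_num_fun torus_lebesgue.
Proof.
move=> A mA; rewrite ge0_fin_numE//.
apply: (@le_lt_trans _ _ (torus_lebesgue setT)).
  by apply: le_measure; rewrite ?inE.
by rewrite torus_lebesgueT ltry.
Qed.

HB.instance Definition _ :=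
  Measure_isFinite.Build _ T R torus_lebesgue mu_fin.

Let inv2pi_ge0 : 0 <= (2 * pi)^-1 :> R.
Proof. by rewrite invr_ge0 mulr_ge0// pi_ge0. Qed.

(* m_1(dk) = dk / (2 pi) *)
Definition torus_m1 : {measure set T -> \bar R} :=
  mscale (NngNum inv2pi_ge0) torus_lebesgue.

End torus_measure.
Arguments torus_lebesgue : clear implicits.
Arguments torus_m1 : clear implicits.

Section total_variation.
Context d (T : measurableType d) (R : realType).

(* |nu|(T), which does not depend on the chosen Hahn decomposition *)
Definition tv_norm (nu : {charge set T -> \bar R}) : \bar R :=
  let PH := cid (Hahn_decomposition nu) in
  let NH := cid (svalP PH) in
  charge_variation (svalP NH) setT.

Definition tv_dist (mu nu : probability T R) : \bar R :=
  tv_norm (cadd (charge_of_finite_measure mu)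
                (copp (charge_of_finite_measure nu))).

End total_variation.

Section weak_convergence.
Context (R : realType).
Local Notation T := (torus R).

Definition weakly_cvg_pinfty (mu : R -> {measure set T -> \bar R})
    (l : {measure set T -> \bar R}) : Prop :=
  forall f : T -> R, continuous f -> [bounded f x | x in [set: T]] ->
    (\int[mu t]_x (f x)%:E @[t --> +oo%R] --> \int[l]_x (f x)%:E)%E.

Definition mu_star (k0 : T) : {measure set T -> \bar R} :=
  mscale (2^-1)%:nng (measure_add \d_k0 \d_(- k0)).

End weak_convergence.

Section coefficients.
Context (R : realType).
Local Notation T := (torus R).
Local Notation dk := (torus_lebesgue R).

(* r theta k is the density at theta of the jump law from k. *)
Record admissible_kernel (r : T -> T -> R) (r0 : R) : Prop := {
  kernel_continuous : continuous (fun x : T * T => r x.1 x.2) ;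
  kernel_r0_gt0 : 0 < r0 ;
  kernel_bounds : forall theta k, r0 <= r theta k <= r0^-1 ;
  kernel_even : forall theta k, r (- theta) (- k) = r theta k ;
  kernel_stochastic :
    forall k, (\int[dk]_theta (r theta k)%:E = 1)%E ;
  kernel_costochastic :
    forall k, (\int[dk]_theta (r k theta)%:E = 1)%E
}.

(* The infimum is taken in \bar R, so that it is +oo when no k is at distance
   at least delta; 0^-1 = 0 in R, but gamma only vanishes on the null set
   {- k0, k0}. *)
Record admissible_rate (gamma : T -> R) (k0 : T) (tstar : R) : Prop := {
  rate_ge0 : forall k, 0 <= gamma k ;
  rate_measurable : measurable_fun [set: T] gamma ;
  rate_even : forall k, gamma (- k) = gamma k ;
  rate_k0 : gamma k0 = 0 ;
  rate_inf_gt0 : forall delta, 0 < delta ->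
    (0 < ereal_inf [set (gamma k)%:E | k in
      [set k | (delta <= Num.min (torus_dist k k0)
                                 (torus_dist k (- k0)))%R]])%E ;
  rate_gt0 : forall k, k <> k0 -> k <> - k0 -> 0 < gamma k ;
  rate_tstar_gt0 : 0 < tstar ;
  rate_le : forall k, gamma k <= tstar^-1 ;
  rate_inv_not_integrable : (\int[dk]_k ((gamma k)^-1)%:E = +oo)%E
}.

End coefficients.

Section generated.
Context d (Omega : measurableType d) d' (E : measurableType d').

(* sigma(Y_i, i in D) *)
Definition generated (D : set nat) (Y : nat -> Omega -> E) :
    set (set Omega) :=
  <<s [set Y i @^-1` B | i in D & B in measurable] >>.

End generated.

Section jump_process.
Context (R : realType) d (Omega : measurableType d) (P : probability Omega R).
Local Notation T := (torus R).
Local Notation dk := (torus_lebesgue R).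

(* P(X_(n+1) in A | X_0, ..., X_n) = \int_A r(theta, X_n) dtheta a.s. *)
Definition markov_chain (r : T -> T -> R) (X : nat -> {RV P >-> T}) : Prop :=
  forall n F A, generated [set i | (i <= n)%N] X F -> measurable A ->
    (P (F `&` X n.+1 @^-1` A) =
     \int[P]_(w in F) \int[dk]_(theta in A) (r theta (X n w))%:E)%E.

Definition iid_exponential (rho : nat -> {RV P >-> R}) : Prop :=
  (forall n A, measurable A ->
     distribution P (rho n) A = exponential_prob 1 A) /\
  (forall (s : seq nat) (B : nat -> set R), uniq s ->
     (forall i, measurable (B i)) ->
     (P (\bigcap_(i in [set` s]) rho i @^-1` B i) =
      \prod_(i <- s) P (rho i @^-1` B i))%E).

Definition independent_sequences (X : nat -> {RV P >-> T})
    (rho : nat -> {RV P >-> R}) : Prop :=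
  forall F G, generated setT X F -> generated setT rho G ->
    P (F `&` G) = (P F * P G)%E.

Definition jump_time (gamma : T -> R) (X : nat -> {RV P >-> T})
    (rho : nat -> {RV P >-> R}) (n : nat) (w : Omega) : R :=
  \sum_(j < n) (gamma (X j w))^-1 * rho j w.

(* The relation between K and (X, rho) is only required almost surely: it is
   not consistent at the negligible w where some rho n w is negative, and says
   nothing at those where the jump times stay bounded. *)
Definition jump_process (r : T -> T -> R) (gamma : T -> R) (k0 : T)
    (K : R -> {RV P >-> T}) : Prop :=
  exists (X : nat -> {RV P >-> T}) (rho : nat -> {RV P >-> R}),
  [/\ (forall n w, X n w <> k0 /\ X n w <> - k0),
      markov_chain r X,
      iid_exponential rho,
      independent_sequences X rho &
      {ae P, forall w, forall n t,
        jump_time gamma X rho n w <= t < jump_time gamma X rho n.+1 w ->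
        K t w = X n w}].

End jump_process.
Arguments jump_process {R d Omega} P r gamma k0 K.

(* Main.v *)
(* Let [R h k = \int r theta k * h theta] and [S = I + (gamma / lam) (R - I)] with
   [lam] an upper bound of [gamma]: the semigroup of the process is uniformised as
   [P_t = e^-z sum_n z^n S^n / n!] with [z = lam t].  That the constructed process
   has this semigroup is seen by conditioning on the successive jumps, through
   Duhamel's formula for the first one.
   Shifting a Poisson law by one changes it by at most [1 / sqrt z] in total
   variation, so [gamma |R P_t h - P_t h|] tends to 0 uniformly in [0 <= h <= 1].
   Since [r >= r0], [R] contracts oscillations (Doeblin), hence [R P_t h] is
   asymptotically constant, and so is [P_t h] away from the null set of [gamma]:
   this gives complete mixing.
   The measure [dk / gamma] is invariant and has infinite mass, so the asymptotic
   constant for [h] the indicator of [gamma >= c] must be 0: the mass concentrates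
   at the zeros [k0] and [- k0] of [gamma], and the symmetry [k -> - k] together
   with mixing makes their weights equal. *)
From HB Require Import structures.
Require Import Defs.
From mathcomp Require Import all_boot all_order all_algebra.
From mathcomp Require Import all_classical all_reals all_analysis.
From mathcomp Require Import measurable_realfun ring lra.

Set Implicit Arguments.
Unset Strict Implicit.
Unset Printing Implicit Defensive.

Import Order.TTheory GRing.Theory Num.Theory.
Import numFieldNormedType.Exports.

Local Open Scope classical_set_scope.
Local Open Scope ring_scope.

(** * Poisson sums *)

Section exponential_generating_function.
Variable R : realType.
Implicit Types (a b : nat -> R) (z : R).

(** The invariant measure being infinite, there is no invariant probability density to converge to.
    What survives, uniformly, is that averaging over a Poisson number of steps makes [w = P_t h]
    almost harmonic: [gamma |R w - w| <= lam / sqrt z]. This says little where [gamma] is small, but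
    one application of [R] repairs that: jump laws have density at most [r0^-1], hence give little
    mass to [gamma <= delta]. So the estimates bear on [R w] rather than on [w], and [delta] is
    fixed before the time. They are uniform over measurable [h] with values in [0, 1]: indicators
    give total variation, continuous functions weak convergence. The other obstacle is that jump
    times mix the chain with the clocks. Reading the chain at [w] and the clocks at an independent
    [w'] separates them: with [w] frozen a clock is integrated by Duhamel's formula, with [w']
    frozen a state is integrated by the Markov property, and Tonelli alternates the two. *)

Definition egf a z : R := limn (pseries (fun n => a n / n`!%:R) z).

Definition ubounded a := exists M, forall n, `|a n| <= M.

Lemma egf_termE a z n :
  a n / n`!%:R * z ^+ n = a n * exp_coeff z n.
Proof. by rewrite /exp_coeff/= mulrAC mulrA. Qed.

Lemma is_cvg_egf a z : ubounded a ->
  cvgn (pseries (fun n => a n / n`!%:R) z).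
Proof.
move=> [M aM]; apply: normed_cvg.
apply: (@series_le_cvg _ _ (fun n => M * exp_coeff `|z| n)) => [n|n|n|].
- exact: normr_ge0.
- by rewrite mulr_ge0// ?exp_coeff_ge0// (le_trans _ (aM n)).
- rewrite /= egf_termE normrM /exp_coeff/= normrM normrX.
  rewrite [X in `|a n| * (_ * X)]ger0_norm//.
  by rewrite ler_wpM2r// mulr_ge0// exprn_ge0.
- by apply: is_cvg_seriesZ; exact: is_cvg_series_exp_coeff.
Qed.

Lemma cvg_egf a z : ubounded a ->
  pseries (fun n => a n / n`!%:R) z @ \oo --> egf a z.
Proof. exact: is_cvg_egf. Qed.

Lemma pseries_egfE a z n : pseries (fun n => a n / n`!%:R) z n =
  \sum_(k < n) a k * exp_coeff z k.
Proof.
rewrite /pseries /series/= big_mkord.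
by apply: eq_bigr => i _; rewrite egf_termE.
Qed.

Lemma cvg_sum_egf a z : ubounded a ->
  (fun n => \sum_(k < n) a k * exp_coeff z k) @ \oo --> egf a z.
Proof.
move=> /(@cvg_egf _ z); rewrite (_ : pseries _ z =
  (fun n => \sum_(k < n) a k * exp_coeff z k))//.
by apply/funext => n; rewrite pseries_egfE.
Qed.

Arguments cvg_sum_egf {a} z _.

Lemma ubounded_cst (c : R) : ubounded (fun=> c).
Proof. by exists `|c|. Qed.

Lemma ubounded_shift a : ubounded a -> ubounded (fun n => a n.+1).
Proof. by move=> [M aM]; exists M => n; exact: aM. Qed.

Lemma ubounded_lin (c e : R) a b : ubounded a -> ubounded b ->
  ubounded (fun n => c * a n + e * b n).
Proof.
move=> [M aM] [N bN]; exists (`|c| * M + `|e| * N) => n.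
rewrite (le_trans (ler_normD _ _))// !normrM.
by apply: lerD; rewrite ler_wpM2l.
Qed.

Lemma egf1 z : egf (fun=> 1) z = expR z.
Proof.
rewrite /egf /expR; congr (limn _); apply/funext => n.
rewrite pseries_egfE /series/= big_mkord.
by apply: eq_bigr => i _; rewrite mul1r.
Qed.

Lemma egf_lin (c e : R) a b z : ubounded a -> ubounded b ->
  egf (fun n => c * a n + e * b n) z = c * egf a z + e * egf b z.
Proof.
move=> ba bb; rewrite -(cvg_lim _ (cvg_sum_egf z (ubounded_lin c e ba bb)))//.
apply: cvg_lim => //.
rewrite [X in X @ _](_ : _ = (fun n => c * \sum_(k < n) a k * exp_coeff z k +
    e * \sum_(k < n) b k * exp_coeff z k)).
  by apply: cvgD; apply: cvgM; [exact: cvg_cst|exact: cvg_sum_egf|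
     exact: cvg_cst|exact: cvg_sum_egf].
apply/funext => n; rewrite !mulr_sumr -big_split/=.
by apply: eq_bigr => i _; rewrite mulrDl !mulrA.
Qed.

Lemma ler_egf a b z : 0 <= z -> ubounded a -> ubounded b ->
  (forall n, a n <= b n) -> egf a z <= egf b z.
Proof.
move=> z0 ba bb ab; apply: (ler_cvg_to (cvg_sum_egf z ba) (cvg_sum_egf z bb)).
apply: nearW => n; apply: ler_sum => i _.
by rewrite ler_wpM2r// exp_coeff_ge0.
Qed.

Lemma egf_sum_le a z n : 0 <= z -> ubounded a -> (forall n, 0 <= a n) ->
  \sum_(k < n) a k * exp_coeff z k <= egf a z.
Proof.
move=> z0 ba a0; rewrite -(cvg_lim _ (cvg_sum_egf z ba))//.
apply: (@nondecreasing_cvgn_le _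
  (fun n => \sum_(k < n) a k * exp_coeff z k)).
  apply/nondecreasing_seqP => m; rewrite big_ord_recr/= lerDl.
  by rewrite mulr_ge0// exp_coeff_ge0.
by apply/cvg_ex; eexists; exact: cvg_sum_egf.
Qed.

Lemma is_derive_egf a z : ubounded a ->
  is_derive z 1 (egf a) (egf (fun n => a n.+1) z).
Proof.
have diffsE b : pseries_diffs (fun n => b n / n`!%:R) =
    (fun n => b n.+1 / n`!%:R).
  apply/funext => n; rewrite /pseries_diffs factS natrM invfM mulrCA.
  by rewrite mulVKf.
(* [|z| + 1] is a point beyond [|z|] at which the series and its first two derived series
   converge. *)
move=> ba; have := @pseries_snd_diffs R (fun n => a n / n`!%:R) (`|z| + 1) z.
rewrite diffsE (diffsE (fun n => a n.+1)); apply.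
- exact: is_cvg_egf.
- exact/(@is_cvg_egf (fun n => a n.+1))/ubounded_shift.
- exact/(@is_cvg_egf (fun n => a n.+2))/(ubounded_shift (ubounded_shift _)).
- by rewrite [ltRHS]ger0_norm ?ltrDl// addr_ge0.
Qed.

Lemma continuous_egf a : ubounded a -> continuous (egf a).
Proof.
move=> ba z; apply/differentiable_continuous/derivable1_diffP.
by have [] := is_derive_egf z ba.
Qed.

Lemma exp_coeffS z n : n.+1%:R * exp_coeff z n.+1 = z * exp_coeff z n.
Proof.
rewrite /exp_coeff/= factS natrM exprS invfM.
by rewrite [X in _ * X = _]mulrCA mulVKf// mulrA.
Qed.

Lemma sum_exp_coeff_le z n : 0 <= z -> \sum_(k < n) exp_coeff z k <= expR z.
Proof.
move=> z0; rewrite -egf1.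
have := @egf_sum_le (fun=> 1) z n z0 (ubounded_cst 1) (fun=> ler01).
by under eq_bigr do rewrite mul1r.
Qed.

(* The variance of the Poisson distribution, truncated at [n.+2]. *)
Lemma sum_sqr_exp_coeff z n :
  \sum_(k < n.+2) (k%:R - z) ^+ 2 * exp_coeff z k =
  z * (\sum_(k < n.+1) exp_coeff z k) +
  z ^+ 2 * (exp_coeff z n.+1 - exp_coeff z n).
Proof.
elim: n => [|n ih].
  rewrite !big_ord_recr !big_ord0/= /exp_coeff/=.
  by rewrite expr0 expr1 !divr1; ring.
rewrite big_ord_recr/= ih.
rewrite [X in _ = _ * X + _]big_ord_recr/=.
have e1 := exp_coeffS z n; have e2 := exp_coeffS z n.+1.
have -> : (n.+2%:R - z) ^+ 2 * exp_coeff z n.+2 =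
    n.+2%:R * (n.+2%:R * exp_coeff z n.+2) - 2 * z * (n.+2%:R * exp_coeff z n.+2)
    + z ^+ 2 * exp_coeff z n.+2 by ring.
rewrite e2.
have -> : n.+2%:R * (z * exp_coeff z n.+1) =
    z * (n.+1%:R * exp_coeff z n.+1) + z * exp_coeff z n.+1.
  by rewrite -[n.+2]addn1 natrD; ring.
by rewrite e1; ring.
Qed.

(** Stein's identity [E(N a(N)) = z E(a(N+1))] for a Poisson variable [N], truncated: [k z^k / k!]
    is [z] times the previous coefficient, and reindexing shifts [a]. *)
Lemma sum_shift_exp_coeff a z n :
  \sum_(k < n.+1) a k * (k%:R - z) * exp_coeff z k =
  z * (\sum_(k < n) a k.+1 * exp_coeff z k -
       \sum_(k < n.+1) a k * exp_coeff z k).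
Proof.
have -> : \sum_(k < n.+1) a k * (k%:R - z) * exp_coeff z k =
    \sum_(k < n.+1) a k * (k%:R * exp_coeff z k) -
    z * \sum_(k < n.+1) a k * exp_coeff z k.
  rewrite mulr_sumr -sumrB; apply: eq_bigr => i _; ring.
rewrite mulrBr; congr (_ - _).
rewrite big_ord_recl/= mul0r mulr0 add0r mulr_sumr.
by apply: eq_bigr => i _; rewrite exp_coeffS; ring.
Qed.

(* Up to the factor [expR (- z)] this is the total variation distance between
   the Poisson law and its translate; Cauchy-Schwarz bounds it by the standard
   deviation divided by [z]. *)
Lemma egf_shift_le a z : 0 < z -> (forall n, `|a n| <= 1) ->
  `|egf (fun n => a n.+1) z - egf a z| <= expR z / Num.sqrt z.
Proof.
move=> z0 a1; have ba : ubounded a by exists 1.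
set s := Num.sqrt z; have s0 : 0 < s by rewrite sqrtr_gt0.
have zE : z = s ^+ 2 by rewrite sqr_sqrtr// ltW.
rewrite -(ler_pM2l z0) -{1}(gtr0_norm z0) -normrM.
have c1 : (fun n => \sum_(k < n.+3) a k * (k%:R - z) * exp_coeff z k) @ \oo -->
    z * (egf (fun n => a n.+1) z - egf a z).
  under eq_fun do rewrite sum_shift_exp_coeff.
  apply: cvgM; first exact: cvg_cst.
  pose F n := \sum_(k < n) a k.+1 * exp_coeff z k.
  pose G n := \sum_(k < n) a k * exp_coeff z k.
  apply: (@cvgB _ _ _ _ _ (fun n => F n.+2) (fun n => G n.+3)).
    rewrite (cvg_shiftS (fun n => F n.+1)) (cvg_shiftS F).
    exact: (cvg_sum_egf z (ubounded_shift ba)).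
  rewrite (cvg_shiftS (fun n => G n.+2)) (cvg_shiftS (fun n => G n.+1)).
  rewrite (cvg_shiftS G).
  exact: (cvg_sum_egf z ba).
(* The truncated variance leaves a boundary term in [exp_coeff], which vanishes as the truncation is
   lifted. *)
have c4 : (fun n => s * expR z + s / 2 * z * (exp_coeff z n.+2 - exp_coeff z n.+1)) @ \oo
    --> s * expR z.
  rewrite -[X in _ --> X]addr0.
  apply: cvgD; first exact: cvg_cst.
  rewrite -[X in _ --> X](mulr0 (s / 2 * z)).
  apply: cvgM; first exact: cvg_cst.
  rewrite -[X in _ --> X](subr0 0).
  have ec := @cvg_exp_coeff R z.
  apply: cvgB.
    by rewrite (cvg_shiftS (fun n => exp_coeff z n.+1)) (cvg_shiftS (exp_coeff z)).
  by rewrite (cvg_shiftS (exp_coeff z)).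
have -> : z * (expR z / s) = s * expR z.
  by rewrite zE; field; rewrite gt_eqF.
apply: (ler_cvg_to (cvg_norm c1) c4); apply: nearW => n.
rewrite (le_trans (ler_norm_sum _ _ _))//.
(* Cauchy-Schwarz is applied in the form [|y| <= y^2 / (2 s) + s / 2]; taking for [s] the standard
   deviation [sqrt z] balances the two halves, each summing to [s / 2 * expR z] in the limit. *)
apply: (@le_trans _ _ (\sum_(k < n.+3) ((2 * s)^-1 * ((k%:R - z) ^+ 2 * exp_coeff z k)
   + s / 2 * exp_coeff z k))).
  apply: ler_sum => i _; rewrite [X in _ <= X + _]mulrA -mulrDl normrM.
  rewrite (ger0_norm (exp_coeff_ge0 _ (ltW z0))).
  apply: ler_wpM2r; first by rewrite exp_coeff_ge0// ltW.
  rewrite normrM.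
  apply: (@le_trans _ _ `|i%:R - z|); first by rewrite ler_piMl.
  set y := i%:R - z.
  rewrite -subr_ge0 -real_normK ?num_real//.
  have -> : (2 * s)^-1 * `|y| ^+ 2 + s / 2 - `|y| =
    (2 * s)^-1 * (`|y| - s) ^+ 2 by field; rewrite gt_eqF.
  by rewrite mulr_ge0 ?sqr_ge0// invr_ge0 mulr_ge0// ltW.
rewrite big_split/= -!mulr_sumr sum_sqr_exp_coeff.
have h1 := sum_exp_coeff_le n.+2 (ltW z0).
have h2 := sum_exp_coeff_le n.+3 (ltW z0).
set S2 := \sum_(k < n.+2) _ in h1 *; set S3 := \sum_(k < n.+3) _ in h2 *.
set D := _ - _; rewrite mulrDr.
have -> : (2 * s)^-1 * (z * S2) = s / 2 * S2.
  by rewrite zE; field; rewrite gt_eqF.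
have -> : (2 * s)^-1 * (z ^+ 2 * D) = s / 2 * z * D.
  by rewrite zE; field; rewrite gt_eqF.
rewrite addrAC lerD2r -mulrDr.
apply: (@le_trans _ _ (s / 2 * (expR z + expR z))).
  by rewrite ler_wpM2l ?lerD// divr_ge0// ltW.
by rewrite le_eqVlt; apply/orP; left; apply/eqP; field.
Qed.

End exponential_generating_function.

(** * The uniformised semigroup *)

(** The abstract setting: of the torus it keeps a measure and a measurable doubly stochastic kernel.
    Symmetry, the null set of the rate and the divergence of its inverse are added where they
    act. *)
Record jump_coefficients (R : realType) d (T : measurableType d)
    (mu : {measure set T -> \bar R}) (r : T -> T -> R) (r0 : R)
    (gamma : T -> R) (lam : R) : Prop := {
  jc_measurable : measurable_fun [set: T * T] (fun x => r x.1 x.2) ;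
  jc_r0_gt0 : 0 < r0 ;
  jc_bounds : forall theta k, r0 <= r theta k <= r0^-1 ;
  jc_stochastic : forall k, (\int[mu]_theta (r theta k)%:E = 1)%E ;
  jc_costochastic : forall k, (\int[mu]_theta (r k theta)%:E = 1)%E ;
  jc_rate_measurable : measurable_fun [set: T] gamma ;
  jc_rate_ge0 : forall k, 0 <= gamma k ;
  jc_lam_gt0 : 0 < lam ;
  jc_rate_le : forall k, gamma k <= lam
}.

(** * Bounded measurable test functions *)

Section bounded_measurable.
Context (R : realType) d (T : measurableType d).
Implicit Types h : T -> R.

Definition bmf h := measurable_fun [set: T] h /\ exists M, forall x, `|h x| <= M.

(** The class is stable under Markov operators; it contains the indicators, for total variation,
    and, after an affine rescaling, the bounded continuous functions, for weak convergence. *)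
Definition unit_fun h := measurable_fun [set: T] h /\ forall x, 0 <= h x <= 1.

Lemma unit_fun_bmf h : unit_fun h -> bmf h.
Proof.
move=> [mh h01]; split=> //; exists 1 => x.
by have /andP[h0 h1] := h01 x; rewrite ger0_norm.
Qed.

Lemma unit_fun_indic (A : set T) : measurable A -> unit_fun \1_A.
Proof.
move=> mA; split=> [|x]; first exact: measurable_indic.
by rewrite indicE; case: (x \in A); rewrite ?lexx ?ler01.
Qed.

Lemma bmf_lin (c e : R) h h' : bmf h -> bmf h' ->
  bmf (fun x => c * h x + e * h' x).
Proof.
move=> [mh [M hM]] [mh' [M' hM']]; split.
  by apply: measurable_funD; apply: measurable_funM.
exists (`|c| * M + `|e| * M') => x.
rewrite (le_trans (ler_normD _ _))// !normrM.
by apply: lerD; rewrite ler_wpM2l.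
Qed.

Lemma bmf_cst (c : R) : bmf (cst c).
Proof. by split => //; exists `|c|. Qed.

Lemma bmfM h h' : bmf h -> bmf h' -> bmf (fun x => h x * h' x).
Proof.
move=> [mh [M hM]] [mh' [M' hM']]; split; first exact: measurable_funM.
by exists (M * M') => x; rewrite normrM ler_pM.
Qed.

Lemma bmf_norm h : bmf h -> bmf (fun x => `|h x|).
Proof.
move=> [mh [M hM]]; split; first exact: measurableT_comp.
by exists M => x; rewrite normr_id.
Qed.

Lemma bmf_sum n (c : nat -> R) (h : nat -> T -> R) : (forall k, bmf (h k)) ->
  bmf (fun x => \sum_(k < n) c k * h k x).
Proof.
move=> bh; elim: n => [|n ih].
  by under eq_fun do rewrite big_ord0; exact: bmf_cst.
under eq_fun do rewrite big_ord_recr/= -[X in X + _]mul1r.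
exact: bmf_lin.
Qed.

Lemma bmf_integrable (mu : {finite_measure set T -> \bar R}) h : bmf h ->
  mu.-integrable [set: T] (EFin \o h).
Proof.
move=> [mh [M hM]]; apply: measurable_bounded_integrable => //.
  by rewrite -ge0_fin_numE// fin_num_measure.
exists M; split; first exact: num_real.
by move=> N MN x _; apply: (le_trans (hM x)); exact: ltW.
Qed.

End bounded_measurable.

(** * The jump operator and the Poisson series of the uniformised chain *)

Section transition_operator.
Context (R : realType) d (T : measurableType d).
Variable (mu : {finite_measure set T -> \bar R}).
Variables (r : T -> T -> R) (r0 : R) (gamma : T -> R) (lam : R).
Hypothesis jc : jump_coefficients mu r r0 gamma lam.
Implicit Types (h w : T -> R) (z : R).

Definition Rop h k : R := \int[mu]_theta (r theta k * h theta).

Lemma kernel_ge0 theta k : 0 <= r theta k.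
Proof.
by have /andP[+ _] := jc_bounds jc theta k; apply: le_trans; exact/ltW/(jc_r0_gt0 jc).
Qed.

Lemma measurable_kernel_l k : measurable_fun [set: T] (r ^~ k).
Proof.
exact: (measurableT_comp (jc_measurable jc) (pair2_measurable k)).
Qed.

Lemma measurable_kernel_r theta : measurable_fun [set: T] (r theta).
Proof.
exact: (measurableT_comp (jc_measurable jc) (pair1_measurable theta)).
Qed.

Lemma bmf_kernel k : bmf (r ^~ k).
Proof.
split; first exact: measurable_kernel_l.
exists r0^-1 => x; rewrite ger0_norm ?kernel_ge0//.
by have /andP[] := jc_bounds jc x k.
Qed.

Lemma Rop_integrable h k : bmf h ->
  mu.-integrable [set: T] (EFin \o (fun theta => r theta k * h theta)).
Proof. by move=> bh; apply: bmf_integrable; exact/bmfM/bh/bmf_kernel. Qed.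

Lemma Rop_EFin h k : bmf h ->
  ((Rop h k)%:E = \int[mu]_theta (r theta k * h theta)%:E)%E.
Proof.
move=> bh; rewrite /Rop /Rintegral fineK//.
exact: (integrable_fin_num measurableT (Rop_integrable k bh)).
Qed.

Lemma Rop_lin (c e : R) h h' k : bmf h -> bmf h' ->
  Rop (fun x => c * h x + e * h' x) k = c * Rop h k + e * Rop h' k.
Proof.
move=> bh bh'; rewrite /Rop.
rewrite -!RintegralZl//; [|exact: Rop_integrable..].
rewrite -RintegralD//.
- by apply: eq_Rintegral => x _; ring.
- apply: (@bmf_integrable _ _ _ mu (fun x => c * (r x k * h x))).
  by apply: bmfM; [exact: bmf_cst|apply: bmfM => //; exact: bmf_kernel].
- apply: (@bmf_integrable _ _ _ mu (fun x => e * (r x k * h' x))).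
  by apply: bmfM; [exact: bmf_cst|apply: bmfM => //; exact: bmf_kernel].
Qed.

Lemma Rop_cst (c : R) k : Rop (cst c) k = c.
Proof.
rewrite /Rop RintegralZr//; last exact: (bmf_integrable mu (bmf_kernel k)).
by rewrite /Rintegral (jc_stochastic jc) mul1r.
Qed.

Lemma ler_Rop h h' k : bmf h -> bmf h' -> (forall x, h x <= h' x) ->
  Rop h k <= Rop h' k.
Proof.
move=> bh bh' hh'; apply: le_Rintegral => //; [exact: Rop_integrable..|].
by move=> x _; rewrite ler_wpM2l// kernel_ge0.
Qed.

Lemma Rop_sum n (c : nat -> R) (h : nat -> T -> R) k : (forall i, bmf (h i)) ->
  Rop (fun x => \sum_(i < n) c i * h i x) k = \sum_(i < n) c i * Rop (h i) k.
Proof.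
move=> bh; elim: n => [|n ih].
  by rewrite big_ord0; under [X in Rop X]eq_fun do rewrite big_ord0; exact: Rop_cst.
rewrite big_ord_recr/= -ih -[X in X + _]mul1r -Rop_lin//; last exact: bmf_sum.
by congr (Rop _ k); apply/funext => x; rewrite big_ord_recr/= mul1r.
Qed.

Lemma unit_fun_bounds h : unit_fun h -> forall x, 0 <= h x <= 1.
Proof. by case. Qed.

Lemma measurable_Rop_ge0 h : bmf h -> (forall x, 0 <= h x) ->
  measurable_fun [set: T] (Rop h).
Proof.
move=> bh h0; apply/measurable_EFinP => /=.
rewrite (_ : EFin \o Rop h =
    fubini_F mu (fun x : T * T => (r x.2 x.1 * h x.2)%:E)); last first.
  by apply/funext => x/=; rewrite Rop_EFin.
apply: measurable_fun_fubini_tonelli_F => [|x]; last first.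
  by rewrite lee_fin mulr_ge0// kernel_ge0.
apply/measurable_EFinP; apply: measurable_funM.
  exact: (measurableT_comp (jc_measurable jc) (@measurable_swap _ _ T T)).
by case: bh => mh _; exact: (measurableT_comp mh measurable_snd).
Qed.

Lemma unit_fun_Rop h : unit_fun h -> unit_fun (Rop h).
Proof.
move=> uh; have bh := unit_fun_bmf uh.
split; first by apply: measurable_Rop_ge0 => // x; case/andP: (unit_fun_bounds uh x).
move=> x; rewrite -{1}(Rop_cst 0 x) -(Rop_cst 1 x).
by apply/andP; split; apply: ler_Rop => //; try exact: bmf_cst;
  move=> y; case/andP: (unit_fun_bounds uh y).
Qed.

Definition Sop h k : R := h k + gamma k / lam * (Rop h k - h k).

Lemma rate_ratio k : 0 <= gamma k / lam <= 1.
Proof.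
have l0 := jc_lam_gt0 jc.
rewrite divr_ge0 ?(jc_rate_ge0 jc) ?(ltW l0)//=.
by rewrite ler_pdivrMr// mul1r (jc_rate_le jc).
Qed.

(** [Sop h x] is a convex combination of [h x] and [Rop h x]: this is where [gamma <= lam]
    enters. *)
Lemma unit_fun_Sop h : unit_fun h -> unit_fun (Sop h).
Proof.
move=> uh; have [mR R01] := unit_fun_Rop uh; split.
  case: uh => mh _; apply: measurable_funD => //; apply: measurable_funM.
    by apply: measurable_funM => //; exact: (jc_rate_measurable jc).
  exact: measurable_funB.
move=> x; have /andP[h0 h1] := unit_fun_bounds uh x.
have /andP[R0 R1] := R01 x; have /andP[g0 g1] := rate_ratio x.
by rewrite /Sop; apply/andP; split; nra.
Qed.

Lemma unit_fun_iter h n : unit_fun h -> unit_fun (iter n Sop h).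
Proof. by move=> uh; elim: n => [//|n ih] /=; exact: unit_fun_Sop. Qed.

(* In the time variable [z = lam * t] this is the transition semigroup. *)
Definition semig z h x : R := expR (- z) * egf (fun n => iter n Sop h x) z.

Lemma ubounded_iter h x : unit_fun h -> ubounded (fun n => iter n Sop h x).
Proof.
move=> uh; exists 1 => n.
by have /andP[h0 h1] := unit_fun_bounds (unit_fun_iter n uh) x; rewrite ger0_norm.
Qed.

Lemma ubounded_Rop_iter h x : unit_fun h ->
  ubounded (fun n => Rop (iter n Sop h) x).
Proof.
move=> uh; exists 1 => n.
have /andP[h0 h1] := unit_fun_bounds (unit_fun_Rop (unit_fun_iter n uh)) x.
by rewrite ger0_norm.
Qed.

Definition semig_sum z h n x : R :=
  expR (- z) * \sum_(k < n) iter k Sop h x * exp_coeff z k.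

Lemma measurable_semig_sum z h n : unit_fun h ->
  measurable_fun [set: T] (semig_sum z h n).
Proof.
move=> uh; apply: measurable_funM => //; apply: measurable_sum => i.
by apply: measurable_funM => //; case: (unit_fun_iter i uh).
Qed.

Lemma cvg_semig_sum z h x : unit_fun h ->
  semig_sum z h n x @[n --> \oo] --> semig z h x.
Proof.
move=> uh; apply: cvgM; first exact: cvg_cst.
exact: cvg_sum_egf (ubounded_iter _ uh).
Qed.

Lemma semig_sum_le z h n x : 0 <= z -> unit_fun h ->
  semig_sum z h n x <= semig z h x.
Proof.
move=> z0 uh; rewrite ler_wpM2l ?expR_ge0// egf_sum_le//.
  exact: ubounded_iter.
by move=> k; case/andP: (unit_fun_bounds (unit_fun_iter k uh) x).
Qed.

(** The terms [1 - S^k h x] are nonnegative, so [egf_sum_le] applies to them and truncation errs by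
    at most a Poisson tail. The bound does not depend on [x], which lets [Rop] pass to the limit in
    [Rop_semig]. *)
Lemma semig_sum_ge z h n x : 0 <= z -> unit_fun h ->
  semig z h x <=
  semig_sum z h n x + expR (- z) * (expR z - \sum_(k < n) exp_coeff z k).
Proof.
move=> z0 uh; rewrite -mulrDr ler_wpM2l ?expR_ge0//.
have ub := ubounded_iter x uh.
have ubc := ubounded_cst (1 : R).
have := @egf_sum_le _ (fun k => 1 * 1 + (-1) * iter k Sop h x) z n z0
  (ubounded_lin 1 (-1) ubc ub).
rewrite (egf_lin 1 (-1) z ubc ub) egf1.
under eq_bigr do rewrite mulN1r mulr1 mulrBl mul1r.
rewrite sumrB mul1r mulN1r => le.
suff p k : 0 <= 1 + (-1) * iter k Sop h x by have := le p; lra.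
by rewrite mulN1r subr_ge0; case/andP: (unit_fun_bounds (unit_fun_iter k uh) x).
Qed.

Lemma unit_fun_semig z h : 0 <= z -> unit_fun h -> unit_fun (semig z h).
Proof.
move=> z0 uh; split.
  apply: (@measurable_fun_cvg _ _ _ _ (fun n => semig_sum z h n)) => [n|].
    exact: measurable_semig_sum.
  by move=> x _; exact: cvg_semig_sum.
move=> x; apply/andP; split.
  rewrite (le_trans _ (semig_sum_le 0 x z0 uh))//.
  by rewrite /semig_sum big_ord0 mulr0.
rewrite (le_trans (semig_sum_ge 0 x z0 uh))//.
by rewrite /semig_sum !big_ord0 mulr0 add0r subr0 -expRD addNr expR0.
Qed.

(** On truncated sums this is linearity. Since [semig] lies between the truncated sum and the same
    plus a constant tending to 0, monotonicity of [Rop] squeezes the limit. *)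
Lemma Rop_semig z h x : 0 <= z -> unit_fun h ->
  Rop (semig z h) x = expR (- z) * egf (fun n => Rop (iter n Sop h) x) z.
Proof.
move=> z0 uh; have buh k := unit_fun_bmf (unit_fun_iter k uh).
have RE n : Rop (semig_sum z h n) x =
    expR (- z) * \sum_(k < n) Rop (iter k Sop h) x * exp_coeff z k.
  transitivity (Rop (fun y => \sum_(k < n)
      expR (- z) * exp_coeff z k * iter k Sop h y) x).
    congr (Rop _ x); apply/funext => y; rewrite /semig_sum mulr_sumr.
    by apply: eq_bigr => i _; ring.
  rewrite (Rop_sum n (fun k => expR (- z) * exp_coeff z k) x buh) mulr_sumr.
  by apply: eq_bigr => i _; ring.
have bw := unit_fun_bmf (unit_fun_semig z0 uh).
have bs n : bmf (semig_sum z h n).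
  apply: unit_fun_bmf; split; first exact: measurable_semig_sum.
  move=> y; have /andP[_ h1] := unit_fun_bounds (unit_fun_semig z0 uh) y.
  rewrite (le_trans (semig_sum_le n y z0 uh) h1) andbT.
  rewrite mulr_ge0 ?expR_ge0// sumr_ge0// => i _.
  rewrite mulr_ge0 ?exp_coeff_ge0//.
  by case/andP: (unit_fun_bounds (unit_fun_iter i uh) y).
have c1 : Rop (semig_sum z h n) x @[n --> \oo] -->
    expR (- z) * egf (fun n => Rop (iter n Sop h) x) z.
  under eq_fun do rewrite RE.
  apply: cvgM; first exact: cvg_cst.
  exact: cvg_sum_egf (ubounded_Rop_iter _ uh).
have c2 : Rop (semig_sum z h n) x +
    expR (- z) * (expR z - \sum_(k < n) exp_coeff z k) @[n --> \oo] -->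
    expR (- z) * egf (fun n => Rop (iter n Sop h) x) z.
  rewrite -[X in _ --> X]addr0; apply: cvgD => //.
  rewrite -[X in _ --> X](mulr0 (expR (- z))); apply: cvgM; first exact: cvg_cst.
  rewrite -[X in _ --> X](subrr (expR z)); apply: cvgB; first exact: cvg_cst.
  rewrite (_ : (fun n => _) = (fun n => \sum_(k < n) 1 * exp_coeff z k)).
    by rewrite -egf1; exact: cvg_sum_egf (ubounded_cst 1).
  by apply/funext => n; apply: eq_bigr => i _; rewrite mul1r.
apply/eqP; rewrite eq_le; apply/andP; split.
  apply: (ler_cvg_to (cvg_cst _) c2); apply: nearW => n.
  rewrite -[X in _ <= _ + X](Rop_cst _ x) -[X in _ <= X + _]mul1r.
  rewrite -[X in _ <= _ + X]mul1r -Rop_lin//; last exact: bmf_cst.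
  apply: ler_Rop => //; first by apply: bmf_lin => //; exact: bmf_cst.
  by move=> y; rewrite !mul1r; exact: semig_sum_ge.
apply: (ler_cvg_to c1 (cvg_cst _)); apply: nearW => n.
by apply: ler_Rop => // y; exact: semig_sum_le.
Qed.

(** Kolmogorov's backward equation: differentiating the series shifts [S^n h] to [S^(n+1) h], the
    factor [expR (- z)] subtracts the unshifted series, and [S - I = (gamma / lam) (R - I)]. *)
Lemma is_derive_semig z h x : 0 <= z -> unit_fun h ->
  is_derive z (1 : R) (fun z : R => semig z h x)
    (gamma x / lam * (Rop (semig z h) x - semig z h x)).
Proof.
move=> z0 uh; set a := fun n => iter n Sop h x.
have ba : ubounded a := ubounded_iter x uh.
have bb := ubounded_Rop_iter x uh.
have aS : (fun n => a n.+1) = (fun n => (1 - gamma x / lam) * a n +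
    gamma x / lam * Rop (iter n Sop h) x).
  by apply/funext => n; rewrite /a/= {1}/Sop; ring.
have de := is_derive_egf z ba.
have -> : gamma x / lam * (Rop (semig z h) x - semig z h x) =
   expR (- z) * egf (fun n => a n.+1) z + egf a z * (- expR (- z)).
  by rewrite aS egf_lin// Rop_semig// /semig -/a; ring.
have d1 : is_derive z (1 : R) (fun z : R => expR (- z)) (- expR (- z)).
  have := @is_derive1_comp R expR -%R z (expR (- z)) (-1) (is_derive_expR _) _.
  by rewrite mulrN1; apply.
exact: (is_deriveM d1 de).
Qed.

(** The quantity bounded is [E(a(N+1) - a(N))] with [N] Poisson of mean [z] and [a n = S^n h x], so
    [egf_shift_le] applies. *)
Lemma semig_residual z h x : 0 < z -> unit_fun h ->
  `|gamma x / lam * (Rop (semig z h) x - semig z h x)| <= (Num.sqrt z)^-1.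
Proof.
move=> z0 uh; set a := fun n => iter n Sop h x.
have ba : ubounded a := ubounded_iter x uh.
have bb := ubounded_Rop_iter x uh.
have aS : (fun n => a n.+1) = (fun n => (1 - gamma x / lam) * a n +
    gamma x / lam * Rop (iter n Sop h) x).
  by apply/funext => n; rewrite /a/= {1}/Sop; ring.
have -> : gamma x / lam * (Rop (semig z h) x - semig z h x) =
   expR (- z) * (egf (fun n => a n.+1) z - egf a z).
  by rewrite aS egf_lin// Rop_semig// ?ltW// /semig -/a; ring.
rewrite normrM gtr0_norm ?expR_gt0//.
have := @egf_shift_le _ a z z0.
rewrite -(ler_pM2l (expR_gt0 (- z))) mulrA -expRD addNr expR0 mul1r; apply.
by move=> n; have /andP[? ?] := unit_fun_bounds (unit_fun_iter n uh) x;
  rewrite ger0_norm.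
Qed.


End transition_operator.

(** * Symmetry and the invariant measure *)

Section semigroup_properties.
Context (R : realType) d (T : measurableType d).
Variable (mu : {finite_measure set T -> \bar R}).
Variables (r : T -> T -> R) (r0 : R) (gamma : T -> R) (lam : R).
Hypothesis jc : jump_coefficients mu r r0 gamma lam.
Implicit Types (h w : T -> R) (z : R).
Local Notation Rop := (Rop mu r).
Local Notation Sop := (Sop mu r gamma lam).
Local Notation semig := (semig mu r gamma lam).

Lemma iter_Sop_lin (c e : R) h h' n : unit_fun h -> unit_fun h' ->
  iter n Sop (fun x => c * h x + e * h' x) =
  (fun x => c * iter n Sop h x + e * iter n Sop h' x).
Proof.
move=> uh uh'; elim: n => [//|n ih]; rewrite iterS ih; apply/funext => x.
have b1 := unit_fun_bmf (unit_fun_iter jc n uh).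
have b2 := unit_fun_bmf (unit_fun_iter jc n uh').
by rewrite /Sop (Rop_lin jc)//=; ring.
Qed.

Lemma semig_lin (c e : R) h h' z x : unit_fun h -> unit_fun h' ->
  semig z (fun x => c * h x + e * h' x) x = c * semig z h x + e * semig z h' x.
Proof.
move=> uh uh'; rewrite /semig.
under eq_fun do rewrite (iter_Sop_lin c e)//.
rewrite egf_lin; first by ring.
- exact: (ubounded_iter jc x uh).
- exact: (ubounded_iter jc x uh').
Qed.

(** A maximum principle for signed functions, which are not [unit_fun]: they enter as combinations
    of two test functions, so one-sided bounds such as [g - \1_A <= M] can be propagated. *)
Lemma iter_Sop_lin_le (c e M : R) h h' n : unit_fun h -> unit_fun h' ->
  (forall x, c * h x + e * h' x <= M) ->
  forall x, c * iter n Sop h x + e * iter n Sop h' x <= M.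
Proof.
move=> uh uh' hM; elim: n => [//|n ih] x.
have b1 := unit_fun_bmf (unit_fun_iter jc n uh).
have b2 := unit_fun_bmf (unit_fun_iter jc n uh').
have RM := ler_Rop jc x (bmf_lin c e b1 b2) (bmf_cst _ M) ih.
rewrite (Rop_lin jc)// (Rop_cst jc) in RM.
have /andP[q0 q1] := rate_ratio jc x.
have := ih x; rewrite /= /Sop.
set q := gamma x / lam in q0 q1 *; set a := iter n Sop h x.
set b := iter n Sop h' x => ab.
have -> : c * (a + q * (Rop (iter n Sop h) x - a)) +
    e * (b + q * (Rop (iter n Sop h') x - b)) =
    (1 - q) * (c * a + e * b) +
    q * (c * Rop (iter n Sop h) x + e * Rop (iter n Sop h') x) by ring.
have -> : M = (1 - q) * M + q * M by ring.
by apply: lerD; apply: ler_wpM2l => //; rewrite subr_ge0.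
Qed.

Lemma semig_lin_le (c e M : R) h h' z x : 0 <= z ->
  unit_fun h -> unit_fun h' -> (forall x, c * h x + e * h' x <= M) ->
  c * semig z h x + e * semig z h' x <= M.
Proof.
move=> z0 uh uh' hM; rewrite -semig_lin// /semig.
under eq_fun do rewrite (iter_Sop_lin c e)//.
have u1 := ubounded_iter jc x uh; have u2 := ubounded_iter jc x uh'.
have ubl := ubounded_lin c e u1 u2.
have ubm : ubounded (fun n : nat => M * 1 + 0 * 1).
  exact: (ubounded_lin M 0 (ubounded_cst 1) (ubounded_cst 1)).
have : egf (fun n => c * iter n Sop h x + e * iter n Sop h' x) z <=
       egf (fun n => M * 1 + 0 * 1) z.
  apply: ler_egf => // n; rewrite mul0r addr0 mulr1.
  exact: iter_Sop_lin_le.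
rewrite (@egf_lin _ M 0 (fun=> 1) (fun=> 1)); [|exact: ubounded_cst..].
rewrite egf1 mul0r addr0 => le.
rewrite -[M]mul1r -(expR0) -(addNr z) expRD -mulrA.
by rewrite ler_wpM2l ?expR_ge0// mulrC.
Qed.

(** * Symmetries of the coefficients *)

Section symmetry.
Variable s : T -> T.
Hypothesis ms : measurable_fun [set: T] s.
Hypothesis mus : forall g : T -> R, measurable_fun [set: T] g ->
  (forall x, 0 <= g x) ->
  (\int[mu]_x (g (s x))%:E = \int[mu]_x (g x)%:E)%E.
Hypothesis rs : forall theta k, r (s theta) (s k) = r theta k.
Hypothesis gs : forall k, gamma (s k) = gamma k.

Lemma unit_fun_comp h : unit_fun h -> unit_fun (h \o s).
Proof.
by move=> [mh h01]; split; [exact: measurableT_comp|move=> x; exact: h01].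
Qed.

Lemma Rop_comp h k : unit_fun h -> Rop (h \o s) k = Rop h (s k).
Proof.
move=> uh; rewrite /Rop /Rintegral.
rewrite -(@mus (fun theta => r theta (s k) * h theta)).
- by congr fine; apply: eq_integral => x _; rewrite rs.
- apply: measurable_funM; first exact: (measurable_kernel_l jc _).
  by case: uh.
- move=> x; rewrite mulr_ge0 ?(kernel_ge0 jc)//.
  by case/andP: (unit_fun_bounds uh x).
Qed.

Lemma iter_Sop_comp h n : unit_fun h ->
  iter n Sop (h \o s) = iter n Sop h \o s.
Proof.
move=> uh; elim: n => [//|n ih]; rewrite iterS ih; apply/funext => x.
by rewrite /Sop/= Rop_comp ?gs//; exact: (unit_fun_iter jc).
Qed.

Lemma semig_comp z h x : unit_fun h -> semig z (h \o s) x = semig z h (s x).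
Proof.
move=> uh; rewrite /semig; congr (_ * egf _ _).
by apply/funext => n; rewrite iter_Sop_comp.
Qed.

End symmetry.

Lemma measurable_rate_set (E : set R) : measurable E ->
  measurable [set k | E (gamma k)].
Proof.
by move=> mE; rewrite -[X in measurable X]setTI; exact: (jc_rate_measurable jc).
Qed.

Lemma measurable_rate_gt c : measurable [set k | c < gamma k].
Proof.
have := @measurable_rate_set `]c, +oo[%classic (measurable_itv _).
by under [X in measurable X -> _]eq_set do rewrite /= in_itv/= andbT.
Qed.

Lemma measurable_rate_le c : measurable [set k | gamma k <= c].
Proof.
have := @measurable_rate_set `]-oo, c]%classic (measurable_itv _).
by under [X in measurable X -> _]eq_set do rewrite /= in_itv/=.
Qed.

Lemma measurable_rate_ge c : measurable [set k | c <= gamma k].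
Proof.
have := @measurable_rate_set `[c, +oo[%classic (measurable_itv _).
by under [X in measurable X -> _]eq_set do rewrite /= in_itv/= andbT.
Qed.

Lemma measurable_inv_rate : measurable_fun [set: T] (fun k => (gamma k)^-1).
Proof.
under eq_fun do rewrite -powR_inv1 ?(jc_rate_ge0 jc)//.
apply: (measurableT_comp (measurable_powR (-1))).
exact: (jc_rate_measurable jc).
Qed.

(** Tonelli, and integration of the kernel in its second variable: [mu] is invariant for the jump
    chain. *)
Lemma integral_Rop h : unit_fun h ->
  (\int[mu]_k (Rop h k)%:E = \int[mu]_k (h k)%:E)%E.
Proof.
move=> uh; have bh := unit_fun_bmf uh.
have h0 x : 0 <= h x by case/andP: (unit_fun_bounds uh x).
under eq_integral do rewrite (Rop_EFin jc)//.
rewrite (@fubini_tonelli _ _ _ _ _ mu mu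
  (fun x : T * T => (r x.2 x.1 * h x.2)%:E))/=.
- apply: eq_integral => x _.
  under eq_integral do rewrite mulrC EFinM.
  rewrite ge0_integralZl_EFin//.
  + by rewrite (jc_costochastic jc) mule1.
  + by move=> y _; rewrite lee_fin (kernel_ge0 jc).
  + by apply/measurable_EFinP; exact: (measurable_kernel_r jc x).
- apply/measurable_EFinP; apply: measurable_funM.
    exact: (measurableT_comp (jc_measurable jc) (@measurable_swap _ _ T T)).
  by case: bh => mh _; exact: (measurableT_comp mh measurable_snd).
- by move=> x; rewrite lee_fin mulr_ge0// (kernel_ge0 jc).
Qed.

(** * The invariant measure with density 1 / gamma *)

Section invariance.
Hypothesis mu0 : mu [set k | gamma k = 0] = 0%E.
Local Notation D := [set k | 0 < gamma k].

Lemma measurable_div_rate h : measurable_fun [set: T] h ->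
  measurable_fun [set: T] (fun k => (h k / gamma k)%:E).
Proof.
move=> mh; apply/measurable_EFinP; apply: measurable_funM => //.
exact: measurable_inv_rate.
Qed.

Lemma integral_rate_gt0 (f : T -> \bar R) :
  measurable_fun [set: T] f -> (forall x, 0 <= f x)%E ->
  (\int[mu]_(k in D) f k = \int[mu]_k f k)%E.
Proof.
move=> mf f0; rewrite [RHS](@ge0_negligible_integral _ _ _ _ _ [set k | gamma k = 0])//.
  congr integral; apply/seteqP; split=> [x /= gx|x [_ /= /eqP gx]].
    by split=> // gx0; rewrite gx0 ltxx in gx.
  by rewrite lt_def gx (jc_rate_ge0 jc).
exact: (@measurable_rate_set [set 0] (measurable_set1 0)).
Qed.

(** Dividing by [gamma] removes the rate: [Sop h / gamma = h / gamma + (Rop h - h) / lam] on [D],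
    and the last term has integral 0 by [integral_Rop]. *)
Lemma integral_div_rate_Sop h : unit_fun h ->
  (\int[mu]_(k in D) (Sop h k / gamma k)%:E <=
   \int[mu]_(k in D) (h k / gamma k)%:E)%E.
Proof.
move=> uh; have mD := measurable_rate_gt 0.
have uR := unit_fun_Rop jc uh; have uS := unit_fun_Sop jc uh.
have ge0 g x : unit_fun g -> 0 <= g x by move=> ug; case/andP: (unit_fun_bounds ug x).
have l0 : 0 <= lam^-1 by rewrite invr_ge0 ltW// (jc_lam_gt0 jc).
have mE g : unit_fun g -> measurable_fun D (EFin \o g).
  by case=> mg _; apply/measurable_EFinP; exact: measurable_funTS.
(* The integral of [h / gamma] may be infinite, so the identity is written without subtraction; only
   the finite integral of [h] gets cancelled. *)
have key : (\int[mu]_(k in D) (Sop h k / gamma k)%:E +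
            (lam^-1)%:E * \int[mu]_(k in D) (h k)%:E =
            \int[mu]_(k in D) (h k / gamma k)%:E +
            (lam^-1)%:E * \int[mu]_(k in D) (Rop h k)%:E)%E.
  rewrite -!ge0_integralZl_EFin//; [|by move=> x _; rewrite lee_fin ge0|exact: mE|
    by move=> x _; rewrite lee_fin ge0|exact: mE].
  have nn (g : T -> R) x : unit_fun g -> (0 <= (g x / gamma x)%:E)%E.
    by move=> ug; rewrite lee_fin divr_ge0//; [exact: ge0|exact: (jc_rate_ge0 jc)].
  have nn' (g : T -> R) x : unit_fun g -> (0 <= (lam^-1)%:E * (g x)%:E)%E.
    by move=> ug; rewrite mule_ge0// lee_fin// ge0.
  have mq (g : T -> R) : unit_fun g -> measurable_fun D (fun x => (g x / gamma x)%:E).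
    by case=> mg _; apply: measurable_funTS; exact: measurable_div_rate.
  have mq' (g : T -> R) : unit_fun g ->
      measurable_fun D (fun x => (lam^-1)%:E * (g x)%:E)%E.
    by move=> ug; apply: measurable_funeM; exact: mE.
  rewrite -ge0_integralD//; [|by move=> x _; exact: nn|exact: mq|
    by move=> x _; exact: nn'|exact: mq'].
  rewrite -ge0_integralD//; [|by move=> x _; exact: nn|exact: mq|
    by move=> x _; exact: nn'|exact: mq'].
  apply: eq_integral => x; rewrite inE/= => gx.
  rewrite -!EFinM -!EFinD; congr EFin; rewrite /Sop; field.
  by rewrite !gt_eqF// (jc_lam_gt0 jc).
have RhE : (\int[mu]_(k in D) (Rop h k)%:E = \int[mu]_(k in D) (h k)%:E)%E.
  rewrite !integral_rate_gt0 ?integral_Rop//.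
  - by apply/measurable_EFinP; case: uh.
  - by move=> x; rewrite lee_fin ge0.
  - by apply/measurable_EFinP; case: uR.
  - by move=> x; rewrite lee_fin ge0.
have fin : ((lam^-1)%:E * \int[mu]_(k in D) (h k)%:E)%E \is a fin_num.
  rewrite fin_numM// integral_rate_gt0; last 2 first.
  - by apply/measurable_EFinP; case: uh.
  - by move=> x; rewrite lee_fin ge0.
  exact: (integrable_fin_num measurableT (bmf_integrable mu (unit_fun_bmf uh))).
by rewrite -(leeD2rE _ _ fin) key RhE.
Qed.

Lemma integral_div_rate_iter h n : unit_fun h ->
  (\int[mu]_(k in D) (iter n Sop h k / gamma k)%:E <=
   \int[mu]_(k in D) (h k / gamma k)%:E)%E.
Proof.
move=> uh; elim: n => [//|n]; apply: le_trans.
exact: (integral_div_rate_Sop (unit_fun_iter jc n uh)).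
Qed.

(** Monotone convergence reduces to truncated sums, which combine the iterates of [Sop] with Poisson
    weights of total at most 1. *)
Lemma integral_div_rate_semig h z : 0 <= z -> unit_fun h ->
  (\int[mu]_(k in D) (semig z h k / gamma k)%:E <=
   \int[mu]_(k in D) (h k / gamma k)%:E)%E.
Proof.
move=> z0 uh; have mD := measurable_rate_gt 0.
pose g n k := ((semig_sum mu r gamma lam z h n k / gamma k)%:E)%E.
have ge0 n x : 0 <= iter n Sop h x.
  by case/andP: (unit_fun_bounds (unit_fun_iter jc n uh) x).
have g0 k : 0 <= (gamma k)^-1 by rewrite invr_ge0 (jc_rate_ge0 jc).
have mg n : measurable_fun [set: T] (g n).
  apply: measurable_div_rate; exact: (measurable_semig_sum jc).
have ndg x : {homo g^~ x : n m / (n <= m)%N >-> (n <= m)%E}.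
  apply/nondecreasing_seqP => n; rewrite /g lee_fin ler_wpM2r// ler_wpM2l ?expR_ge0//.
  by rewrite big_ord_recr/= lerDl mulr_ge0// exp_coeff_ge0.
have c : (\int[mu]_(x in D) g n x @[n --> \oo] -->
          \int[mu]_(x in D) limn (g^~ x))%E.
  apply: cvg_monotone_convergence => //.
  - by move=> n; exact: measurable_funTS.
  - move=> n x _; rewrite lee_fin mulr_ge0// mulr_ge0 ?expR_ge0//.
    by rewrite sumr_ge0// => i _; rewrite mulr_ge0// exp_coeff_ge0.
have -> : (\int[mu]_(k in D) (semig z h k / gamma k)%:E =
           \int[mu]_(x in D) limn (g^~ x))%E.
  apply: eq_integral => x _; apply/esym/cvg_lim => //.
  apply: cvg_EFin; first exact: nearW.
  by apply: cvgM; [exact: (cvg_semig_sum jc)|exact: cvg_cst].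
rewrite -(cvg_lim _ c)//; apply: lime_le; first by apply/cvg_ex; eexists; exact: c.
apply: nearW => n; rewrite /g.
set I := (X in (_ <= X)%E).
have I0 : (0 <= I)%E.
  by apply: integral_ge0 => x _; rewrite lee_fin mulr_ge0// (ge0 0%N).
have -> : (\int[mu]_(k in D) (semig_sum mu r gamma lam z h n k / gamma k)%:E =
  \int[mu]_(k in D) (\sum_(i < n) ((expR (- z) * exp_coeff z i)%:E *
       (iter i Sop h k / gamma k)%:E)))%E.
  apply: eq_integral => x _; under eq_bigr do rewrite -EFinM.
  rewrite sumEFin; congr EFin; rewrite /semig_sum mulr_sumr mulr_suml.
  by apply: eq_bigr => i _; ring.
have ec i : 0 <= expR (- z) * exp_coeff z i.
  by rewrite mulr_ge0 ?expR_ge0// exp_coeff_ge0.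
have mi i : measurable_fun D (fun k => (iter i Sop h k / gamma k)%:E).
  apply: measurable_funTS; apply: measurable_div_rate.
  by case: (unit_fun_iter jc i uh).
rewrite ge0_integral_sum//; last 2 first.
- by move=> i; apply: measurable_funeM.
- by move=> i x _; rewrite mule_ge0// lee_fin// mulr_ge0.
apply: (@le_trans _ _ (\sum_(i < n) (expR (- z) * exp_coeff z i)%:E * I)%E).
  apply: lee_sum => i _; rewrite ge0_integralZl_EFin//; last first.
    by move=> x _; rewrite lee_fin mulr_ge0.
  by rewrite lee_wpmul2l ?lee_fin//; exact: integral_div_rate_iter.
rewrite -ge0_sume_distrl//; last by move=> i _; rewrite lee_fin.
rewrite -[leRHS]mul1e lee_wpmul2r// sumEFin lee_fin -mulr_sumr.
rewrite (le_trans (ler_wpM2l (expR_ge0 _) (sum_exp_coeff_le n z0)))//.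
by rewrite -expRD addNr expR0.
Qed.

End invariance.
End semigroup_properties.

(** * Mixing and escape *)

Section mixing.
Context (R : realType) d (T : measurableType d).
Variable (mu : {finite_measure set T -> \bar R}).
Variables (r : T -> T -> R) (r0 : R) (gamma : T -> R) (lam : R).
Hypothesis jc : jump_coefficients mu r r0 gamma lam.
Implicit Types (h w u : T -> R) (z : R).
Local Notation Rop := (Rop mu r).
Local Notation Sop := (Sop mu r gamma lam).
Local Notation semig := (semig mu r gamma lam).

(** Doeblin's constant: the part [r0] of the density is common to all jump laws and carries the mass
    [p]. *)
Let p : R := r0 * fine (mu setT).

(** A jump law has mass 1 and density at most [r0^-1], whence [mu setT >= r0 > 0]. *)
Lemma doeblin_gt0 : 0 < p.
Proof.
have r00 := jc_r0_gt0 jc.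
have : 1 <= r0^-1 * fine (mu setT).
  rewrite -(Rop_cst jc 1 point) -Rintegral_cst//; apply: le_Rintegral => //.
  - by apply: (Rop_integrable jc); exact: bmf_cst.
  - by apply: (@bmf_integrable _ _ _ mu); exact: bmf_cst.
  - by move=> x _; rewrite mulr1; case/andP: (jc_bounds jc x point).
rewrite mulrC ler_pdivlMr// mul1r => r0m.
by rewrite mulr_gt0// (lt_le_trans r00).
Qed.

Lemma integral_kernel_subE u k : bmf u ->
  \int[mu]_x ((r x k - r0) * u x) = Rop u k - r0 * \int[mu]_x u x.
Proof.
move=> bu; rewrite /Rop -RintegralZl//; last exact: bmf_integrable.
rewrite -RintegralB//.
- by apply: eq_Rintegral => x _; ring.
- exact: (Rop_integrable jc).
- by apply: (@bmf_integrable _ _ _ mu (fun x => r0 * u x));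
    apply: bmfM => //; exact: bmf_cst.
Qed.

Lemma integrable_kernel_sub u k : bmf u ->
  mu.-integrable [set: T] (EFin \o (fun x => (r x k - r0) * u x)).
Proof.
move=> bu; apply: bmf_integrable; apply: bmfM => //.
have := bmf_lin 1 (-r0) (bmf_kernel jc k) (bmf_cst _ 1).
by under [X in bmf X -> _]eq_fun do rewrite mulr1 mul1r.
Qed.

(* Doeblin: the kernel minus its uniform part [r0] has mass [1 - p]. *)
Lemma Rop_contract u s : bmf u -> (forall x y, u x - u y <= s) ->
  forall k k', Rop u k - Rop u k' <= (1 - p) * s.
Proof.
move=> bu us k k'.
pose m := inf (range u).
have hu : has_inf (range u).
  split; first by exists (u point), point.
  by exists (u point - s) => _ [y _ <-]; have := us point y; lra.
have mu_ y : m <= u y by apply: ge_inf; [case: hu|exists y].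
have uM x : u x <= m + s.
  rewrite -lerBlDr; apply: lb_le_inf; first by case: hu.
  by move=> _ [y _ <-]; have := us x y; lra.
have cst_int k0 c : \int[mu]_x ((r x k0 - r0) * c) = (1 - p) * c.
  rewrite (integral_kernel_subE k0 (bmf_cst _ c)) (Rop_cst jc) Rintegral_cst//.
  by rewrite /p; ring.
have rr0 x k0 : 0 <= r x k0 - r0.
  by rewrite subr_ge0; case/andP: (jc_bounds jc x k0).
(* For every point, [Rop u] minus [r0] times the integral of [u] lies between [(1 - p) * m] and
   [(1 - p) * (m + s)]; the subtracted term is common and cancels in the difference. *)
have h1 : \int[mu]_x ((r x k - r0) * u x) <= (1 - p) * (m + s).
  rewrite -(cst_int k); apply: le_Rintegral => //; try exact: integrable_kernel_sub.
    by apply: integrable_kernel_sub; exact: bmf_cst.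
  by move=> x _; rewrite ler_wpM2l.
have h2 : (1 - p) * m <= \int[mu]_x ((r x k' - r0) * u x).
  rewrite -(cst_int k'); apply: le_Rintegral => //; try exact: integrable_kernel_sub.
    by apply: integrable_kernel_sub; exact: bmf_cst.
  by move=> x _; rewrite ler_wpM2l.
by move: h1 h2; rewrite !integral_kernel_subE//; lra.
Qed.

(** * From a small residual to near constancy *)

Section residual.
Variables (w : T -> R) (e delta : R).
Hypothesis uw : unit_fun w.
Hypothesis we : forall k, gamma k * `|Rop w k - w k| <= e.
Hypothesis delta0 : 0 < delta.

Let bad : set T := [set k | gamma k <= delta].
Let mbad : measurable bad := measurable_rate_le jc delta.
(** Off [bad] the residual is at most [e / delta]; on [bad] it is at most 1, and a jump lands there
    with probability at most [mu bad / r0]. *)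
Let eta := e / delta + fine (mu bad) / r0.

Lemma residual_le k : `|w k - Rop w k| <= e / delta + \1_bad k.
Proof.
have e0 : 0 <= e by apply: le_trans (we k); rewrite mulr_ge0// (jc_rate_ge0 jc).
rewrite distrC indicE; have [kb|kb] := boolP (k \in bad).
  apply: (@le_trans _ _ 1); last by rewrite lerDr divr_ge0// ltW.
  have /andP[? ?] := unit_fun_bounds uw k.
  have /andP[? ?] := unit_fun_bounds (unit_fun_Rop jc uw) k.
  by rewrite ler_norml; apply/andP; split; lra.
rewrite addr0 ler_pdivlMr// mulrC; apply: le_trans (we k).
by rewrite ler_wpM2r// ltW// ltNge; move: kb; rewrite notin_setE/= => /negP.
Qed.

(** Pointwise, the residual of [w] can be of order 1 on [bad]; averaging by [Rop] replaces the
    indicator of [bad] by its small mass. This is why constancy is sought for [Rop w]. *)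
Lemma Rop_residual k : `|Rop w k - Rop (Rop w) k| <= eta.
Proof.
have bw := unit_fun_bmf uw; have uR := unit_fun_Rop jc uw.
have bR := unit_fun_bmf uR.
have bb : bmf (\1_bad : T -> R) by apply/unit_fun_bmf/unit_fun_indic.
have bD : bmf (fun x => e / delta * 1 + 1 * \1_bad x).
  by apply: bmf_lin => //; exact: bmf_cst.
have RD : Rop (fun x => e / delta * 1 + 1 * \1_bad x) k <= eta.
  rewrite (Rop_lin jc)//; last exact: bmf_cst.
  rewrite (Rop_cst jc) mulr1 mul1r lerD2l.
  have -> : fine (mu bad) / r0 = \int[mu]_x (r0^-1 * \1_bad x).
    rewrite RintegralZl//; last exact: bmf_integrable.
    by rewrite /Rintegral integral_indic// setIT mulrC.
  apply: le_Rintegral => //.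
  - exact: (Rop_integrable jc).
  - by apply: (@bmf_integrable _ _ _ mu (fun x => r0^-1 * \1_bad x));
      apply: bmfM => //; exact: bmf_cst.
  - move=> x _; apply: ler_wpM2r; first by rewrite indicE.
    by case/andP: (jc_bounds jc x k).
have dE : Rop (fun x => 1 * w x + (-1) * Rop w x) k = Rop w k - Rop (Rop w) k.
  by rewrite (Rop_lin jc)//; ring.
have bd : bmf (fun x => 1 * w x + (-1) * Rop w x) by exact: bmf_lin.
rewrite -dE ler_norml; apply/andP; split; last first.
  apply: le_trans RD; apply: (ler_Rop jc) => // x.
  by have := residual_le x; rewrite ler_norml => /andP[_ ]; lra.
rewrite lerNl; apply: le_trans RD.
have -> : - Rop (fun x => 1 * w x + -1 * Rop w x) k =
    Rop (fun x => (-1) * w x + 1 * Rop w x) k.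
  by rewrite !(Rop_lin jc)//; ring.
apply: (ler_Rop jc) => //; first exact: bmf_lin.
move=> x; have := residual_le x; rewrite ler_norml => /andP[+ _]; lra.
Qed.

(** Let [S] be the oscillation of [Rop w]. That of [Rop (Rop w)] is at most [(1 - p) * S] by
    Doeblin, and the two functions differ by at most [eta], so [S <= (1 - p) * S + 2 * eta]. *)
Lemma osc_Rop k k' : Rop w k - Rop w k' <= 2 * eta / p.
Proof.
have uR := unit_fun_Rop jc uw; have bR := unit_fun_bmf uR.
pose f (x : T * T) := Rop w x.1 - Rop w x.2.
have f1 x : f x <= 1.
  have /andP[? ?] := unit_fun_bounds uR x.1.
  by have /andP[? ?] := unit_fun_bounds uR x.2; rewrite /f; lra.
have sf : has_sup (range f).
  by split; [exists (f point), point|exists 1 => _ [x _ <-]].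
pose S := sup (range f).
have fS x y : Rop w x - Rop w y <= S.
  by apply: ub_le_sup; [case: sf|exists (x, y)].
have : S <= (1 - p) * S + 2 * eta.
  apply: ge_sup; first by case: sf.
  move=> _ [[x y] _ <-]; rewrite /f/=.
  have := Rop_contract bR fS x y.
  have := Rop_residual x; rewrite ler_norml => /andP[_].
  by have := Rop_residual y; rewrite ler_norml => /andP[+ _]; lra.
have := fS k k'; rewrite ler_pdivlMr ?doeblin_gt0//.
have p0 := doeblin_gt0; nra.
Qed.

(** Off [bad], [w] is close to [Rop w], which is nearly constant. The term [nu bad] stays separate
    because [nu] comes with no bound on its density. *)
Lemma mixing_le (nu : probability T R) k :
  `|\int[nu]_x w x - Rop w k| <= e / delta + fine (nu bad) + 2 * eta / p.
Proof.
have bw := unit_fun_bmf uw; have bR := unit_fun_bmf (unit_fun_Rop jc uw).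
have bb : bmf (\1_bad : T -> R) by apply/unit_fun_bmf/unit_fun_indic.
have nuc c : \int[nu]__ c = c.
  transitivity (c * fine (nu setT)); first exact: Rintegral_cst.
  by rewrite probability_setT mulr1.
pose c := Rop w k; pose q := 2 * eta / p.
have ub x : `|1 * w x + (-1) * c| <= (e / delta + q) * 1 + 1 * \1_bad x.
  have := residual_le x; have := osc_Rop x k; have := osc_Rop k x.
  rewrite -/q -/c !ler_norml => h1 h2 /andP[h3 h4].
  by apply/andP; split; lra.
have bD : bmf (fun x => 1 * w x + (-1) * c) by apply: bmf_lin => //; exact: bmf_cst.
have bU : bmf (fun x => (e / delta + q) * 1 + 1 * \1_bad x).
  by apply: bmf_lin => //; exact: bmf_cst.
have -> : \int[nu]_x w x - Rop w k = \int[nu]_x (1 * w x + (-1) * c).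
  rewrite RintegralD//; last 2 first.
  - by apply: (@bmf_integrable _ _ _ nu (fun x => 1 * w x)); apply: bmfM => //; exact: bmf_cst.
  - by apply: (@bmf_integrable _ _ _ nu (fun x => -1 * c)); exact: bmf_cst.
  by rewrite nuc mulN1r; congr (_ + _); apply: eq_Rintegral => x _; rewrite mul1r.
apply: le_trans (le_normr_Rintegral _ _) _ => //; first exact: (bmf_integrable nu bD).
apply: (@le_trans _ _ (\int[nu]_x ((e / delta + q) * 1 + 1 * \1_bad x))).
  apply: le_Rintegral => //.
  - exact: (bmf_integrable nu (bmf_norm bD)).
  - exact: (bmf_integrable nu bU).
rewrite RintegralD//; last 2 first.
- by apply: (@bmf_integrable _ _ _ nu (fun x => (e / delta + q) * 1)); exact: bmf_cst.
- apply: (@bmf_integrable _ _ _ nu (fun x => 1 * \1_bad x)).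
  by apply: bmfM => //; exact: bmf_cst.
rewrite nuc (_ : \int[nu]_x (1 * \1_bad x) = fine (nu bad)).
  by rewrite -/q; lra.
rewrite /Rintegral; under eq_integral do rewrite mul1r.
by rewrite integral_indic// setIT.
Qed.

End residual.

Lemma fine_measure_le (m : {finite_measure set T -> \bar R}) (A B : set T) :
  measurable A -> measurable B -> A `<=` B -> fine (m A) <= fine (m B).
Proof.
move=> mA mB AB; apply: fine_le; [exact: fin_num_measure..|].
by apply: le_measure; rewrite ?inE.
Qed.

Lemma natSinv_lt (x : R) : 0 < x -> exists n, n.+1%:R^-1 < x :> R.
Proof.
move=> x0; exists (Num.truncn x^-1).
by rewrite invf_plt ?posrE// truncnS_gt.
Qed.

(** Continuity from above along the sets [gamma <= 1 / (n+1)]. Stated for every [x <= delta], so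
    that several thresholds combine into a minimum. *)
Lemma rate_le_small (m : {finite_measure set T -> \bar R}) (e : R) :
  m [set k | gamma k = 0] = 0%E -> 0 < e ->
  exists2 delta : R, 0 < delta &
    forall x : R, x <= delta -> fine (m [set k | gamma k <= x]) <= e.
Proof.
move=> m0 e0; pose F n := [set k | gamma k <= n.+1%:R^-1].
have mF n : measurable (F n) by exact: (measurable_rate_le jc).
have IF : \bigcap_n F n = [set k | gamma k = 0].
  apply/seteqP; split=> [k Fk|k /= gk n _]; last by rewrite /F/= gk invr_ge0.
  apply/eqP; rewrite eq_le (jc_rate_ge0 jc) andbT leNgt; apply/negP => gk.
  have [n ng] := natSinv_lt gk.
  by have := Fk n I; rewrite /F/= leNgt ng.
have mI : measurable (\bigcap_n F n) by exact: bigcapT_measurable.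
have mF0 : (m (F 0%N) < +oo)%E by rewrite -ge0_fin_numE// fin_num_measure.
have /= := nonincreasing_cvg_mu mF0 mF mI.
rewrite IF m0 => cF.
have {}cF : (m (F n) @[n --> \oo] --> 0)%E.
  apply: cF => a b ab; apply/subsetPset => k; rewrite /F/= => /le_trans; apply.
  by rewrite lef_pV2 ?posrE// ler_nat.
have /fine_cvgP[_ /cvgrPdist_le /(_ e e0)[N _ HN]] := cF.
exists N.+1%:R^-1 => // x xN.
apply: le_trans (HN N (leqnn _)); rewrite sub0r normrN ger0_norm ?fine_ge0//.
apply: fine_measure_le => //; first exact: (measurable_rate_le jc).
by move=> k /= /le_trans; apply.
Qed.

Lemma semig_rate_residual z h : 0 < z -> unit_fun h ->
  forall k, gamma k * `|Rop (semig z h) k - semig z h k| <= lam / Num.sqrt z.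
Proof.
move=> z0 uh k; have := semig_residual jc k z0 uh.
have l0 := jc_lam_gt0 jc.
rewrite normrM ger0_norm; last by case/andP: (rate_ratio jc k).
by rewrite mulrAC ler_pdivrMr// [leRHS]mulrC.
Qed.

Lemma sqrt_large (c : R) : 0 < c ->
  exists2 Z : R, 0 < Z & forall z, Z <= z -> 0 < z /\ lam / Num.sqrt z <= c.
Proof.
move=> c0; have l0 := jc_lam_gt0 jc.
exists ((lam / c) ^+ 2); first by rewrite exprn_gt0// divr_gt0.
move=> z Zz; have z0 : 0 < z by apply: lt_le_trans Zz; rewrite exprn_gt0// divr_gt0.
split=> //; rewrite ler_pdivrMr ?sqrtr_gt0// mulrC -ler_pdivrMr//.
rewrite -(ler_sqr _ _) ?nnegrE ?sqrtr_ge0//; last by rewrite divr_ge0// ltW.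
by rewrite sqr_sqrtr// ltW.
Qed.

Hypothesis mu0 : mu [set k | gamma k = 0] = 0%E.

Lemma semig_mixing (nu : probability T R) (e : R) :
  nu [set k | gamma k = 0] = 0%E -> 0 < e ->
  exists2 Z : R, 0 < Z & forall z h k, Z <= z -> unit_fun h ->
    `|\int[nu]_x semig z h x - Rop (semig z h) k| <= e.
Proof.
move=> nu0 e0; have p0 := doeblin_gt0; have r00 := jc_r0_gt0 jc.
(* In [mixing_le], [e / delta] and [nu bad] cost [e1] each, and [eta <= 2 * e1] makes the
   oscillation cost [4 * e1 / p]. *)
pose e1 := e / (2 + 4 / p).
have e10 : 0 < e1 by rewrite divr_gt0// addr_gt0// divr_gt0.
have [d1 d10 H1] := rate_le_small mu0 (mulr_gt0 e10 r00).
have [d2 d20 H2] := @rate_le_small nu e1 nu0 e10.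
pose delta := Num.min d1 d2.
have delta0 : 0 < delta by rewrite lt_min d10.
have [Z Z0 HZ] := sqrt_large (mulr_gt0 e10 delta0).
exists Z => // z h k Zz uh; have [z0 lz] := HZ z Zz.
have uw := unit_fun_semig jc (ltW z0) uh.
apply: le_trans (mixing_le uw (semig_rate_residual z0 uh) delta0 nu k) _.
have h1 : lam / Num.sqrt z / delta <= e1 by rewrite ler_pdivrMr.
have h2 : fine (nu [set k | gamma k <= delta]) <= e1.
  by apply: H2; rewrite ge_min lexx orbT.
have h3 : fine (mu [set k | gamma k <= delta]) / r0 <= e1.
  by rewrite ler_pdivrMr//; apply: H1; rewrite ge_min lexx.
have -> : e = e1 + e1 + 2 * (e1 + e1) / p.
  by rewrite /e1; field; rewrite !gt_eqF// addr_gt0// mulr_gt0.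
apply: lerD; first exact: lerD.
by rewrite ler_wpM2r ?invr_ge0 ?(ltW p0)// ler_wpM2l// lerD.
Qed.

Hypothesis rate_oo : (\int[mu]_k ((gamma k)^-1)%:E = +oo)%E.

Lemma inv_rate_large (M : R) : exists2 delta : R, 0 < delta &
  forall x : R, x <= delta ->
    (M%:E <= \int[mu]_(k in [set k | (x < gamma k)%R]) ((gamma k)^-1)%:E)%E.
Proof.
pose F n := [set k | n.+1%:R^-1 < gamma k].
have mF n : measurable (F n) by exact: (measurable_rate_gt jc).
have g0 k : (0 <= ((gamma k)^-1)%:E)%E by rewrite lee_fin invr_ge0 (jc_rate_ge0 jc).
have mg : measurable_fun [set: T] (fun k => ((gamma k)^-1)%:E).
  by apply/measurable_EFinP; exact: (measurable_inv_rate jc).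
have UF : \bigcup_n F n = [set k | 0 < gamma k].
  apply/seteqP; split=> [k [n _]|k /= /natSinv_lt[n ng]]; last by exists n.
  by apply: lt_trans; rewrite invr_gt0.
have ndF : nondecreasing_seq F.
  move=> a b ab; apply/subsetPset => k; rewrite /F/=; apply: le_lt_trans.
  by rewrite lef_pV2 ?posrE// ler_nat.
have := @ge0_nondecreasing_set_cvg_integral _ _ _ F
  (fun k => ((gamma k)^-1)%:E) mu ndF mF.
rewrite UF (integral_rate_gt0 jc mu0)// rate_oo => cF.
have {}cF : (\int[mu]_(k in F n) ((gamma k)^-1)%:E @[n --> \oo] --> +oo)%E.
  by apply: cF => // i; exact: measurable_funTS.
have /cvgeyPge/(_ M)[N _ HN] := cF.
exists N.+1%:R^-1 => // x xN.
apply: le_trans (HN N (leqnn _)) _; apply: ge0_subset_integral => //.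
- exact: (measurable_rate_gt jc).
- exact: measurable_funTS.
- by move=> k /=; apply: le_lt_trans.
Qed.

(** By contradiction: if [Rop w] exceeds [e] somewhere, near constancy gives [w >= e / 2] wherever
    [gamma > delta], and for small [delta] the integral of [w / gamma] outgrows the bound inherited
    from time 0. *)
Lemma semig_escape (c e : R) : 0 < c -> 0 < e ->
  exists2 Z : R, 0 < Z & forall z k, Z <= z ->
    Rop (semig z \1_[set k | c <= gamma k]) k <= e.
Proof.
move=> c0 e0; have p0 := doeblin_gt0; have r00 := jc_r0_gt0 jc.
pose A := [set k | c <= gamma k].
have mA : measurable A by exact: (measurable_rate_ge jc).
have uA : unit_fun (\1_A : T -> R) by exact: unit_fun_indic.
(* Bounds the integral of [\1_A / gamma], since [gamma >= c] on [A]. *)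
pose C := c^-1 * fine (mu setT).
have C0 : 0 <= C by rewrite mulr_ge0 ?invr_ge0 ?fine_ge0// ltW.
(* From [Rop w k] to [w k'] one loses [4 * e1 / p] by oscillation and [e1] by the residual, that is
   [e / 2] in all. *)
pose e1 := e / 2 / (1 + 4 / p).
have e10 : 0 < e1 by rewrite !divr_gt0// addr_gt0// divr_gt0.
have [d1 d10 H1] := rate_le_small mu0 (mulr_gt0 e10 r00).
(* Chosen so that [e / 2 * M = C + e / 2], which exceeds [C]. *)
pose M := 2 * C / e + 1.
have M0 : 0 < M.
  by rewrite ltr_wpDl// divr_ge0//; [exact: mulr_ge0|exact: ltW].
have [d2 d20 H2] := inv_rate_large M.
pose delta := Num.min d1 d2.
have delta0 : 0 < delta by rewrite lt_min d10.
have [Z Z0 HZ] := sqrt_large (mulr_gt0 e10 delta0).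
exists Z => // z k Zz; have [z0 lz] := HZ z Zz.
have uw := unit_fun_semig jc (ltW z0) uA.
have h1 : lam / Num.sqrt z / delta <= e1 by rewrite ler_pdivrMr.
have h3 : fine (mu [set k | gamma k <= delta]) / r0 <= e1.
  by rewrite ler_pdivrMr//; apply: H1; rewrite ge_min lexx.
set w := semig z \1_A; rewrite leNgt; apply/negP => ek.
have we := semig_rate_residual z0 uA.
have wlarge k' : delta < gamma k' -> e / 2 <= w k'.
  move=> gk; have := residual_le uw we delta0 k'.
  rewrite indicE memNset ?addr0; last by rewrite /= leNgt gk.
  rewrite ler_norml => /andP[+ _]; rewrite -/w.
  have := osc_Rop uw we delta0 k k'; rewrite -/w.
  have h4 : 2 * (lam / Num.sqrt z / delta +
      fine (mu [set k | gamma k <= delta]) / r0) / p <= 2 * (e1 + e1) / p.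
    by rewrite ler_wpM2r ?invr_ge0 ?(ltW p0)// ler_wpM2l// lerD.
  have h5 : e / 2 = e1 + 2 * (e1 + e1) / p.
    by rewrite /e1; field; rewrite !gt_eqF// addr_gt0.
  lra.
have mD := measurable_rate_gt jc delta.
have mw : measurable_fun [set: T] w by case: uw.
have up : (\int[mu]_(k in [set k | (0 < gamma k)%R]) (w k / gamma k)%:E <= C%:E)%E.
  apply: le_trans (integral_div_rate_semig jc mu0 (ltW z0) uA) _.
  have -> : C%:E = (\int[mu]_k (c^-1)%:E)%E.
    by rewrite integral_cst//= /C EFinM fineK// fin_num_measure.
  apply: (@le_trans _ _ (\int[mu]_(k in [set k | (0 < gamma k)%R]) (c^-1)%:E)%E).
    apply: ge0_le_integral => //.
    - exact: (measurable_rate_gt jc).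
    - by move=> x /= gx; rewrite lee_fin divr_ge0// ?ltW// indicE.
    - apply: measurable_funTS; apply: (measurable_div_rate jc).
      exact: measurable_indic.
    - move=> x /= gx; rewrite lee_fin indicE; have [|] := boolP (x \in A).
        by rewrite inE /A/= => cx; rewrite mul1r lef_pV2 ?posrE.
      by rewrite mul0r invr_ge0 ltW.
  apply: ge0_subset_integral => //; first exact: (measurable_rate_gt jc).
  by move=> x _; rewrite lee_fin invr_ge0 ltW.
have lo : ((e / 2 * M)%:E <=
    \int[mu]_(k in [set k | (0 < gamma k)%R]) (w k / gamma k)%:E)%E.
  apply: (@le_trans _ _ (\int[mu]_(k in [set k | (delta < gamma k)%R])
      ((e / 2)%:E * ((gamma k)^-1)%:E))%E).
    rewrite ge0_integralZl_EFin//.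
    - rewrite EFinM lee_wpmul2l// ?lee_fin ?divr_ge0 ?(ltW e0)//.
      by apply: H2; rewrite ge_min lexx orbT.
    - by move=> x _; rewrite lee_fin invr_ge0 (jc_rate_ge0 jc).
    - apply: measurable_funTS; apply/measurable_EFinP.
      exact: (measurable_inv_rate jc).
    - by rewrite divr_ge0// ltW.
  apply: (@le_trans _ _ (\int[mu]_(k in [set k | (delta < gamma k)%R])
      (w k / gamma k)%:E)%E).
    apply: ge0_le_integral => //.
    - by move=> x _; rewrite -EFinM lee_fin mulr_ge0 ?invr_ge0 ?(jc_rate_ge0 jc)//
        divr_ge0// ltW.
    - apply: measurable_funTS; apply: measurable_funeM; apply/measurable_EFinP.
      exact: (measurable_inv_rate jc).
    - by apply: measurable_funTS; exact: (measurable_div_rate jc).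
    - move=> x /= gx; rewrite -EFinM lee_fin ler_wpM2r ?wlarge//.
      by rewrite invr_ge0 (jc_rate_ge0 jc).
  apply: ge0_subset_integral => //.
  - exact: (measurable_rate_gt jc).
  - by apply: measurable_funTS; exact: (measurable_div_rate jc).
  - move=> x _; rewrite lee_fin divr_ge0 ?(jc_rate_ge0 jc)//.
    by case/andP: (unit_fun_bounds uw x).
  - by move=> x /=; apply: lt_trans.
have := le_trans lo up; rewrite lee_fin leNgt => /negP; apply.
rewrite /M mulrDr mulr1 (_ : e / 2 * (2 * C / e) = C); last first.
  by field; rewrite gt_eqF.
by rewrite ltrDl divr_gt0.
Qed.

End mixing.

(** * Decoupling and kernel laws *)

Section density.
Context (R : realType) d (T : measurableType d) (mu : {measure set T -> \bar R}).

(** Carrying [mg] and [g0] as arguments lets the measure structure be inferred from the term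
    alone. *)
Definition density_measure (g : T -> R) (mg : measurable_fun [set: T] g)
  (g0 : forall x, 0 <= g x) (A : set T) : \bar R := (\int[mu]_(x in A) (g x)%:E)%E.

Variables (g : T -> R) (mg : measurable_fun [set: T] g) (g0 : forall x, 0 <= g x).
Local Notation nu := (density_measure mg g0).

Let nu0 : nu set0 = 0%E. Proof. exact: integral_set0. Qed.

Let nu_ge0 A : (0 <= nu A)%E.
Proof. by apply: integral_ge0 => x _; rewrite lee_fin. Qed.

Let nu_sigma_additive : semi_sigma_additive nu.
Proof.
move=> /= F mF tF mUF; rewrite /density_measure; apply: cvg_toP.
  apply: ereal_nondecreasing_is_cvgn => m n mn.
  by apply: lee_sum_nneg_natr => // k _ _; exact: nu_ge0.
rewrite ge0_integral_bigcup//.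
- by apply/measurable_funTS/measurable_EFinP.
- by move=> x _; rewrite lee_fin.
Qed.

HB.instance Definition _ := isMeasure.Build _ _ _ nu nu0 nu_ge0 nu_sigma_additive.

Import HBNNSimple.

Lemma integral_density (f : T -> \bar R) : measurable_fun [set: T] f ->
  (forall x, 0 <= f x)%E ->
  (\int[nu]_x f x = \int[mu]_x (f x * (g x)%:E))%E.
Proof.
move=> mf f0; pose f_ := nnsfun_approx measurableT mf.
have cf x : (((f_ n x)%:E)%E @[n --> \oo] --> f x)%E.
  by apply: cvg_nnsfun_approx.
have ndf x : {homo (fun n => (f_ n x)%:E) : n m / (n <= m)%N >-> (n <= m)%E}.
  by move=> a b ab; rewrite lee_fin; exact/lefP/nd_nnsfun_approx.
have mg' : measurable_fun [set: T] (EFin \o g) by exact/measurable_EFinP.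
have mf_ n : measurable_fun [set: T] (fun x => (f_ n x)%:E) by exact/measurable_EFinP.
have c1 : (\int[nu]_x (f_ n x)%:E @[n --> \oo] --> \int[nu]_x f x)%E.
  have -> : (\int[nu]_x f x = \int[nu]_x limn (fun n => (f_ n x)%:E))%E.
    by apply: eq_integral => x _; rewrite (cvg_lim _ (cf x)).
  apply: cvg_monotone_convergence => //.
  by move=> n x _; rewrite lee_fin.
have c2 : (\int[mu]_x ((f_ n x)%:E * (g x)%:E) @[n --> \oo] -->
           \int[mu]_x (f x * (g x)%:E))%E.
  have cg x : ((f_ n x)%:E * (g x)%:E @[n --> \oo] --> f x * (g x)%:E)%E.
    by apply: cvgeZr.
  have -> : (\int[mu]_x (f x * (g x)%:E) =
             \int[mu]_x limn (fun n => (f_ n x)%:E * (g x)%:E))%E.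
    by apply: eq_integral => x _; rewrite (cvg_lim _ (cg x)).
  apply: cvg_monotone_convergence => //.
  - by move=> n; exact: emeasurable_funM.
  - by move=> n x _; rewrite mule_ge0// lee_fin.
  - by move=> x _ a b ab; rewrite lee_wpmul2r// ?lee_fin//; exact: ndf.
apply: (cvg_unique _ c1) => //; rewrite (_ : (fun n => _) = (fun n =>
  \int[mu]_x ((f_ n x)%:E * (g x)%:E))%E)//.
apply/funext => n.
rewrite integralT_nnsfun sintegralE.
transitivity (\int[mu]_x \sum_(k \in range (f_ n))
    (k%:E * ((g x)%:E * (\1_(f_ n @^-1` [set k]) x)%:E)))%E.
  rewrite ge0_integral_fsum//; last 2 first.
  - move=> k; apply/measurable_funeM/emeasurable_funM => //.
    by apply/measurable_EFinP; exact: measurable_indic.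
  - move=> k x _; have [k0|k0] := leP 0 k.
      by rewrite mule_ge0 ?lee_fin// mulr_ge0// indicE.
    by rewrite preimage_nnfun0// indic0 !mule0.
  apply: eq_fsbigr => k _; have [k0|k0] := leP 0 k; last first.
    rewrite preimage_nnfun0// measure0 mule0.
    by under eq_integral do rewrite indic0 !mule0; rewrite integral0.
  rewrite ge0_integralZl_EFin//.
  - congr (_ * _)%E; rewrite /= [LHS]/density_measure [LHS]integral_mkcond.
    by apply: eq_integral => x _; rewrite epatch_indic.
  - by move=> x _; rewrite mule_ge0// lee_fin.
  - apply: emeasurable_funM => //.
    by apply/measurable_EFinP; exact: measurable_indic.
apply: eq_integral => x _; rewrite [in RHS]fimfunE -fsumEFin//.
rewrite ge0_mule_fsuml.
  by apply: eq_fsbigr => k _; rewrite EFinM muleAC -!muleA muleCA.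
by move=> k; rewrite nnfun_muleindic_ge0.
Qed.

End density.

(** * Integration against an independent copy *)

Section decoupling.
Context (R : realType) d d1 d2 (Omega : measurableType d)
  (E1 : measurableType d1) (E2 : measurableType d2) (P : probability Omega R).
Variables (Y : Omega -> E1) (Z : Omega -> E2).
Hypotheses (mY : measurable_fun [set: Omega] Y) (mZ : measurable_fun [set: Omega] Z).
Hypothesis indep : forall B C, measurable B -> measurable C ->
  (P (Y @^-1` B `&` Z @^-1` C) = P (Y @^-1` B) * P (Z @^-1` C))%E.

(** By independence the joint law is the product of the marginals, and Tonelli applies. [Y] and [Z]
    may be the identity of [Omega] towards a smaller sigma-algebra, so whole families of variables
    can be separated at once. *)
Lemma integral_decouple (f : E1 * E2 -> \bar R) : measurable_fun [set: E1 * E2] f ->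
  (forall x, 0 <= f x)%E ->
  (\int[P]_w f (Y w, Z w) = \int[P]_w \int[P]_w' f (Y w, Z w'))%E.
Proof.
move=> mf f0.
pose Y' : {mfun Omega >-> E1} := HB.pack Y (isMeasurableFun.Build _ _ _ _ _ mY).
pose Z' : {mfun Omega >-> E2} := HB.pack Z (isMeasurableFun.Build _ _ _ _ _ mZ).
have mYZ : measurable_fun [set: Omega] (fun w => (Y w, Z w)).
  exact: measurable_fun_pair.
pose YZ : {mfun Omega >-> (E1 * E2)%type} :=
  HB.pack (fun w => (Y w, Z w)) (isMeasurableFun.Build _ _ _ _ _ mYZ).
transitivity (\int[distribution P YZ]_x f x)%E.
  by rewrite ge0_integral_distribution.
transitivity (\int[distribution P Y' \x distribution P Z']_x f x)%E.
  apply: eq_measure_integral => A mA _; apply/esym.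
  by apply: product_measure_unique => // B C mB mC; rewrite -indep.
rewrite fubini_tonelli1// ge0_integral_distribution//; last 2 first.
- exact: measurable_fun_fubini_tonelli_F.
- by move=> y; apply: integral_ge0.
apply: eq_integral => w _; rewrite /= /fubini_F ge0_integral_distribution//.
exact: measurableT_comp.
Qed.

End decoupling.

(** * Joint laws given by a transition density *)

Section kernel_law.
Context (R : realType) d d1 d2 (Omega : measurableType d)
  (E : measurableType d1) (T : measurableType d2) (P : probability Omega R)
  (mu : {finite_measure set T -> \bar R}).
Variables (Y : Omega -> E) (X : Omega -> T) (g : E * T -> R).
Hypotheses (mY : measurable_fun [set: Omega] Y) (mX : measurable_fun [set: Omega] X).
Hypotheses (mg : measurable_fun [set: E * T] g) (g0 : forall x, 0 <= g x).
Hypothesis law : forall B A, measurable B -> measurable A ->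
  (P (Y @^-1` B `&` X @^-1` A) =
   \int[P]_(w in Y @^-1` B) \int[mu]_(theta in A) (g (Y w, theta))%:E)%E.

(** The hypothesis [law] says, on rectangles, that the joint law of [Y] and [X] has density [g] with
    respect to the law of [Y] times [mu]; rectangles determine it. *)
Lemma integral_kernel (f : E * T -> \bar R) : measurable_fun [set: E * T] f ->
  (forall x, 0 <= f x)%E ->
  (\int[P]_w f (Y w, X w) =
   \int[P]_w \int[mu]_theta (f (Y w, theta) * (g (Y w, theta))%:E))%E.
Proof.
move=> mf f0.
pose Y' : {mfun Omega >-> E} := HB.pack Y (isMeasurableFun.Build _ _ _ _ _ mY).
have mYX : measurable_fun [set: Omega] (fun w => (Y w, X w)).
  exact: measurable_fun_pair.
pose YX : {mfun Omega >-> (E * T)%type} :=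
  HB.pack (fun w => (Y w, X w)) (isMeasurableFun.Build _ _ _ _ _ mYX).
pose nu := density_measure (distribution P Y' \x mu)%E mg g0.
have mg' : measurable_fun [set: E * T] (EFin \o g) by exact/measurable_EFinP.
transitivity (\int[distribution P YX]_x f x)%E.
  by rewrite ge0_integral_distribution.
transitivity (\int[nu]_x f x)%E.
  apply: eq_measure_integral => A mA _.
  apply: (measure_unique [set B `*` C | B in measurable & C in measurable]
    (fun=> setT)) => //.
  - exact: measurable_prod_measurableType.
  - move=> _ _ [B mB [C mC <-]] [B' mB' [C' mC' <-]].
    exists (B `&` B'); first exact: measurableI.
    by exists (C `&` C'); [exact: measurableI|rewrite setXI].
  - by move=> i; exists setT => //; exists setT => //; rewrite setXTT.
  - by rewrite bigcup_const.
  - move=> _ [B mB [C mC <-]].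
    have mBC : measurable (B `*` C) by exact: measurableX.
    rewrite -[LHS]/(P (Y @^-1` B `&` X @^-1` C)) law//.
    rewrite -[RHS]/(\int[distribution P Y' \x mu]_(x in B `*` C) (g x)%:E)%E.
    rewrite integral_mkcond [RHS]integral_mkcond.
    have mgBC : measurable_fun [set: E * T]
        ((fun x => (g x)%:E) \_ (B `*` C)).
      by apply/(measurable_restrictT _ mBC); exact: measurable_funTS.
    have gBC0 x : (0 <= ((fun x => (g x)%:E) \_ (B `*` C)) x)%E.
      by rewrite patchE; case: ifP => // _; rewrite lee_fin.
    rewrite fubini_tonelli1// ge0_integral_distribution//; last 2 first.
    - exact: measurable_fun_fubini_tonelli_F.
    - by move=> y; apply: integral_ge0.
    apply: eq_integral => w _; rewrite /= /fubini_F patchE.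
    case: ifPn => [|/negP] YB.
      rewrite [LHS]integral_mkcond; apply: eq_integral => x _.
      rewrite !patchE; congr (if _ then _ else _).
      rewrite in_setX; move: YB; rewrite !inE => YB.
      by rewrite [(Y w, x).1 \in B]mem_set.
    rewrite integral0_eq// => x _; rewrite patchE in_setX ifF//.
    by apply/negP => /andP[h _]; apply: YB; move: h; rewrite !inE.
  - by move=> k; rewrite /= -ge0_fin_numE// fin_num_measure.
rewrite integral_density// fubini_tonelli1//=; last 2 first.
- exact: emeasurable_funM.
- by move=> x; rewrite mule_ge0// lee_fin.
rewrite ge0_integral_distribution//.
- apply: measurable_fun_fubini_tonelli_F; first exact: emeasurable_funM.
  by move=> x; rewrite mule_ge0// lee_fin.
- by move=> y; apply: integral_ge0 => x _; rewrite mule_ge0// lee_fin.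
Qed.

End kernel_law.

(** * Exponential clocks *)

Section exponential_tail.
Variable R : realType.
Local Notation leb := (@lebesgue_measure R).
Local Notation pdf := (exponential_pdf (1 : R)).

Lemma exponential_pdf1E (x : R) : 0 <= x -> pdf x = expR (- x).
Proof. by move=> x0; rewrite exponential_pdfE// mul1r mulN1r. Qed.

Lemma exponential_pdf1_ge0 (x : R) : 0 <= pdf x.
Proof. exact: exponential_pdf_ge0. Qed.

Lemma measurable_exponential_pdf1 : measurable_fun [set: R] pdf.
Proof. exact: measurable_exponential_pdf. Qed.

Lemma continuous_expRN : continuous (fun x : R => expR (- x)).
Proof.
by move=> x; apply: continuous_comp; [exact: oppr_continuous|exact: continuous_expR].
Qed.

Lemma is_derive_expRN (x : R) :
  is_derive x (1 : R) (fun z : R => expR (- z)) (- expR (- x)).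
Proof.
have := @is_derive1_comp R expR -%R x (expR (- x)) (-1) (is_derive_expR _) _.
by rewrite mulrN1; apply.
Qed.

Lemma integral_exponential_gt (b : R) : 0 <= b ->
  (\int[leb]_(u in `]b, +oo[) (pdf u)%:E = (expR (- b))%:E)%E.
Proof.
move=> b0; have mp := measurable_exponential_pdf1.
rewrite (@integral_itv_obnd_cbnd R b)//; last first.
  by apply/measurable_EFinP; exact: measurable_funTS.
rewrite (@ge0_continuous_FTC2y R _ (fun x => - expR (- x)) b 0).
- by rewrite -EFinN opprK add0e.
- by move=> x _; exact: exponential_pdf1_ge0.
- apply: (@continuous_subspaceW R^o R^o _ [set` `[(0:R), +oo[%R]
    (exponential_pdf 1)); last exact: within_continuous_exponential_pdf.
  by apply: subset_itvr; rewrite bnd_simp.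
- by rewrite -oppr0; apply: cvgN; exact: cvgr_expR.
- move=> x _; apply: derivableN; have [h _] := is_derive_expRN x; exact: h.
- by apply: cvgN; apply/cvg_at_right_filter; exact: continuous_expRN.
- move=> x; rewrite in_itv/= andbT => bx.
  rewrite derive1E; have h := is_deriveN (is_derive_expRN x).
  by rewrite (@derive_val _ _ _ _ _ _ _ h) opprK exponential_pdf1E// (le_trans b0)// ltW.
Qed.

Lemma integral_exponential_split (f : R -> \bar R) (b : R) : 0 <= b ->
  measurable_fun [set: R] f -> (forall x, 0 <= f x)%E ->
  (\int[leb]_u (f u * (pdf u)%:E) =
   \int[leb]_(u in `[0%R, b]) (f u * (expR (- u))%:E) +
   \int[leb]_(u in `]b, +oo[) (f u * (pdf u)%:E))%E.
Proof.
move=> b0 mf f0.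
have mfp : measurable_fun [set: R] (fun u => f u * (pdf u)%:E)%E.
  by apply: emeasurable_funM => //; apply/measurable_EFinP; exact: measurable_exponential_pdf1.
have fp0 u : (0 <= f u * (pdf u)%:E)%E by rewrite mule_ge0// lee_fin exponential_pdf1_ge0.
rewrite -[in LHS](itv_setU_setT false b) ge0_integral_setU//; last 2 first.
- exact: measurable_funTS.
- rewrite disj_set2E; apply/eqP/seteqP; split => // x [] /=.
  by rewrite !in_itv/= andbT => /le_lt_trans h /h; rewrite ltxx.
congr (_ + _)%E.
rewrite (@itv_bndbnd_setU _ _ _ (BLeft 0)) ?bnd_simp// ge0_integral_setU//; last 2 first.
- exact: measurable_funTS.
- rewrite disj_set2E; apply/eqP/seteqP; split => // x [] /=.
  by rewrite !in_itv/= => x0 /andP[]; rewrite leNgt x0.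
rewrite integral0_eq ?add0e => [|u /=]; last first.
  by rewrite in_itv/= => u0; rewrite lt0_exponential_pdf// mule0.
apply: eq_integral => u; rewrite inE/= in_itv/= => /andP[u0 _].
by rewrite exponential_pdf1E.
Qed.

End exponential_tail.

(** * Duhamel's formula *)

Section step_functions.
Variable R : realType.

(** The closed and the open version are both needed to encode [t_n <= t < t_(n+1)] as a product. *)
Definition step (s : R) : R := (0 <= s)%R%:R.
Definition stepo (s : R) : R := (0 < s)%R%:R.

Lemma measurable_step : measurable_fun [set: R] step.
Proof.
rewrite (_ : step = \1_(`[0, +oo[%classic)); first exact: measurable_indic.
by apply/funext => s; rewrite indicE mem_setE in_itv/= andbT.
Qed.

Lemma measurable_stepo : measurable_fun [set: R] stepo.
Proof.
rewrite (_ : stepo = \1_(`]0, +oo[%classic)); first exact: measurable_indic.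
by apply/funext => s; rewrite indicE mem_setE in_itv/= andbT.
Qed.

Lemma step_ge0 s : 0 <= step s. Proof. exact: ler0n. Qed.
Lemma stepo_ge0 s : 0 <= stepo s. Proof. exact: ler0n. Qed.

End step_functions.

Section measurable_egf.
Context (R : realType) d (T : measurableType d).

Lemma measurable_egf (a : nat -> T -> R) :
  (forall n, measurable_fun [set: T] (a n)) -> (forall x, ubounded (a^~ x)) ->
  measurable_fun [set: R * T] (fun y => egf (a^~ y.2) y.1).
Proof.
move=> ma ba.
apply: (@measurable_fun_cvg _ _ _ _
  (fun n (y : R * T) => \sum_(k < n) a k y.2 * exp_coeff y.1 k)) => [n|y _].
  apply: measurable_sum => k; apply: measurable_funM.
    exact: (measurableT_comp (ma k) measurable_snd).
  apply: measurable_funM => //; apply: measurable_funX.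
  exact: measurable_fst.
exact: (cvg_sum_egf (ba y.2)).
Qed.

End measurable_egf.

Section duhamel.
Context (R : realType) d (T : measurableType d).
Variable (mu : {finite_measure set T -> \bar R}).
Variables (r : T -> T -> R) (r0 : R) (gamma : T -> R) (lam : R).
Hypothesis jc : jump_coefficients mu r r0 gamma lam.
Local Notation Rop := (Rop mu r).
Local Notation Sop := (Sop mu r gamma lam).
Local Notation semig := (semig mu r gamma lam).
Variable h : T -> R.
Hypothesis uh : unit_fun h.

(** For [z >= 0] this is [Rop (semig z h) x]; as a series it is visibly continuous in [z] and
    jointly measurable. *)
Definition rsemig (z : R) (x : T) : R :=
  expR (- z) * egf (fun n => Rop (iter n Sop h) x) z.

Lemma measurable_semig2 : measurable_fun [set: R * T] (fun y => semig y.1 h y.2).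
Proof.
apply: measurable_funM.
  apply: (measurableT_comp (@measurable_expR R)).
  by apply: measurable_funN; exact: measurable_fst.
apply: (measurable_egf (a := fun n => iter n Sop h)) => [n|x].
  by case: (unit_fun_iter jc n uh).
exact: (ubounded_iter jc x uh).
Qed.

Lemma measurable_rsemig2 : measurable_fun [set: R * T] (fun y => rsemig y.1 y.2).
Proof.
apply: measurable_funM.
  apply: (measurableT_comp (@measurable_expR R)).
  by apply: measurable_funN; exact: measurable_fst.
apply: (measurable_egf (a := fun n => Rop (iter n Sop h))) => [n|x].
  by case: (unit_fun_Rop jc (unit_fun_iter jc n uh)).
exact: (ubounded_Rop_iter jc x uh).
Qed.

(* Extension by 0 to negative times: the renewal identity then also covers the
   paths whose next jump comes after the time considered. *)
Definition semigT (s : R) (x : T) : R := step s * semig (lam * s) h x.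
Definition rsemigT (s : R) (x : T) : R := step s * rsemig (lam * s) x.

Lemma measurable_semigT : measurable_fun [set: R * T] (fun y => semigT y.1 y.2).
Proof.
apply: measurable_funM.
  exact: (measurableT_comp (@measurable_step R) measurable_fst).
apply: (measurableT_comp measurable_semig2 (g := fun y : R * T => (lam * y.1, y.2))).
apply: measurable_fun_pair; last exact: measurable_snd.
by apply: measurable_funM => //; exact: measurable_fst.
Qed.

Lemma measurable_rsemigT : measurable_fun [set: R * T] (fun y => rsemigT y.1 y.2).
Proof.
apply: measurable_funM.
  exact: (measurableT_comp (@measurable_step R) measurable_fst).
apply: (measurableT_comp measurable_rsemig2 (g := fun y : R * T => (lam * y.1, y.2))).
apply: measurable_fun_pair; last exact: measurable_snd.
by apply: measurable_funM => //; exact: measurable_fst.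
Qed.

Lemma semigT_unit s x : 0 <= semigT s x <= 1.
Proof.
rewrite /semigT /step; case: (leP 0 s) => [s0|_]; last by rewrite mul0r lexx ler01.
have z0 : 0 <= lam * s by rewrite mulr_ge0// ltW// (jc_lam_gt0 jc).
by rewrite mul1r (unit_fun_bounds (unit_fun_semig jc z0 uh)).
Qed.

Lemma rsemigTE s x : rsemigT s x = Rop (semigT s) x.
Proof.
rewrite /rsemigT /semigT /step; case: (leP 0 s) => [s0|_].
  have z0 : 0 <= lam * s by rewrite mulr_ge0// ltW// (jc_lam_gt0 jc).
  rewrite mul1r /rsemig -(Rop_semig jc)//.
  by congr (Rop _ x); apply/funext => y; rewrite mul1r.
rewrite mul0r; under [X in Rop X]eq_fun do rewrite mul0r.
by rewrite (Rop_cst jc).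
Qed.

Lemma unit_fun_semigT s : unit_fun (semigT s).
Proof.
split=> [|x]; last exact: semigT_unit.
exact: (measurableT_comp measurable_semigT (pair1_measurable s)).
Qed.

Lemma rsemigT_ge0 s x : 0 <= rsemigT s x.
Proof.
by rewrite rsemigTE; case/andP: (unit_fun_bounds (unit_fun_Rop jc (unit_fun_semigT s)) x).
Qed.

Lemma semig0 x : semig 0 h x = h x.
Proof.
rewrite /semig oppr0 expR0 mul1r.
rewrite -(cvg_lim _ (cvg_sum_egf (z := 0) (ubounded_iter jc x uh)))//.
apply: lim_near_cst => //; exists 1%N => // -[//|n] _ /=.
rewrite big_ord_recl/= /exp_coeff/= expr0 fact0 divr1 mulr1 big1 ?addr0// => i _.
by rewrite expr0n/= mul0r mulr0.
Qed.

Lemma continuous_rsemig x : continuous (rsemig^~ x).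
Proof.
move=> z; apply: cvgM; first exact: continuous_expRN.
exact: (continuous_egf (ubounded_Rop_iter jc x uh)).
Qed.

Lemma continuous_semig x : continuous (fun z => semig z h x).
Proof.
move=> z; apply: cvgM; first exact: continuous_expRN.
exact: (continuous_egf (ubounded_iter jc x uh)).
Qed.

Section fixed_point.
Variable x : T.
Hypothesis gx : 0 < gamma x.
Let c := (gamma x)^-1.

(* The primitive [F u = - e^-u v (s - c u)] of the post-jump contribution. *)
Lemma integral_rsemig (s : R) : 0 < s ->
  (\int[@lebesgue_measure R]_(u in `[0%R, (gamma x * s)%R])
     (rsemig (lam * (s - c * u)) x * expR (- u))%:E =
   (semig (lam * s) h x - expR (- (gamma x * s)) * h x)%:E)%E.
Proof.
move=> s0; have l0 := jc_lam_gt0 jc.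
pose F u := - (expR (- u) * semig (lam * (s - c * u)) h x).
have cz : continuous (fun u : R => lam * (s - c * u)).
  move=> u; apply: cvgM; first exact: cvg_cst.
  by apply: cvgB; [exact: cvg_cst|apply: cvgM; [exact: cvg_cst|exact: cvg_id]].
have cF : continuous F.
  move=> u; apply: cvgN; apply: cvgM; first exact: continuous_expRN.
  apply: (@continuous_comp _ _ _ (fun u : R => lam * (s - c * u))
    (fun z => semig z h x)); [exact: cz|exact: continuous_semig].
have dF u : 0 < u < gamma x * s ->
    is_derive u (1 : R) F (rsemig (lam * (s - c * u)) x * expR (- u)).
  move=> /andP[u0 us].
  have z0 : 0 <= lam * (s - c * u).
    by rewrite mulr_ge0 ?(ltW l0)// subr_ge0 ler_pdivrMl// ltW.
  have dz : is_derive u (1 : R) (fun u => lam * (s - c * u)) (- (lam * c)).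
    have := is_deriveM (is_derive_cst lam u (1 : R))
      (is_deriveB (is_derive_cst s u (1 : R))
        (is_deriveM (is_derive_cst c u (1 : R)) (is_derive_id u (1 : R)))).
    move=> H; apply: (is_derive_eq H).
    by rewrite /GRing.scale/=; ring.
  have dc := @is_derive1_comp R (fun z => semig z h x)
    (fun u => lam * (s - c * u)) u _ _ (is_derive_semig jc x z0 uh) dz.
  have H := is_deriveN (is_deriveM (is_derive_expRN u) dc).
  (* By the backward equation and [lam * c * (gamma x / lam) = 1], the two copies of [semig] cancel
     and only the [rsemig] term is left. *)
  apply: (is_derive_eq H); rewrite /GRing.scale/= -/(rsemig _ _).
  rewrite (Rop_semig jc)//= -/(rsemig _ _).
  by rewrite /c; field; rewrite !gt_eqF.
rewrite (@continuous_FTC2 R _ F).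
- have cgs : c * (gamma x * s) = s by rewrite mulKf// gt_eqF.
  rewrite -EFinB /F cgs subrr !mulr0 semig0 oppr0 expR0.
  by rewrite addr0; congr EFin; ring.
- by rewrite mulr_gt0.
- apply: continuous_subspaceT => u; apply: cvgM; last exact: continuous_expRN.
  apply: (@continuous_comp _ _ _ (fun u : R => lam * (s - c * u))
    (rsemig^~ x)); [exact: cz|exact: continuous_rsemig].
- split=> [u|  |].
  + by rewrite in_itv/= => /dF [].
  + by apply/cvg_at_right_filter; exact: cF.
  + by apply/cvg_at_left_filter; exact: cF.
- move=> u; rewrite in_itv/= => /dF h'.
  by rewrite derive1E (@derive_val _ _ _ _ _ _ _ h').
Qed.

(* Conditioning on the first jump. *)
Lemma duhamel (s : R) :
  (\int[@lebesgue_measure R]_u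
    ((h x * (step s * stepo (c * u - s)) + rsemigT (s - c * u) x)%:E *
       (exponential_pdf (1 : R) u)%:E) = (semigT s x)%:E)%E.
Proof.
have l0 := jc_lam_gt0 jc; have c0 : 0 < c by rewrite invr_gt0.
have h0 : 0 <= h x by case/andP: (unit_fun_bounds uh x).
(* At negative times both sides vanish: the clock is nonnegative, so [s - c * u] stays negative. *)
have [s0|s0] := ltP s 0.
  rewrite /semigT {2}/step leNgt s0/= mul0r integral0_eq// => u _.
  have [u0|u0] := ltP u 0; first by rewrite lt0_exponential_pdf// mule0.
  rewrite /rsemigT /step leNgt s0/= mul0r mulr0 add0r.
  have : s - c * u < 0 by rewrite subr_lt0 (lt_le_trans s0)// mulr_ge0// ltW.
  by rewrite leNgt => -> /=; rewrite mul0r mul0e.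
(* The holding time is [c * u], so the first jump comes by time [s] exactly when [u <= gamma x * s];
   the integral is split there. *)
have b0 : 0 <= gamma x * s by rewrite mulr_ge0// ltW.
have mcu : measurable_fun [set: R] (fun u => c * u) by apply: measurable_funM.
rewrite (integral_exponential_split b0); last 2 first.
- apply/measurable_EFinP; apply: measurable_funD.
    apply: measurable_funM => //; apply: measurable_funM => //.
    apply: (measurableT_comp (@measurable_stepo R) (g := fun u => c * u - s)).
    exact: measurable_funB.
  apply: (measurableT_comp measurable_rsemigT (g := fun u => (s - c * u, x))).
  by apply: measurable_fun_pair => //; exact: measurable_funB.
- move=> u; rewrite lee_fin addr_ge0 ?rsemigT_ge0//.
  by rewrite mulr_ge0// mulr_ge0 ?step_ge0 ?stepo_ge0.
have -> : (\int[@lebesgue_measure R]_(u in `](gamma x * s)%R, +oo[)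
    ((h x * (step s * stepo (c * u - s)) + rsemigT (s - c * u) x)%:E *
       (exponential_pdf (1 : R) u)%:E) = (h x * expR (- (gamma x * s)))%:E)%E.
  rewrite EFinM -(integral_exponential_gt b0) -ge0_integralZl_EFin//; last 2 first.
  - by move=> u _; rewrite lee_fin exponential_pdf1_ge0.
  - by apply/measurable_EFinP/measurable_funTS; exact: measurable_exponential_pdf1.
  apply: eq_integral => u; rewrite inE/= in_itv/= andbT => us.
  have su : s < c * u by rewrite ltr_pdivlMl.
  rewrite /step /stepo s0 subr_gt0 su/= !mulr1.
  by rewrite /rsemigT /step subr_ge0 leNgt su/= mul0r addr0.
have -> : (\int[@lebesgue_measure R]_(u in `[0%R, (gamma x * s)%R])
    ((h x * (step s * stepo (c * u - s)) + rsemigT (s - c * u) x)%:E *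
       (expR (- u))%:E) =
  \int[@lebesgue_measure R]_(u in `[0%R, (gamma x * s)%R])
     (rsemig (lam * (s - c * u)) x * expR (- u))%:E)%E.
  apply: eq_integral => u; rewrite inE/= in_itv/= => /andP[u0 us].
  have su : c * u <= s by rewrite ler_pdivrMl.
  rewrite -EFinM /step /stepo subr_gt0 ltNge su/= !mulr0 add0r.
  by rewrite /rsemigT /step subr_ge0 su/= mul1r.
(* The fundamental theorem of calculus wants a nondegenerate interval; at [s = 0] the first integral
   is over a point. *)
have [sp|sn] := ltP 0 s.
  rewrite integral_rsemig// -EFinD /semigT /step s0 mul1r; congr EFin; ring.
have -> : s = 0 by apply/eqP; rewrite eq_le sn.
rewrite mulr0 set_itv1 integral_set1 add0e oppr0 expR0 mulr1.
by rewrite /semigT /step lexx mul1r mulr0 semig0.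
Qed.

End fixed_point.
End duhamel.

(** * Conditioning on the past *)

Section generated_sigma_algebra.
Context d (Omega : measurableType d) d' (E : measurableType d').
Variables (D : set nat) (Y : nat -> Omega -> E).

Definition gen_system : set (set Omega) :=
  [set Y i @^-1` B | i in D & B in measurable].

(** [Omega] with the smaller sigma-algebra as a type of its own: conditioning on the variables [Y i]
    then becomes a statement about the identity map from [Omega] to [gen_type]. *)
Definition gen_type := g_sigma_algebraType gen_system.

Lemma measurable_gen i : D i ->
  measurable_fun [set: gen_type] (Y i : gen_type -> E).
Proof.
move=> Di _ B mB; rewrite setTI; apply: sub_gen_smallest.
by exists i => //; exists B.
Qed.

Hypothesis mY : forall i, measurable_fun [set: Omega] (Y i).

Lemma gen_system_measurable : gen_system `<=` measurable.
Proof. by move=> _ [i _ [B mB <-]]; rewrite -[X in measurable X]setTI; exact: mY. Qed.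

Lemma generated_measurable A : generated D Y A -> measurable A.
Proof.
exact: (smallest_sub (@sigma_algebra_measurable _ Omega) gen_system_measurable).
Qed.

Lemma measurable_gen_id : measurable_fun [set: Omega] (id : Omega -> gen_type).
Proof. by move=> _ B mB; rewrite setTI; exact: generated_measurable. Qed.

End generated_sigma_algebra.

(** * Independence of a clock from the earlier ones *)

Section iid_sequence.
Context (R : realType) d (Omega : measurableType d) (P : probability Omega R).
Variable rho : nat -> {RV P >-> R}.
Hypothesis rho_iid : iid_exponential rho.

Let rect n : set (set Omega) :=
  [set \bigcap_(i in [set k | (k < n)%N]) rho i @^-1` B i |
    B in [set B : nat -> set R | forall i, measurable (B i)]].

Lemma iid_rect n (B : nat -> set R) : (forall i, measurable (B i)) ->
  (P (\bigcap_(i in [set k | (k < n)%N]) rho i @^-1` B i) =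
   \prod_(i <- iota 0 n) P (rho i @^-1` B i))%E.
Proof.
move=> mB; case: rho_iid => _ /(_ (iota 0 n) B (iota_uniq _ _) mB) <-.
by congr (P _); apply: eq_bigcapl; split=> i /=; rewrite mem_iota add0n.
Qed.

Lemma measurable_rect n : rect n `<=` measurable.
Proof.
move=> _ [B mB <-]; apply: bigcap_measurableType => i _.
by rewrite -[X in measurable X]setTI; exact: measurable_funP.
Qed.

(** For fixed [C], both sides are finite measures in [H]; they agree on the cylinders [rect n],
    which are stable under intersection and generate the past. *)
Lemma generated_past_indep n H C : generated [set i | (i < n)%N] rho H ->
  measurable C ->
  (P (H `&` rho n @^-1` C) = P H * P (rho n @^-1` C))%E.
Proof.
move=> gH mC; have mnC : measurable (rho n @^-1` C).
  by rewrite -[X in measurable X]setTI; exact: measurable_funP.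
pose m1 : {measure set Omega -> \bar R} := mrestr P mnC.
have c0 : 0 <= fine (P (rho n @^-1` C)) by exact: fine_ge0.
pose m2 : {measure set Omega -> \bar R} := mscale (NngNum c0) P.
have : <<s rect n >> H.
  apply: smallest_sub gH; first exact: smallest_sigma_algebra.
  move=> _ [i /= ni [B mB <-]]; apply: sub_gen_smallest.
  exists (fun j => if j == i then B else setT); first by move=> j /=; case: ifP.
  apply/seteqP; split=> [w /(_ i ni)/=|w Bw j _ /=]; first by rewrite eqxx.
  by case: eqP => // ->.
have mI : setI_closed (rect n).
  move=> _ _ [B mB <-] [B' mB' <-]; exists (fun i => B i `&` B' i).
    by move=> i; exact: measurableI.
  apply/seteqP; split=> [w Bw|w [Bw Bw'] i ni]; last by split; [exact: Bw|exact: Bw'].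
  by split=> i ni; have [] := Bw i ni.
have rT (k : nat) : rect n setT.
  exists (fun=> setT) => //; apply/seteqP; split => // w _ i _ //.
have m12 A : rect n A -> m1 A = m2 A.
  move=> [B mB <-]; rewrite /m1 /m2/= /mrestr /mscale/= fineK ?fin_num_measure//.
  (* Placing [C] at index [n] turns the intersection into a cylinder over [n.+1] clocks. *)
  pose B' i := if (i < n)%N then B i else C.
  have mB' i : measurable (B' i) by rewrite /B'; case: ifP.
  have -> : \bigcap_(i in [set k | (k < n)%N]) rho i @^-1` B i `&` rho n @^-1` C =
      \bigcap_(i in [set k | (k < n.+1)%N]) rho i @^-1` B' i.
    apply/seteqP; split=> [w [Bw Cw] i /=|w Bw].
      rewrite ltnS leq_eqVlt => /predU1P[->|ni]; first by rewrite /B' ltnn.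
      by rewrite /B' ni; exact: Bw.
    split=> [i /= ni|]; last by have := Bw n (ltnSn n); rewrite /= /B' ltnn.
    by have := Bw i (ltnW ni); rewrite /= /B' ni.
  rewrite !iid_rect// -addn1 iotaD big_cat/= big_seq1 add0n muleC.
  congr (_ * _)%E; first by rewrite /B' ltnn.
  apply: eq_big_seq => i; rewrite mem_iota add0n /= => ni.
  by rewrite /B' ni.
have m1oo (k : nat) : (m1 setT < +oo)%E.
  by rewrite /m1/= /mrestr setTI -ge0_fin_numE// fin_num_measure.
have UT : \bigcup_(k : nat) [set: Omega] = setT by rewrite bigcup_const.
move=> /(g_sigma_algebra_measure_unique (rect n) (@measurable_rect n)
  (fun=> setT) rT UT m1 m2 mI m12 m1oo).
by rewrite /m1 /m2 /= /mrestr /mscale/= fineK ?fin_num_measure// muleC.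
Qed.

End iid_sequence.

(** * The jump chain read with independent clocks *)

Section jump_recursion.
Context (R : realType) d (Omega : measurableType d) (P : probability Omega R).
Local Notation T := (torus R).
Local Notation dk := (torus_lebesgue R).
Variables (r : T -> T -> R) (r0 : R) (gamma : T -> R) (lam : R).
Hypothesis jc : jump_coefficients dk r r0 gamma lam.
Variables (X : nat -> {RV P >-> T}) (rho : nat -> {RV P >-> R}).
Hypothesis Xg : forall n w, 0 < gamma (X n w).
Hypothesis XM : markov_chain r X.
Hypothesis rho_iid : iid_exponential rho.
Hypothesis Xrho : independent_sequences X rho.
Local Notation Rop := (Rop dk r).
Local Notation semig := (semig dk r gamma lam).
Variable h : T -> R.
Hypothesis uh : unit_fun h.
Local Notation V := (semigT dk r gamma lam h).
Local Notation W := (rsemigT dk r gamma lam h).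

(* Jump times of the chain read at [w] with the clocks read at [w']. *)
Definition split_time n (w w' : Omega) : R :=
  \sum_(j < n) (gamma (X j w))^-1 * rho j w'.

(** The domains are arbitrary because it serves both on [Omega] and on the generated
    sigma-algebras. *)
Lemma measurable_split_time d1 d2 (A : measurableType d1) (B : measurableType d2)
    (X' : nat -> A -> T) (rho' : nat -> B -> R) n :
  (forall j, (j < n)%N -> measurable_fun [set: A] (X' j)) ->
  (forall j, (j < n)%N -> measurable_fun [set: B] (rho' j)) ->
  measurable_fun [set: A * B]
    (fun y => \sum_(j < n) (gamma (X' j y.1))^-1 * rho' j y.2).
Proof.
move=> mX mr; apply: measurable_sum => j; apply: measurable_funM.
  apply: (measurableT_comp (measurable_inv_rate jc)).
  exact: (measurableT_comp (mX j (ltn_ord j)) measurable_fst).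
exact: (measurableT_comp (mr j (ltn_ord j)) measurable_snd).
Qed.

(** The contribution to [h (K t)] of the [n]th holding interval. *)
Definition occupation t n (w w' : Omega) : R :=
  h (X n w) * (step (t - split_time n w w') * stepo (split_time n.+1 w w' - t)).

Lemma occupation_ge0 t n w w' : 0 <= occupation t n w w'.
Proof.
rewrite /occupation mulr_ge0 ?mulr_ge0 ?step_ge0 ?stepo_ge0//.
by case/andP: (unit_fun_bounds uh (X n w)).
Qed.

Lemma measurable_occupation d1 d2 (A : measurableType d1) (B : measurableType d2)
    (X' : nat -> A -> T) (rho' : nat -> B -> R) t n :
  (forall j, measurable_fun [set: A] (X' j)) ->
  (forall j, measurable_fun [set: B] (rho' j)) ->
  measurable_fun [set: A * B] (fun y => h (X' n y.1) *
    (step (t - \sum_(j < n) (gamma (X' j y.1))^-1 * rho' j y.2) *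
     stepo (\sum_(j < n.+1) (gamma (X' j y.1))^-1 * rho' j y.2 - t))).
Proof.
move=> mX mr; apply: measurable_funM.
  have mh : measurable_fun [set: T] h by case: uh.
  exact: (measurableT_comp mh (measurableT_comp (mX n) measurable_fst)).
apply: measurable_funM.
  apply: (measurableT_comp (@measurable_step R)); apply: measurable_funB => //.
  by apply: measurable_split_time => j _.
apply: (measurableT_comp (@measurable_stepo R)); apply: measurable_funB => //.
by apply: measurable_split_time => j _.
Qed.

Lemma expect_clock n (f : R -> \bar R) : measurable_fun [set: R] f ->
  (forall u, 0 <= f u)%E ->
  (\int[P]_w f (rho n w) =
   \int[@lebesgue_measure R]_u (f u * (exponential_pdf (1 : R) u)%:E))%E.
Proof.
move=> mf f0; rewrite -(@integral_density _ _ _ (@lebesgue_measure R) _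
  (@measurable_exponential_pdf1 R) (@exponential_pdf1_ge0 R))//.
transitivity (\int[distribution P (rho n)]_u f u)%E.
  by rewrite ge0_integral_distribution.
(* The density measure lives on [measurableTypeR R], the law of the clock on [R]; pushing forward
   along the identity reconciles them. *)
pose idTR : measurableTypeR R -> R := idfun.
have mid : measurable_fun [set: measurableTypeR R] idTR by exact: (@measurable_id _ _ setT).
pose idR : {mfun measurableTypeR R >-> R} :=
  HB.pack idTR (isMeasurableFun.Build _ _ _ _ _ mid).
pose m := density_measure (@lebesgue_measure R)
  (@measurable_exponential_pdf1 R) (@exponential_pdf1_ge0 R).
transitivity (\int[pushforward m idR]_u f u)%E; last first.
  by rewrite ge0_integral_pushforward.
by apply: eq_measure_integral => A mA _; exact: (rho_iid.1 n A mA).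
Qed.

Lemma mX n : measurable_fun [set: Omega] (X n). Proof. exact: measurable_funP. Qed.
Lemma mrho n : measurable_fun [set: Omega] (rho n). Proof. exact: measurable_funP. Qed.

Let E1 n := gen_type [set i | (i <= n)%N] (fun n => X n : Omega -> T).
Let E2 n := gen_type [set i | (i < n)%N] (fun n => rho n : Omega -> R).

(** With the clocks frozen at [w'], [split_time n.+1] depends on [X 0], ..., [X n] only; integrating
    [X n.+1] against its kernel turns [V] into [Rop V], which is [W]. *)
Lemma expect_chain t n w' :
  (\int[P]_w (W (t - split_time n.+1 w w') (X n w))%:E =
   \int[P]_w (V (t - split_time n.+1 w w') (X n.+1 w))%:E)%E.
Proof.
pose Y : Omega -> E1 n := id.
have mY : measurable_fun [set: Omega] Y by apply: measurable_gen_id => i; exact: mX.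
have mXE j : (j <= n)%N -> measurable_fun [set: E1 n] (X j : E1 n -> T).
  by move=> jn; exact: measurable_gen.
pose g (y : E1 n * T) := r y.2 (X n y.1).
have mg : measurable_fun [set: E1 n * T] g.
  apply: (measurableT_comp (jc_measurable jc) (g := fun y : E1 n * T => (y.2, X n y.1 : T))).
  apply: measurable_fun_pair; first exact: measurable_snd.
  exact: (measurableT_comp (mXE n (leqnn n)) measurable_fst).
have g0 y : 0 <= g y by exact: (kernel_ge0 jc).
pose f (y : E1 n * T) := (V (t - split_time n.+1 y.1 w') y.2)%:E.
have mf : measurable_fun [set: E1 n * T] f.
  apply/measurable_EFinP.
  apply: (measurableT_comp (measurable_semigT jc uh)
    (g := fun y : E1 n * T => (t - split_time n.+1 y.1 w', y.2))).
  apply: measurable_fun_pair; last exact: measurable_snd.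
  apply: measurable_funB => //; apply: measurable_sum => j.
  apply: measurable_funM => //.
  apply: (measurableT_comp (measurable_inv_rate jc)).
  have jn : (j <= n)%N by rewrite -ltnS ltn_ord.
  exact: (measurableT_comp (mXE j jn) measurable_fst).
have f0 y : (0 <= f y)%E.
  by rewrite lee_fin; case/andP: (semigT_unit jc uh (t - split_time n.+1 y.1 w') y.2).
have law B A : measurable B -> measurable A ->
  (P (Y @^-1` B `&` X n.+1 @^-1` A) =
   \int[P]_(w in Y @^-1` B) \int[dk]_(theta in A) (g (Y w, theta))%:E)%E.
  by move=> mB mA; apply: XM.
have := integral_kernel mY (mX n.+1) mg g0 law mf f0.
rewrite /f /= => ->; apply: eq_integral => w _.
rewrite (rsemigTE jc)// (Rop_EFin jc); last exact/unit_fun_bmf/(unit_fun_semigT jc).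
by apply: eq_integral => x _; rewrite muleC -EFinM.
Qed.

(** With the chain frozen at [w], [split_time n] depends on the clocks before [n] and is independent
    of [rho n], which Duhamel's formula integrates at time [t - split_time n w w']. *)
Lemma expect_clocks t n w :
  (\int[P]_w' (V (t - split_time n w w') (X n w))%:E =
   \int[P]_w' (occupation t n w w')%:E +
   \int[P]_w' (W (t - split_time n.+1 w w') (X n w))%:E)%E.
Proof.
pose x : T := X n w; pose c := (gamma x)^-1.
pose G s u : R := h x * (step s * stepo (c * u - s)) + W (s - c * u) x.
have h0 : 0 <= h x by case/andP: (unit_fun_bounds uh x).
have G0 s u : 0 <= G s u.
  by rewrite addr_ge0 ?(rsemigT_ge0 jc)// mulr_ge0// mulr_ge0 ?step_ge0 ?stepo_ge0.
have mG : measurable_fun [set: R * R] (fun y => G y.1 y.2).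
  have m1 : measurable_fun [set: R * R] (fun y : R * R => c * y.2 : R).
    by apply: measurable_funM => //; exact: measurable_snd.
  apply: measurable_funD.
    apply: measurable_funM => //; apply: measurable_funM.
      exact: (measurableT_comp (@measurable_step R) measurable_fst).
    apply: (measurableT_comp (@measurable_stepo R)
      (g := fun y : R * R => c * y.2 - y.1)).
    by apply: measurable_funB => //; exact: measurable_fst.
  apply: (measurableT_comp (measurable_rsemigT jc uh)
      (g := fun y : R * R => (y.1 - c * y.2, x))).
  by apply: measurable_fun_pair => //; apply: measurable_funB => //; exact: measurable_fst.
have mGs s : measurable_fun [set: R] (G s).
  exact: (measurableT_comp mG (pair1_measurable s)).
pose Y : Omega -> E2 n := id.
have mY : measurable_fun [set: Omega] Y by apply: measurable_gen_id => i; exact: mrho.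
have mtt : measurable_fun [set: E2 n] (fun w' : E2 n => split_time n w w').
  apply: measurable_sum => j; apply: measurable_funM => //.
  by apply: (@measurable_gen _ Omega); exact: ltn_ord.
transitivity (\int[P]_w' (G (t - split_time n w w') (rho n w'))%:E)%E.
  pose f (y : E2 n * R) := (G (t - split_time n w y.1) y.2)%:E.
  have mf : measurable_fun [set: E2 n * R] f.
    apply/measurable_EFinP.
    apply: (measurableT_comp mG (g := fun y : E2 n * R => (t - split_time n w y.1, y.2))).
    apply: measurable_fun_pair; last exact: measurable_snd.
    apply: measurable_funB => //; exact: (measurableT_comp mtt measurable_fst).
  have f0 y : (0 <= f y)%E by rewrite lee_fin.
  have ind B C : measurable B -> measurable C ->
      (P (Y @^-1` B `&` rho n @^-1` C) = P (Y @^-1` B) * P (rho n @^-1` C))%E.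
    by move=> mB mC; exact: (generated_past_indep rho_iid).
  have := integral_decouple mY (mrho n) ind mf f0.
  rewrite /f /= => ->; apply: eq_integral => w' _.
  rewrite (expect_clock n (f := fun u => (G (t - split_time n w w') u)%:E)).
  - by rewrite (duhamel jc uh (Xg n w)).
  - by apply/measurable_EFinP.
  - by move=> u; rewrite lee_fin.
rewrite -ge0_integralD//.
- apply: eq_integral => w' _; rewrite -EFinD; congr EFin.
  rewrite /G /occupation /split_time big_ord_recr/= -/x -/c.
  by congr (h x * (_ * stepo _) + W _ x); ring.
- by move=> w' _; rewrite lee_fin occupation_ge0.
- apply/measurable_EFinP.
  apply: (measurableT_comp (measurable_occupation t n mX mrho) (pair1_measurable w)).
- by move=> w' _; rewrite lee_fin (rsemigT_ge0 jc).
- apply/measurable_EFinP; apply: (measurableT_comp (measurable_rsemigT jc uh)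
      (g := fun w' => (t - split_time n.+1 w w', x))).
  apply: measurable_fun_pair => //; apply: measurable_funB => //.
  by apply: measurable_sum => j; apply: measurable_funM => //; exact: mrho.
Qed.

(** [Zint t n] is what the semigroup predicts for the part of the expectation of [h (K t)] due to
    the holding intervals from the [n]th on; [Jint t n] is the part of the [n]th alone. *)
Definition Zint t n := (\int[P]_w \int[P]_w' (V (t - split_time n w w') (X n w))%:E)%E.
Definition Jint t n := (\int[P]_w \int[P]_w' (occupation t n w w')%:E)%E.

(** [expect_clocks] works at fixed [w] and [expect_chain] at fixed [w']; Tonelli exchanges the order
    between the two and back. *)
Lemma Zint_rec t n : Zint t n = (Jint t n + Zint t n.+1)%E.
Proof.
have mfst j : measurable_fun [set: Omega * Omega] (fun y => X j y.1).
  exact: (measurableT_comp (mX j) measurable_fst).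
have mtt k : measurable_fun [set: Omega * Omega] (fun y => split_time k y.1 y.2).
  exact: (measurable_split_time (fun j _ => mX j) (fun j _ => mrho j)).
have mWX k n' : measurable_fun [set: Omega * Omega]
    (fun y => (W (t - split_time k y.1 y.2) (X n' y.1))%:E).
  apply/measurable_EFinP; apply: (measurableT_comp (measurable_rsemigT jc uh)
      (g := fun y => (t - split_time k y.1 y.2, X n' y.1 : T))).
  by apply: measurable_fun_pair => //; exact: measurable_funB.
have mVX k n' : measurable_fun [set: Omega * Omega]
    (fun y => (V (t - split_time k y.1 y.2) (X n' y.1))%:E).
  apply/measurable_EFinP; apply: (measurableT_comp (measurable_semigT jc uh)
      (g := fun y => (t - split_time k y.1 y.2, X n' y.1 : T))).
  by apply: measurable_fun_pair => //; exact: measurable_funB.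
have W0 k n' y : (0 <= (W (t - split_time k y.1 y.2) (X n' y.1))%:E)%E.
  by rewrite lee_fin (rsemigT_ge0 jc).
have V0 k n' y : (0 <= (V (t - split_time k y.1 y.2) (X n' y.1))%:E)%E.
  by rewrite lee_fin; case/andP: (semigT_unit jc uh (t - split_time k y.1 y.2) (X n' y.1)).
pose A w := (\int[P]_w' (occupation t n w w')%:E)%E.
pose B w := (\int[P]_w' (W (t - split_time n.+1 w w') (X n w))%:E)%E.
have mA : measurable_fun [set: Omega] A.
  apply: (@measurable_fun_fubini_tonelli_F _ _ _ _ _ P
    (fun y => (occupation t n y.1 y.2)%:E)).
    by apply/measurable_EFinP; exact: (measurable_occupation t n mX mrho).
  by move=> y; rewrite lee_fin occupation_ge0.
have mB : measurable_fun [set: Omega] B.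
  exact: (@measurable_fun_fubini_tonelli_F _ _ _ _ _ P _ (mWX n.+1 n) (W0 n.+1 n)).
have A0 w : (0 <= A w)%E.
  by apply: integral_ge0 => w' _; rewrite lee_fin occupation_ge0.
have B0 w : (0 <= B w)%E.
  by apply: integral_ge0 => w' _; exact: (W0 n.+1 n (w, w')).
transitivity (\int[P]_w (A w + B w))%E.
  by apply: eq_integral => w _; exact: expect_clocks.
rewrite (ge0_integralD P measurableT (fun w _ => A0 w) mA (fun w _ => B0 w) mB).
have JE : (\int[P]_w A w = Jint t n)%E by reflexivity.
have e1 := @fubini_tonelli _ _ _ _ _ P P _ (mWX n.+1 n) (W0 n.+1 n).
have e2 := @fubini_tonelli _ _ _ _ _ P P _ (mVX n.+1 n.+1) (V0 n.+1 n.+1).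
have BE : (\int[P]_w B w = \int[P]_w \int[P]_w'
    (V (t - split_time n.+1 w w') (X n.+1 w))%:E)%E.
  apply: etrans e1 _; apply: etrans (esym e2).
  by apply: eq_integral => w' _; exact: expect_chain.
by rewrite JE BE.
Qed.

End jump_recursion.

(** * The law of the process *)

Section jump_law.
Context (R : realType) d (Omega : measurableType d) (P : probability Omega R).
Local Notation T := (torus R).
Local Notation dk := (torus_lebesgue R).
Variables (r : T -> T -> R) (r0 : R) (gamma : T -> R) (lam : R).
Hypothesis jc : jump_coefficients dk r r0 gamma lam.
Variables (X : nat -> {RV P >-> T}) (rho : nat -> {RV P >-> R}).
Hypothesis Xg : forall n w, 0 < gamma (X n w).
Hypothesis XM : markov_chain r X.
Hypothesis rho_iid : iid_exponential rho.
Hypothesis Xrho : independent_sequences X rho.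
Variable h : T -> R.
Hypothesis uh : unit_fun h.
Local Notation V := (semigT dk r gamma lam h).
Local Notation stime := (split_time gamma X rho).
Local Notation occ := (occupation gamma X rho h).
Local Notation Z := (Zint r gamma lam X rho h).
Local Notation J := (Jint gamma X rho h).

Let EX := gen_type setT (fun n => X n : Omega -> T).
Let Erho := gen_type setT (fun n => rho n : Omega -> R).

Lemma decouple_clocks (f : EX * Erho -> \bar R) :
  measurable_fun [set: EX * Erho] f -> (forall y, 0 <= f y)%E ->
  (\int[P]_w f (w, w) = \int[P]_w \int[P]_w' f (w, w'))%E.
Proof.
move=> mf f0.
have m1 : measurable_fun [set: Omega] (id : Omega -> EX).
  by apply: measurable_gen_id => i; exact: mX.
have m2 : measurable_fun [set: Omega] (id : Omega -> Erho).
  by apply: measurable_gen_id => i; exact: mrho.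
apply: (integral_decouple m1 m2 _ mf f0) => B C mB mC.
exact: Xrho.
Qed.

Lemma mXE j : measurable_fun [set: EX] (X j : EX -> T).
Proof. exact: measurable_gen. Qed.

Lemma mrhoE j : measurable_fun [set: Erho] (rho j : Erho -> R).
Proof. exact: measurable_gen. Qed.

Lemma Jint_diag t n : J t n = (\int[P]_w (occ t n w w)%:E)%E.
Proof.
apply/esym; apply: (decouple_clocks (f := fun y => (occ t n y.1 y.2)%:E)).
  by apply/measurable_EFinP; exact: (measurable_occupation jc uh t n mXE mrhoE).
by move=> y; rewrite lee_fin (occupation_ge0 _ _ _ uh).
Qed.

Lemma exponential_le (b : R) n : 0 <= b ->
  P (rho n @^-1` `]-oo, b]) = (1 - expR (- b))%:E.
Proof.
move=> b0; have mb : measurable (rho n @^-1` `]-oo, b]).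
  by rewrite -[X in measurable X]setTI; exact: measurable_funP.
have Pb : P (rho n @^-1` `]b, +oo[) = (expR (- b))%:E.
  by rewrite -integral_exponential_gt//; exact: (rho_iid.1 n _ (measurable_itv _)).
have -> : rho n @^-1` `]-oo, b] = ~` (rho n @^-1` `]b, +oo[).
  apply/seteqP; split=> w /=; rewrite !in_itv/= andbT leNgt; first by move/negP.
  by move=> /negP.
have mb' : measurable (rho n @^-1` `]b, +oo[).
  by rewrite -[X in measurable X]setTI; exact: measurable_funP.
by apply: etrans (probability_setC P mb') _; rewrite EFinB; congr (_ - _)%E.
Qed.

Lemma clocks_ae_ge0 : {ae P, forall w, forall n, 0 <= rho n w}.
Proof.
apply: ae_foralln => n; exists (rho n @^-1` `]-oo, 0[); split.
- by rewrite -[X in measurable X]setTI; exact: measurable_funP.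
- apply: etrans (rho_iid.1 n `]-oo, 0[%classic (measurable_itv _)) _.
  apply: integral0_eq => u /=.
  by rewrite in_itv/= => u0; rewrite lt0_exponential_pdf.
- by move=> w /= /negP; rewrite -ltNge in_itv.
Qed.

Lemma stime_rec n w w' :
  stime n.+1 w w' = stime n w w' + (gamma (X n w))^-1 * rho n w'.
Proof. by rewrite /split_time big_ord_recr. Qed.

Lemma stime_mono w : (forall n, 0 <= rho n w) ->
  forall m n, (m <= n)%N -> stime m w w <= stime n w w.
Proof.
move=> rw m n mn; apply: (@homo_leq _ (fun n => stime n w w) (fun a b => a <= b)) => //.
  by move=> ? ? ?; exact: le_trans.
by move=> i; rewrite stime_rec lerDl mulr_ge0// invr_ge0 ltW.
Qed.

Lemma measurable_stime n : measurable_fun [set: Omega] (fun w => stime n w w).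
Proof.
apply: measurable_sum => j; apply: measurable_funM; last exact: mrho.
exact: (measurableT_comp (measurable_inv_rate jc) (mX X j)).
Qed.

(** As [gamma <= lam], each holding time is at least [rho j / lam]; so [t_n <= t] forces the [n]
    first clocks to be all at most [lam * t], an event of geometric probability. This also rules out
    explosion. *)
Lemma prob_stime_le t n : 0 <= t ->
  (\int[P]_w (step (t - stime n w w))%:E <=
   ((1 - expR (- (lam * t))) ^+ n)%:E)%E.
Proof.
move=> t0; have l0 := jc_lam_gt0 jc.
have lt0 : 0 <= lam * t by rewrite mulr_ge0// ltW.
pose A := \bigcap_(i in [set k | (k < n)%N]) rho i @^-1` `]-oo, (lam * t)%R].
have mA : measurable A.
  apply: bigcap_measurableType => i _.
  by rewrite -[X in measurable X]setTI; exact: measurable_funP.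
have -> : ((1 - expR (- (lam * t))) ^+ n)%:E = P A.
  rewrite (@iid_rect _ _ _ P rho rho_iid n (fun=> `]-oo, (lam * t)%R]%classic))//.
  under eq_bigr do rewrite exponential_le//.
  by rewrite prodEFin big_const_seq count_predT size_iota iter_mulr_1.
have -> : P A = (\int[P]_w (\1_A w)%:E)%E by rewrite integral_indic// setIT.
apply: ae_ge0_le_integral => //.
- by move=> w _; rewrite lee_fin step_ge0.
- apply/measurable_EFinP; apply: (measurableT_comp (@measurable_step R)).
  by apply: measurable_funB => //; exact: measurable_stime.
- by apply/measurable_EFinP; exact: measurable_indic.
apply: filterS clocks_ae_ge0 => w rw _; rewrite lee_fin /step subr_ge0.
case: (leP (stime n w w) t) => [tn|_]; last by rewrite indicE.
rewrite indicE mem_set// => j /= jn; rewrite in_itv/=.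
have := le_trans (stime_mono rw jn) tn.
rewrite stime_rec => tj.
have g0 := Xg j w.
have s0 : 0 <= stime j w w by have := stime_mono rw (leq0n j); rewrite /split_time big_ord0.
have : (gamma (X j w))^-1 * rho j w <= t by apply: le_trans tj; rewrite lerDr.
rewrite ler_pdivrMl// => /le_trans; apply.
by rewrite ler_wpM2r// (jc_rate_le jc).
Qed.

Lemma Zint0 t : Z t 0 = (\int[P]_w (V t (X 0%N w))%:E)%E.
Proof.
apply: eq_integral => w _.
under eq_integral do rewrite /split_time big_ord0 subr0.
by rewrite integral_cst//= probability_setT mule1.
Qed.

Lemma Zint_sum t N : Z t 0 = (\sum_(n < N) J t n + Z t N)%E.
Proof.
elim: N => [|N ih]; first by rewrite big_ord0 add0e.
by rewrite big_ord_recr/= -addeA -(Zint_rec jc Xg XM rho_iid uh).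
Qed.

(** [V s] is at most 1 and vanishes for [s < 0], so the remainder is at most the probability of [N]
    jumps by time [t]. *)
Lemma Zint_le t N : 0 <= t ->
  (Z t N <= ((1 - expR (- (lam * t))) ^+ N)%:E)%E.
Proof.
move=> t0; apply: le_trans (prob_stime_le N t0).
have m1 : measurable_fun [set: EX * Erho]
    (fun y : EX * Erho => (step (t - stime N y.1 y.2))%:E).
  apply/measurable_EFinP; apply: (measurableT_comp (@measurable_step R)).
  apply: measurable_funB => //.
  exact: (measurable_split_time jc (fun j _ => mXE j) (fun j _ => mrhoE j)).
have p1 (y : EX * Erho) : (0 <= (step (t - stime N y.1 y.2))%:E)%E.
  by rewrite lee_fin step_ge0.
rewrite [leRHS](decouple_clocks m1 p1).
have mtt : measurable_fun [set: Omega * Omega] (fun y => t - stime N y.1 y.2).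
  apply: measurable_funB => //.
  exact: (measurable_split_time jc (fun j _ => mX X j) (fun j _ => mrho rho j)).
have mV : measurable_fun [set: Omega * Omega]
    (fun y => (V (t - stime N y.1 y.2) (X N y.1))%:E).
  apply/measurable_EFinP; apply: (measurableT_comp (measurable_semigT jc uh)
      (g := fun y => (t - stime N y.1 y.2, X N y.1 : T))).
  apply: measurable_fun_pair => //.
  exact: (measurableT_comp (mX X N) measurable_fst).
have ms : measurable_fun [set: Omega * Omega]
    (fun y => (step (t - stime N y.1 y.2))%:E).
  by apply/measurable_EFinP; apply: (measurableT_comp (@measurable_step R)).
have V0 y : (0 <= (V (t - stime N y.1 y.2) (X N y.1))%:E)%E.
  by rewrite lee_fin; case/andP: (semigT_unit jc uh (t - stime N y.1 y.2) (X N y.1)).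
have s0 y : (0 <= (step (t - stime N y.1 y.2))%:E)%E by rewrite lee_fin step_ge0.
apply: ge0_le_integral => //.
- by move=> w _; apply: integral_ge0 => w' _; exact: (V0 (w, w')).
- exact: (@measurable_fun_fubini_tonelli_F _ _ _ _ _ P _ mV V0).
- exact: (@measurable_fun_fubini_tonelli_F _ _ _ _ _ P _ ms s0).
move=> w _; apply: ge0_le_integral => //.
- by move=> w' _; exact: (V0 (w, w')).
- exact: (measurableT_comp mV (pair1_measurable w)).
- exact: (measurableT_comp ms (pair1_measurable w)).
move=> w' _; rewrite lee_fin /step; case: (leP 0 (t - stime N w w')) => s1.
  by case/andP: (semigT_unit jc uh (t - stime N w w') (X N w)).
by rewrite /semigT /step [0 <= t - _]leNgt s1 mul0r.
Qed.

(** * Summation over the holding intervals *)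

Section process.
Variables (t : R) (k : Omega -> T).
Hypothesis mk : measurable_fun [set: Omega] k.
Hypothesis t0 : 0 <= t.
Hypothesis kX : {ae P, forall w, forall n,
  stime n w w <= t < stime n.+1 w w -> k w = X n w}.

(** With nonnegative clocks the holding intervals are disjoint and fill the times before [t_N]: one
    term survives if [t < t_N], none otherwise. *)
Lemma sum_occ w : (forall n, 0 <= rho n w) ->
  (forall n, stime n w w <= t < stime n.+1 w w -> k w = X n w) ->
  forall N, \sum_(n < N) occ t n w w = h (k w) * (1 - step (t - stime N w w)).
Proof.
move=> rw kw; elim=> [|N ih].
  by rewrite big_ord0 /split_time big_ord0 subr0 /step t0 subrr mulr0.
rewrite big_ord_recr/= ih /occupation /step /stepo !subr_ge0 subr_gt0.
have := stime_mono rw (leqnSn N).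
case: (leP (stime N w w) t) => [tN|tN] SN.
  case: (ltP t (stime N.+1 w w)) => [tS|tS].
    by rewrite /= subrr subr0 mulr0 add0r !mulr1 (kw N) // tN.
  by rewrite /= subrr !mulr0 addr0.
have tS : t < stime N.+1 w w by exact: lt_le_trans SN.
by rewrite [_ <= t]leNgt tS /= mul0r mulr0 addr0.
Qed.

(** Both sides are [\sum_(n < N) J t n] plus a nonnegative remainder at most [q ^+ N]: the left one
    through the paths, the right one through the renewal recursion. *)
Lemma jump_law_semigT :
  (\int[P]_w (h (k w))%:E = \int[P]_w (V t (X 0%N w))%:E)%E.
Proof.
rewrite -Zint0.
pose q := 1 - expR (- (lam * t)).
have l0 := jc_lam_gt0 jc.
have q0 : 0 <= q.
  by rewrite subr_ge0 -expR0 ler_expR oppr_le0 mulr_ge0// ltW.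
have q1 : q < 1 by rewrite ltrBlDr ltrDl expR_gt0.
have mh : measurable_fun [set: Omega] (fun w => h (k w)).
  by case: uh => mh _; exact: (measurableT_comp mh mk).
have h01 w : 0 <= h (k w) <= 1 := unit_fun_bounds uh (k w).
have mst N : measurable_fun [set: Omega] (fun w => step (t - stime N w w)).
  apply: (measurableT_comp (@measurable_step R)); apply: measurable_funB => //.
  exact: measurable_stime.
have mocc n : measurable_fun [set: Omega] (fun w => occ t n w w).
  apply: (measurableT_comp (measurable_occupation jc uh t n (mX X) (mrho rho))
    (g := fun w : Omega => (w, w))).
  exact: measurable_fun_pair.
have occ0 n w : (0 <= (occ t n w w)%:E)%E by rewrite lee_fin (occupation_ge0 _ _ _ uh).
have hs0 N w : 0 <= h (k w) * step (t - stime N w w).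
  by case/andP: (h01 w) => *; rewrite mulr_ge0// step_ge0.
have mhs N : measurable_fun [set: Omega] (fun w => (h (k w) * step (t - stime N w w))%:E).
  by apply/measurable_EFinP; exact: measurable_funM.
have mS N : measurable_fun [set: Omega] (fun w => \sum_(n < N) (occ t n w w)%:E)%E.
  by apply: emeasurable_sum => n; apply/measurable_EFinP.
have key N : (\int[P]_w (h (k w))%:E = \sum_(n < N) J t n +
    \int[P]_w (h (k w) * step (t - stime N w w))%:E)%E.
  have -> : (\sum_(n < N) J t n = \int[P]_w (\sum_(n < N) (occ t n w w)%:E))%E.
    rewrite ge0_integral_sum//.
    - by apply: eq_bigr => n _; rewrite Jint_diag.
    - by move=> n; apply/measurable_EFinP.
  rewrite -ge0_integralD//; last 2 first.
  - by move=> w _; apply: sume_ge0.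
  - by move=> w _; rewrite lee_fin.
  apply: ge0_ae_eq_integral => //.
  - by apply/measurable_EFinP.
  - exact: emeasurable_funD.
  - by move=> w _; rewrite lee_fin; case/andP: (h01 w).
  - by move=> w _; rewrite adde_ge0 ?lee_fin// sume_ge0.
  move: kX; apply: filterS2 clocks_ae_ge0 => w rw kw _.
  by rewrite sumEFin sum_occ// -EFinD; congr EFin; ring.
have err N : (\int[P]_w (h (k w) * step (t - stime N w w))%:E <= (q ^+ N)%:E)%E.
  apply: le_trans (prob_stime_le N t0); apply: ge0_le_integral => //.
  - by move=> w _; rewrite lee_fin.
  - by apply/measurable_EFinP.
  - by move=> w _; rewrite lee_fin ler_piMl ?step_ge0//; case/andP: (h01 w).
have small (e : R) : 0 < e -> exists N, q ^+ N <= e.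
  move=> e0; have := @cvg_expr R q; rewrite ger0_norm// => /(_ q1).
  move=> /cvgrPdist_le /(_ e e0)[N _ /(_ N (leqnn N))].
  by rewrite sub0r normrN ger0_norm ?exprn_ge0// => ?; exists N.
apply/eqP; rewrite eq_le; apply/andP; split; apply/lee_addgt0Pr => e e0;
  have [N qN] := small e e0.
- rewrite (key N) (Zint_sum t N) -addeA; apply: leeD2l.
  apply: le_trans (err N) _; rewrite -[leLHS]add0e; apply: leeD; last by rewrite lee_fin.
  apply: integral_ge0 => w _; apply: integral_ge0 => w' _.
  by rewrite lee_fin; case/andP: (semigT_unit jc uh (t - stime N w w') (X N w)).
- rewrite (key N) (Zint_sum t N) -addeA; apply: leeD2l.
  apply: le_trans (Zint_le N t0) _; rewrite -[leLHS]add0e.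
  apply: leeD; last by rewrite lee_fin.
  by apply: integral_ge0 => w _; rewrite lee_fin.
Qed.

End process.

End jump_law.

(** * Measurability on the torus *)

Section torus_measurability.
Variable R : realType.
Local Notation T := (torus R).
Local Notation dk := (torus_lebesgue R).

Lemma torus_openE (U : set T) : open U = open (@torus_proj R @^-1` U).
Proof. by []. Qed.

Lemma torus_reprK (k : T) : torus_proj (repr k) = k.
Proof. exact: reprK. Qed.

Lemma torus_proj_shift (x : R) (m : int) : torus_proj (x + m%:~R * (2 * pi)) = torus_proj x.
Proof.
apply/torus_projE; rewrite addrAC subrr add0r mulfK ?intr_int//.
by rewrite mulf_neq0// gt_eqF// pi_gt0.
Qed.

Let c2pi : 0 < 2 * pi :> R. Proof. by rewrite mulr_gt0// pi_gt0. Qed.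

(** [repr] is an arbitrary representative; removing the right multiple of the period gives the one
    in [0, 2 pi), a Borel section of the projection. *)
Definition torus_sec (k : T) : R :=
  repr k - (Num.floor (repr k / (2 * pi)))%:~R * (2 * pi).

Lemma torus_secK k : torus_proj (torus_sec k) = k.
Proof. by rewrite /torus_sec -mulNr -intrN torus_proj_shift torus_reprK. Qed.

Lemma torus_sec_ge0 k : 0 <= torus_sec k.
Proof. by rewrite subr_ge0 -ler_pdivlMr// floor_le_tmp. Qed.

Lemma torus_sec_lt k : torus_sec k < 2 * pi.
Proof.
have h : repr k < ((Num.floor (repr k / (2 * pi)))%:~R + 1) * (2 * pi).
  by rewrite -ltr_pdivrMr// -[X in _ + X]/(1%:~R) -intrD floorD1_gt.
by rewrite /torus_sec ltrBlDl; move: h; rewrite mulrDl mul1r.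
Qed.

Lemma torus_projK x : 0 <= x < 2 * pi -> torus_sec (torus_proj x) = x.
Proof.
move=> /andP[x0 x2]; have := torus_secK (torus_proj x) => /torus_projE.
have s0 := torus_sec_ge0 (torus_proj x); have s2 := torus_sec_lt (torus_proj x).
move=> /intrP[m]; set s := torus_sec _ in s0 s2 * => mE.
have sE : s - x = m%:~R * (2 * pi) by rewrite -mE divfK// gt_eqF.
have m1 : m%:~R < 1 :> R by rewrite -(ltr_pM2r c2pi) -sE mul1r; lra.
have m2 : -1 < m%:~R :> R by rewrite -(ltr_pM2r c2pi) -sE mulN1r; lra.
have m0 : m = 0.
  have h1 : (m < 1)%R by rewrite -(ltr_int R).
  have h2 : (-1 < m)%R by rewrite -(ltr_int R).
  by apply/eqP; rewrite eq_le -ltzD1 add0r h1 /=; move: h2; rewrite -lezD1 addNr.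
by apply/eqP; rewrite -subr_eq0 sE m0 mul0r.
Qed.

(** The section jumps at the class of 0 but is lower semicontinuous: for [a >= 0] the set where it
    exceeds [a] is the image of the open arc from [a] to [2 * pi], whose preimage is a union of open
    translates. *)
Lemma measurable_torus_sec : measurable_fun [set: T] torus_sec.
Proof.
apply: (measurability _ (RGenOInfty.measurableE R)) => //.
move=> /= _ [_ [a ->] <-].
rewrite setTI; have [a0|a0] := ltP a 0.
  rewrite (_ : _ @^-1` _ = setT)//; apply/seteqP; split=> // k _ /=.
  by rewrite in_itv/= andbT (lt_le_trans a0)// torus_sec_ge0.
rewrite (_ : _ @^-1` _ = [set torus_proj x | x in `]a, (2 * pi)%R[%classic]); last first.
  apply/seteqP; split=> [k /=|_ [x /= + <-]]; rewrite !in_itv/= ?andbT.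
    by move=> ak; exists (torus_sec k); rewrite ?torus_secK//= in_itv/= ak torus_sec_lt.
  by move=> /andP[ax x2]; rewrite torus_projK// x2 (le_trans a0)// ltW.
apply: sub_sigma_algebra; rewrite torus_openE.
rewrite (_ : _ @^-1` _ = \bigcup_(m : int)
    `]a + m%:~R * (2 * pi), (2 * pi + m%:~R * (2 * pi))%R[%classic); last first.
  apply/seteqP; split=> [y [x /= + /torus_projE /intrP[m xy]]|y [m _ /=]].
    have {}xy : x = y + m%:~R * (2 * pi).
      by rewrite -xy divfK ?gt_eqF// addrC subrK.
    rewrite !in_itv/= xy => /andP[h1 h2]; exists (- m) => //=.
    by rewrite in_itv/= intrN; apply/andP; split; lra.
  rewrite in_itv/= => /andP[h1 h2].
  exists (y + (- m)%:~R * (2 * pi)); last by rewrite torus_proj_shift.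
  by rewrite /= in_itv/= intrN; apply/andP; split; lra.
by apply: bigcup_open => m _; exact: itv_open.
Qed.

Lemma measurable_continuous_torus (f : T -> R) : continuous f ->
  measurable_fun [set: T] f.
Proof.
move=> cf; apply: (measurability _ (RGenOInfty.measurableE R)) => //.
move=> /= _ [_ [a ->] <-].
rewrite setTI; apply: sub_sigma_algebra.
by move/continuousP : cf; apply; exact: rray_open.
Qed.

(* Continuity only gives measurability for the Borel sets of the product topology;
   for the product sigma-algebra, [r] is the limit of [r (phi n theta) k] where
   [phi n] takes countably many values. *)
Lemma measurable_kernel_torus (r : T -> T -> R) :
  continuous (fun x : T * T => r x.1 x.2) ->
  measurable_fun [set: T * T] (fun x => r x.1 x.2).
Proof.
move=> cr.
pose phi n (k : T) : T := torus_proj ((Num.truncn (n.+1%:R * torus_sec k))%:R / n.+1%:R).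
have cphi k : phi n k @[n --> \oo] --> k.
  rewrite -[X in _ --> X]torus_secK.
  suff cx : (Num.truncn (n.+1%:R * torus_sec k))%:R / n.+1%:R @[n --> \oo] --> torus_sec k.
    exact: (cvg_comp _ _ cx (@continuous_torus_proj R (torus_sec k))).
  apply/cvgrPdist_le => e e0; have [N Ne] := natSinv_lt e0.
  exists N => // n /= Nn.
  have n0 : 0 < n.+1%:R :> R by [].
  have x0 : 0 <= n.+1%:R * torus_sec k by rewrite mulr_ge0// torus_sec_ge0.
  have /andP[t1 t2] := truncn_itv x0.
  have ne : n.+1%:R^-1 <= e.
    by apply: le_trans (ltW Ne); rewrite lef_pV2 ?posrE// ler_nat.
  apply: le_trans ne; rewrite -(ler_pM2l n0) mulfV ?gt_eqF//.
  rewrite -{1}(gtr0_norm n0) -normrM mulrBr [X in _ - X]mulrCA mulfV ?gt_eqF// mulr1.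
  rewrite ger0_norm ?subr_ge0//.
  by move: t2; rewrite -natr1; lra.
apply: (@measurable_fun_cvg _ _ _ _ (fun n (x : T * T) => r (phi n x.1) x.2)) => [n|x _].
  move=> _ B mB; rewrite setTI.
  rewrite (_ : _ @^-1` _ = \bigcup_m
    ([set k | Num.truncn (n.+1%:R * torus_sec k) = m] `*`
     (r (torus_proj (m%:R / n.+1%:R)) @^-1` B))).
    apply: bigcup_measurable => m _; apply: measurableX.
      rewrite (_ : [set k | _] = torus_sec @^-1`
          `[m%:R / n.+1%:R, m.+1%:R / n.+1%:R[%classic).
        rewrite -[X in measurable X]setTI; exact: measurable_torus_sec.
      apply/seteqP; split=> k /=.
        move/eqP; rewrite truncn_eq ?mulr_ge0 ?torus_sec_ge0// in_itv/=.
        by rewrite ler_pdivrMr// ltr_pdivlMr// [_ * n.+1%:R]mulrC.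
      rewrite in_itv/= ler_pdivrMr// ltr_pdivlMr// [_ * n.+1%:R]mulrC => h.
      by apply/eqP; rewrite truncn_eq ?mulr_ge0 ?torus_sec_ge0.
    rewrite -[X in measurable X]setTI; apply: measurable_continuous_torus => //.
    move=> k; set th := torus_proj _.
    exact: (cvg_comp _ _ (cvg_pair (cvg_cst th) cvg_id) (cr (th, k))).
  apply/seteqP; split=> [x Bx|x [m _ [/= xm]]].
    by exists (Num.truncn (n.+1%:R * torus_sec x.1)).
  by rewrite /phi xm.
case: x => th k /=.
exact: (cvg_comp _ _ (cvg_pair (cphi th) (cvg_cst k)) (cr (th, k))).
Qed.

Lemma measurable_torusN : measurable_fun [set: T] (-%R : T -> T).
Proof.
apply: (@measurability _ _ _ _ _ _ (@open T)) => //.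
move=> _ [U oU <-]; rewrite setTI; apply: sub_sigma_algebra.
rewrite torus_openE.
rewrite (_ : _ @^-1` _ = -%R @^-1` (@torus_proj R @^-1` U)).
  by move/continuousP : (@oppr_continuous R R); apply; rewrite -torus_openE.
by apply/seteqP; split => x /=; rewrite torus_projN.
Qed.

Lemma torus_lebesgueN (A : set T) : measurable A -> dk (-%R @^-1` A) = dk A.
Proof.
move=> mA; rewrite /torus_lebesgue.
have mB : measurable (@torus_proj R @^-1` A `&` `[- pi, pi]).
  apply: measurableI; last exact: measurable_itv.
  by rewrite -[X in measurable X]setTI; exact: measurable_torus_proj.
rewrite -[RHS](lebesgue_measureN mB) /pushforward; congr (lebesgue_measure _).
by apply/seteqP; split=> x /=; rewrite torus_projN !in_itv/= => -[? /andP[? ?]];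
  split=> //; apply/andP; split; lra.
Qed.

Lemma integral_torusN (g : T -> R) : measurable_fun [set: T] g ->
  (forall x, 0 <= g x) ->
  (\int[dk]_x (g (- x))%:E = \int[dk]_x (g x)%:E)%E.
Proof.
move=> mg g0.
have mg' : measurable_fun [set: T] (EFin \o g) by exact/measurable_EFinP.
rewrite -(@ge0_integral_pushforward _ _ _ _ _ (-%R : T -> T) measurable_torusN
  dk setT (EFin \o g))//; last first.
  by move=> x _ /=; rewrite lee_fin.
by apply: eq_measure_integral => [|mN A mA _];
  [exact: measurable_torusN|exact: torus_lebesgueN].
Qed.

End torus_measurability.

(** * The process on the torus *)

Section torus_coefficients.
Variable R : realType.
Local Notation T := (torus R).
Local Notation dk := (torus_lebesgue R).
Variables (r : T -> T -> R) (r0 : R) (gamma : T -> R) (k0 : T) (tstar : R).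
Hypotheses (hr : admissible_kernel r r0) (hg : admissible_rate gamma k0 tstar).
Local Notation lam := (tstar^-1).

Lemma admissible_coefficients : jump_coefficients dk r r0 gamma lam.
Proof.
split.
- exact: measurable_kernel_torus (kernel_continuous hr).
- exact: kernel_r0_gt0 hr.
- exact: kernel_bounds hr.
- exact: kernel_stochastic hr.
- exact: kernel_costochastic hr.
- exact: rate_measurable hg.
- exact: rate_ge0 hg.
- by rewrite invr_gt0; exact: rate_tstar_gt0 hg.
- exact: rate_le hg.
Qed.

Let jc := admissible_coefficients.

Lemma rate_eq0 k : gamma k = 0 -> k = k0 \/ k = - k0.
Proof.
move=> gk; apply: contrapT => /not_orP[h1 h2].
by have := rate_gt0 hg h1 h2; rewrite gk ltxx.
Qed.

Lemma countable_torus_fiber (k : T) : countable (@torus_proj R @^-1` [set k]).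
Proof.
apply: (@sub_countable _ _ _ [set repr k + m%:~R * (2 * pi) | m in [set: int]]).
  apply: subset_card_le => x /= xk; have := esym (torus_reprK k); rewrite -xk.
  move=> /torus_projE /intrP[m xm]; exists m => //.
  rewrite -xm divfK ?gt_eqF ?mulr_gt0 ?pi_gt0//.
  by rewrite xk; ring.
by apply: (sub_countable (card_image_le _ _)); exact: countableP.
Qed.

Lemma rate_eq0_null : dk [set k | gamma k = 0] = 0%E.
Proof.
rewrite /torus_lebesgue; apply: countable_lebesgue_measure0.
apply: (@sub_countable _ _ _
  (\bigcup_(k in [set k0; - k0]) (@torus_proj R @^-1` [set k]))).
  by apply: subset_card_le => x [/= /rate_eq0 xk _]; exists (torus_proj x).
apply: bigcup_countable => [|k _]; last exact: countable_torus_fiber.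
by apply: finite_set_countable; exact: finite_set2.
Qed.

End torus_coefficients.

Section process_law.
Context (R : realType) d (Omega : measurableType d) (P : probability Omega R).
Local Notation T := (torus R).
Local Notation dk := (torus_lebesgue R).
Variables (r : T -> T -> R) (r0 : R) (gamma : T -> R) (k0 : T) (tstar : R).
Hypotheses (hr : admissible_kernel r r0) (hg : admissible_rate gamma k0 tstar).
Local Notation lam := (tstar^-1).
Variable K : R -> {RV P >-> T}.
Hypothesis hK : jump_process P r gamma k0 K.
Let jc := admissible_coefficients hr hg.

Lemma Rintegral_distribution (X : {RV P >-> T}) (h : T -> R) : unit_fun h ->
  \int[distribution P X]_x h x = \int[P]_w h (X w).
Proof.
move=> [mh h01]; congr fine.
rewrite (@ge0_integral_distribution _ _ _ _ _ P X (EFin \o h))//.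
  exact/measurable_EFinP.
by move=> x; rewrite lee_fin; case/andP: (h01 x).
Qed.

(** [nu] is the law of [X 0]; it does not charge the zeros of [gamma] because the chain avoids [k0]
    and [- k0]. *)
Lemma jump_process_law : exists2 nu : probability T R,
  nu [set k | gamma k = 0] = 0%E &
  forall t h, 0 <= t -> unit_fun h ->
    \int[distribution P (K t)]_x h x = \int[nu]_x semig dk r gamma lam (lam * t) h x.
Proof.
have [X [rho [Xk XM rho_iid Xrho KX]]] := hK.
have Xg n w : 0 < gamma (X n w).
  by have [h1 h2] := Xk n w; exact: (rate_gt0 hg).
exists (distribution P (X 0%N)) => [|t h t0 uh].
  transitivity (P set0); last exact: measure0.
  congr (P _); apply/seteqP; split=> // w /= gw.
  by have := Xg 0%N w; rewrite gw ltxx.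
have uw : unit_fun (semig dk r gamma lam (lam * t) h).
  by apply: (unit_fun_semig jc) => //; rewrite mulr_ge0// ltW// (jc_lam_gt0 jc).
rewrite !Rintegral_distribution//; congr fine.
have kX : {ae P, forall w, forall n, split_time gamma X rho n w w <= t <
    split_time gamma X rho n.+1 w w -> K t w = X n w}.
  by move: KX; apply: filterS => w Kw n; exact: Kw.
rewrite (jump_law_semigT jc Xg XM rho_iid Xrho uh (measurable_funP (K t)) t0 kX).
by apply: eq_integral => w _; rewrite /semigT /step t0 mul1r.
Qed.

(** The comparison value involves [h], [t] and [k] but not the process, so it links two processes
    with different initial laws. Dividing [Z] by [lam] returns to the original time scale. *)
Lemma jump_process_mixing (e : R) : 0 < e -> exists2 t0 : R, 0 < t0 &
  forall t h k, t0 <= t -> unit_fun h ->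
    `|\int[distribution P (K t)]_x h x -
      Rop dk r (semig dk r gamma lam (lam * t) h) k| <= e.
Proof.
move=> e0; have [nu nu0 nuK] := jump_process_law.
have l0 := jc_lam_gt0 jc.
have [Z Z0 HZ] := semig_mixing jc (rate_eq0_null hg) nu0 e0.
exists (Z / lam); first by rewrite divr_gt0.
move=> t h k Zt uh; rewrite nuK//.
  by apply: HZ => //; rewrite mulrC -ler_pdivrMr.
by apply: le_trans Zt; rewrite divr_ge0// ltW.
Qed.

End process_law.

(** * Concentration *)

Section total_variation_bound.
Context d (T : measurableType d) (R : realType).

Lemma tv_norm_ge0 (nu : {charge set T -> \bar R}) : (0 <= tv_norm nu)%E.
Proof. by rewrite /tv_norm /charge_variation/= adde_ge0. Qed.

(** The variation is the value on the positive Hahn set minus that on the negative one, each at most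
    [e]; hence the factor 2. *)
Lemma tv_norm_le (nu : {charge set T -> \bar R}) (e : R) :
  (forall A, measurable A -> `|nu A| <= e%:E)%E -> (tv_norm nu <= (2 * e)%:E)%E.
Proof.
move=> nue; rewrite /tv_norm /charge_variation/=; set P := cid _.
set N := cid _; have [[mP _] [mN _] _ _] := svalP N.
rewrite jordan_posE cjordan_posE jordan_negE cjordan_negE /crestr0 /crestr.
rewrite !mem_set// !setTI mulrDl mul1r EFinD; apply: leeD.
  by apply: le_trans (nue _ mP); exact: lee_abs.
by apply: le_trans (nue _ mN); rewrite -abseN lee_abs.
Qed.

End total_variation_bound.

Section torus_continuity.
Variable R : realType.
Local Notation T := (torus R).

(** Lifts to the line: if the distance is below [delta], some representative [x] of [k - l] has norm
    below [delta], and [repr l + x] represents [k]. *)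
Lemma continuous_torus_dist (f : T -> R) (l : T) (e : R) : continuous f -> 0 < e ->
  exists2 delta : R, 0 < delta &
    forall k, torus_dist k l < delta -> `|f k - f l| <= e.
Proof.
move=> cf e0; have cF : {for repr l, continuous (f \o @torus_proj R)}.
  by apply: continuous_comp; [exact: continuous_torus_proj|exact: cf].
have /cvgrPdist_le/(_ e e0)/nbhs_ballP[delta /= d0 Hd] := cF.
exists delta => // k kl.
have [_ [x /= xE <-] xd] : exists2 y,
    [set `|x| | x in [set x | torus_proj x = k - l]] y & y < delta.
  apply: inf_lt kl.
  by exists `|repr (k - l)|; exists (repr (k - l)) => //=; exact: torus_reprK.
have := Hd (repr l + x); rewrite /ball/= opprD addNKr normrN => /(_ xd).
by rewrite torus_projD torus_reprK xE [l + _]addrC subrK distrC.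
Qed.

Lemma continuous_comp_torusN (f : T -> R) : continuous f ->
  continuous (f \o (-%R : T -> T)).
Proof.
move=> cf; apply/continuousP => U oU; rewrite torus_openE.
rewrite (_ : _ @^-1` _ = -%R @^-1` (@torus_proj R @^-1` (f @^-1` U))).
  move/continuousP : (@oppr_continuous R R); apply; rewrite -torus_openE.
  by move/continuousP : cf; apply.
by apply/seteqP; split => x /=; rewrite torus_projN.
Qed.

End torus_continuity.

Section concentration.
Variable R : realType.
Local Notation T := (torus R).
Local Notation dk := (torus_lebesgue R).
Variables (r : T -> T -> R) (r0 : R) (gamma : T -> R) (k0 : T) (tstar : R).
Hypotheses (hr : admissible_kernel r r0) (hg : admissible_rate gamma k0 tstar).
Local Notation lam := (tstar^-1).
Let jc := admissible_coefficients hr hg.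
Local Notation Rop := (Rop dk r).
Local Notation semig := (semig dk r gamma lam).

Lemma small_rate_near_k0 (delta : R) : 0 < delta -> exists2 c : R, 0 < c &
  forall k, gamma k < c -> torus_dist k k0 < delta \/ torus_dist k (- k0) < delta.
Proof.
move=> d0; have := rate_inf_gt0 hg d0; set S := ereal_inf _ => S0.
(* The infimum is [+oo] when no point is that far from the zeros; then [c = 1] will do. *)
have [c c0 cS] : exists2 c : R, 0 < c & (c%:E <= S)%E.
  move: S0; case: S => [x| |] // x0; last by exists 1 => //; exact: leey.
  by exists x.
exists c => // k; apply: contraPP => /not_orP[/negP h1 /negP h2]; apply/negP.
rewrite -leNgt -lee_fin; apply: le_trans cS _; apply: ereal_inf_lbound.
by exists k => //=; rewrite le_min !leNgt h1.
Qed.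

Lemma Rop_semigN (z : R) (h : T -> R) (k : T) : 0 <= z -> unit_fun h ->
  Rop (semig z (h \o (-%R : T -> T))) k = Rop (semig z h) (- k).
Proof.
move=> z0 uh; have rN := kernel_even hr; have gN := rate_even hg.
rewrite -(Rop_comp jc (@integral_torusN R) rN _
  (unit_fun_semig jc z0 uh)).
congr (Rop _ k); apply/funext => x /=.
by rewrite (semig_comp jc (@integral_torusN R) rN gN).
Qed.

Section near_constant.
Variables (g : T -> R) (c a eta : R).
Hypothesis ug : unit_fun g.
Hypothesis gc : forall x, gamma x < a -> `|g x - c| <= eta.
Hypothesis c01 : 0 <= c <= 1.
Hypothesis eta0 : 0 <= eta.
Let A := [set k | a <= gamma k].

(** The pointwise bound [|g - c| <= eta + \1_A] is propagated by the semigroup and then by [Rop],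
    one side at a time. *)
Lemma Rop_semig_near_constant (z : R) (k : T) : 0 <= z ->
  `|Rop (semig z g) k - c| <= eta + Rop (semig z \1_A) k.
Proof.
have lin (u v : R) : 1 * u + -1 * v <= c + eta -> -1 * u + -1 * v <= eta - c ->
    `|u - c| <= eta + v.
  by move=> h1 h2; rewrite ler_norml; apply/andP; split; lra.
move=> z0; have uA : unit_fun (\1_A : T -> R).
  by apply: unit_fun_indic; exact: (measurable_rate_ge jc).
have bg := unit_fun_bmf (unit_fun_semig jc z0 ug).
have bA := unit_fun_bmf (unit_fun_semig jc z0 uA).
have gcA x : `|g x - c| <= eta + \1_A x.
  rewrite indicE; have [|] := boolP (x \in A).
    move=> _; apply: (@le_trans _ _ 1); last by rewrite lerDr.
    have := unit_fun_bounds ug x; move: c01 => /andP[? ?] /andP[? ?].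
    by rewrite ler_norml; apply/andP; split; lra.
  rewrite notin_setE /A/= => /negP; rewrite -ltNge addr0; exact: gc.
have side e M : (forall x, e * g x + (-1) * \1_A x <= M) ->
    e * Rop (semig z g) k + (-1) * Rop (semig z \1_A) k <= M.
  move=> eM; rewrite -(Rop_lin jc)// -[leRHS](Rop_cst jc M k).
  apply: (ler_Rop jc) => [||x]; [exact: bmf_lin|exact: bmf_cst|].
  exact: (semig_lin_le jc).
have h1 : 1 * Rop (semig z g) k + -1 * Rop (semig z \1_A) k <= c + eta.
  by apply: side => x; have := gcA x; rewrite ler_norml => /andP[_]; lra.
have h2 : -1 * Rop (semig z g) k + -1 * Rop (semig z \1_A) k <= eta - c.
  by apply: side => x; have := gcA x; rewrite ler_norml => /andP[+ _]; lra.
exact: lin.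
Qed.

End near_constant.

(** Concentration alone does not say how the mass splits between the two zeros. The average [g] of
    [h] and its reflection takes the same value [c] at both, so it is near [c] wherever [gamma] is
    small, and symmetry turns this into a statement on [h] at [k] and [- k]. *)
Lemma Rop_semig_concentrates (h : T -> R) (e : R) : unit_fun h -> continuous h -> 0 < e ->
  exists2 t0 : R, 0 < t0 & forall t k, t0 <= t ->
    `|(Rop (semig (lam * t) h) k + Rop (semig (lam * t) h) (- k)) / 2 -
      (h k0 + h (- k0)) / 2| <= e.
Proof.
move=> uh ch e0; have l0 := jc_lam_gt0 jc.
pose g x := 2^-1 * h x + 2^-1 * (h \o (-%R : T -> T)) x.
have uhN : unit_fun (h \o (-%R : T -> T)) by exact: unit_fun_comp (@measurable_torusN R) _ uh.
have ug : unit_fun g.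
  split; first by case: uh uhN => mh _ [mhN _]; apply: measurable_funD; exact: measurable_funM.
  move=> x; have /andP[? ?] := unit_fun_bounds uh x.
  by have /andP[? ?] := unit_fun_bounds uhN x; apply/andP; split; rewrite /g; lra.
pose c := (h k0 + h (- k0)) / 2.
have c01 : 0 <= c <= 1.
  have /andP[? ?] := unit_fun_bounds uh k0.
  by have /andP[? ?] := unit_fun_bounds uh (- k0); apply/andP; split; rewrite /c; lra.
have e2 : 0 < e / 2 by rewrite divr_gt0.
have cont l : exists2 delta : R, 0 < delta &
    forall k, torus_dist k l < delta -> `|h k - h l| <= e / 2.
  exact: continuous_torus_dist.
have contN l : exists2 delta : R, 0 < delta &
    forall k, torus_dist k l < delta -> `|h (- k) - h (- l)| <= e / 2.
  apply: (@continuous_torus_dist _ (h \o (-%R : T -> T))) => //.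
  exact: continuous_comp_torusN.
have [d1 d10 H1] := cont k0; have [d2 d20 H2] := contN k0.
have [d3 d30 H3] := cont (- k0); have [d4 d40 H4] := contN (- k0).
pose delta := Num.min (Num.min d1 d2) (Num.min d3 d4).
have delta0 : 0 < delta by rewrite !lt_min d10 d20 d30.
have [a a0 near] := small_rate_near_k0 delta0.
have gc x : gamma x < a -> `|g x - c| <= e / 2.
  move=> /near[]; rewrite /delta !lt_min => /andP[/andP[x1 x2] /andP[x3 x4]].
    have := H1 x x1; have := H2 x x2; rewrite !ler_norml => /andP[? ?] /andP[? ?].
    by apply/andP; split; rewrite /g /c/=; lra.
  have := H3 x x3; have := H4 x x4; rewrite opprK !ler_norml => /andP[? ?] /andP[? ?].
  by apply/andP; split; rewrite /g /c/=; lra.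
have [Z Z0 HZ] := semig_escape jc (rate_eq0_null hg) (rate_inv_not_integrable hg) a0 e2.
exists (Z / lam); first by rewrite divr_gt0.
move=> t k; rewrite ler_pdivrMr// mulrC => Zt.
have z0 : 0 <= lam * t by rewrite (le_trans _ Zt)// ltW.
have := Rop_semig_near_constant ug gc c01 (ltW e2) k z0.
have -> : Rop (semig (lam * t) g) k =
    (Rop (semig (lam * t) h) k + Rop (semig (lam * t) h) (- k)) / 2.
  rewrite -Rop_semigN// mulrDl ![_ / 2]mulrC.
  rewrite -(Rop_lin jc); last 2 first.
  - exact/unit_fun_bmf/(unit_fun_semig jc).
  - exact/unit_fun_bmf/(unit_fun_semig jc).
  by congr (Rop _ k); apply/funext => x; exact: (semig_lin jc).
by move=> /le_trans; apply; rewrite [leRHS]splitr lerD2l HZ.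
Qed.

End concentration.

(** * Limits *)

Lemma cvge_pinfty_fin (R : realType) (u : R -> \bar R) (l : R) :
  (forall e : R, 0 < e -> exists t0 : R, forall t, t0 <= t ->
    exists2 x : R, u t = x%:E & `|x - l| <= e) ->
  (u t @[t --> +oo%R] --> l%:E)%E.
Proof.
move=> ul; apply/fine_cvgP; split.
  have [t0 H] := ul 1 ltr01.
  near=> t; have [|x -> _ //] := H t.
  by near: t; apply: nbhs_pinfty_ge; exact: num_real.
apply/cvgrPdist_le => e e0; have [t0 H] := ul e e0.
near=> t; have [|x uE xl] := H t.
  by near: t; apply: nbhs_pinfty_ge; exact: num_real.
by rewrite /= uE/= distrC.
Unshelve. all: by end_near. Qed.

Section weak_limit.
Variable R : realType.
Local Notation T := (torus R).

(** Reduces a signed integrand to a nonnegative one, for which integration against [mu_star] is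
    computed. *)
Lemma integral_shift (m : {measure set T -> \bar R}) (f : T -> R) (M : R) :
  m [set: T] = 1%E -> measurable_fun [set: T] f -> (forall x, `|f x| <= M) ->
  (\int[m]_x (f x)%:E = \int[m]_x (f x + M)%:E - M%:E)%E.
Proof.
move=> m1 mf fM.
have intf : m.-integrable [set: T] (EFin \o f).
  apply: measurable_bounded_integrable => //; first by rewrite m1 ltry.
  by exists M; split; [exact: num_real|move=> y My x _; exact: le_trans (fM x) (ltW My)].
have intM : m.-integrable [set: T] (EFin \o cst M).
  apply: measurable_bounded_integrable => //; first by rewrite m1 ltry.
  by exists `|M|; split; [exact: num_real|move=> y My x _; exact: ltW].
rewrite (integralD_EFin measurableT intf intM).
have -> : (\int[m]_x (EFin \o cst M) x = M%:E)%E.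
  by rewrite [LHS](integral_cst m measurableT M%:E) m1 mule1.
by rewrite addeK.
Qed.

Lemma integral_mu_star (k0 : T) (g : T -> R) : measurable_fun [set: T] g ->
  (forall x, 0 <= g x) ->
  (\int[mu_star k0]_x (g x)%:E = ((g k0 + g (- k0)) / 2)%:E)%E.
Proof.
move=> mg g0; have mg' : measurable_fun [set: T] (EFin \o g) by exact/measurable_EFinP.
have g0' x : [set: T] x -> (0 <= (EFin \o g) x)%E by rewrite lee_fin.
rewrite (ge0_integral_mscale _ _ _ mg' g0')// (ge0_integral_measure_add _ _ _ g0' mg')//.
rewrite !(integral_dirac _ _ mg')// !diracT !mul1e.
by rewrite -EFinD -EFinM mulrC.
Qed.

Lemma mu_starT (k0 : T) : mu_star k0 [set: T] = 1%E.
Proof.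
have := @integral_mu_star k0 (cst 1) (measurable_cst _) (fun=> ler01).
rewrite (integral_cst (mu_star k0) measurableT 1) mul1e => ->.
by congr EFin; rewrite /=; field.
Qed.

End weak_limit.

(** * Passage to the two limits *)

Section mixing_limits.
Variable R : realType.
Local Notation T := (torus R).
Local Notation dk := (torus_lebesgue R).
Variables (r : T -> T -> R) (r0 : R) (gamma : T -> R) (k0 : T) (tstar : R).
Hypotheses (hr : admissible_kernel r r0) (hg : admissible_rate gamma k0 tstar).

(** Mixing is applied at both [k0] and [- k0]: the expectation is close to each of the two values of
    [Rop], hence to their average, which is the quantity that concentrates. *)
Lemma jump_process_weak_unit d (Omega : measurableType d) (P : probability Omega R)
    (K : R -> {RV P >-> T}) (h : T -> R) (e : R) :
  jump_process P r gamma k0 K -> unit_fun h -> continuous h -> 0 < e ->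
  exists t0 : R, forall t, t0 <= t ->
    `|\int[distribution P (K t)]_x h x - (h k0 + h (- k0)) / 2| <= e.
Proof.
move=> hK uh ch e0; have e2 : 0 < e / 2 by rewrite divr_gt0.
have [t1 t10 H1] := jump_process_mixing hr hg hK e2.
have [t2 t20 H2] := Rop_semig_concentrates hr hg uh ch e2.
exists (Num.max t1 t2) => t; rewrite ge_max => /andP[tt1 tt2].
have := H1 t h k0 tt1 uh; have := H1 t h (- k0) tt1 uh; have := H2 t k0 tt2.
set u := \int[_]_x h x; set v := Rop _ _ _ k0; set w := Rop _ _ _ (- k0).
rewrite !ler_norml => /andP[? ?] /andP[? ?] /andP[? ?].
by apply/andP; split; lra.
Qed.

Lemma jump_process_weak_limit d (Omega : measurableType d) (P : probability Omega R)
    (K : R -> {RV P >-> T}) :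
  jump_process P r gamma k0 K ->
  weakly_cvg_pinfty (fun t => distribution P (K t)) (mu_star k0).
Proof.
move=> hK f cf [M0 [_ fM0]].
have [M Mgt0 fM] : exists2 M : R, 0 < M & forall x, `|f x| <= M.
  exists (`|M0| + 1) => [|x]; first by rewrite ltr_wpDl.
  by apply: fM0 => //; rewrite (le_lt_trans (ler_norm M0))// ltrDl.
have mf := measurable_continuous_torus cf.
have f0 x : 0 <= f x + M by have := fM x; rewrite ler_norml => /andP[+ _]; lra.
(* The affine map from [-M, M] to [0, 1] makes [f] a test function. *)
pose h x := (2 * M)^-1 * (f x + M).
have M2 : 0 < 2 * M by rewrite mulr_gt0.
have fh x : f x + M = 2 * M * h x by rewrite /h mulrA divff ?mul1r// gt_eqF.
have mh : measurable_fun [set: T] h.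
  by apply: measurable_funM => //; exact: measurable_funD.
have uh : unit_fun h.
  split=> // x; rewrite /h mulr_ge0 ?invr_ge0 ?(ltW M2)//= mulrC ler_pdivrMr// mul1r.
  by have := fM x; rewrite ler_norml => /andP[_]; lra.
have ch : continuous h.
  move=> x; have c1 : f y + M @[y --> x] --> f x + M.
    by have := cvgD (cf x) (cvg_cst M); apply.
  by have := cvgM (cvg_cst (2 * M)^-1) c1; apply.
have fint (m : probability T R) :
    (\int[m]_x (f x)%:E = (2 * M * (\int[m]_x h x)%R - M)%:E)%E.
  rewrite (integral_shift (probability_setT m) mf fM) EFinB; congr (_ - _)%E.
  have hint : (\int[m]_x (h x)%:E = (\int[m]_x h x)%R%:E)%E.
    rewrite /Rintegral fineK//; apply: integrable_fin_num => //.
    by apply: bmf_integrable; exact: unit_fun_bmf.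
  under eq_integral do rewrite fh EFinM.
  rewrite ge0_integralZl_EFin//.
  - by rewrite hint.
  - by move=> x _; rewrite lee_fin; case/andP: (unit_fun_bounds uh x).
  - exact/measurable_EFinP.
  - exact: ltW.
rewrite (integral_shift (mu_starT k0) mf fM) integral_mu_star//; last first.
  exact: measurable_funD.
rewrite -EFinB; apply: cvge_pinfty_fin => e e0.
have e1 : 0 < e / (2 * M) by rewrite divr_gt0.
have [t0 H] := jump_process_weak_unit hK uh ch e1.
exists t0 => t tt0; exists (2 * M * \int[distribution P (K t)]_x h x - M); first exact: fint.
rewrite !fh (_ : _ - (_ - _) = 2 * M *
  (\int[distribution P (K t)]_x h x - (h k0 + h (- k0)) / 2)); last by field.
rewrite normrM gtr0_norm//.
by rewrite mulrC -ler_pdivlMr// H.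
Qed.

Lemma jump_process_tv_limit d (Omega : measurableType d) (P : probability Omega R)
    (K : R -> {RV P >-> T}) d' (Omega' : measurableType d')
    (P' : probability Omega' R) (K' : R -> {RV P' >-> T}) :
  jump_process P r gamma k0 K -> jump_process P' r gamma k0 K' ->
  (tv_dist (distribution P (K t)) (distribution P' (K' t))
    @[t --> +oo%R] --> 0)%E.
Proof.
move=> hK hK'; apply: (@cvge_pinfty_fin R _ 0) => e e0.
(* Each process contributes one mixing error, so an event is off by [e / 2], and [tv_norm_le]
   doubles this. *)
have e4 : 0 < e / 4 by rewrite divr_gt0.
have [t1 t10 H1] := jump_process_mixing hr hg hK e4.
have [t2 t20 H2] := jump_process_mixing hr hg hK' e4.
exists (Num.max t1 t2) => t; rewrite ge_max => /andP[tt1 tt2].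
rewrite /tv_dist; set nu := cadd _ _.
have nue A : measurable A -> (`|nu A| <= (e / 2)%:E)%E.
  move=> mA; have uA : unit_fun (\1_A : T -> R) by exact: unit_fun_indic.
  have mE (m : probability T R) : (m A = (\int[m]_x \1_A x)%R%:E)%E.
    by rewrite /Rintegral integral_indic// setIT fineK// fin_num_measure.
  have -> : (nu A = ((\int[distribution P (K t)]_x \1_A x)%R -
      (\int[distribution P' (K' t)]_x \1_A x)%R)%:E)%E.
    by rewrite EFinB -!mE.
  rewrite abse_EFin lee_fin; have := H1 t _ point tt1 uA; have := H2 t _ point tt2 uA.
  set u := Rintegral _ _ _; set v := Rop _ _ _ _; set w := Rintegral _ _ _.
  rewrite !ler_norml => /andP[? ?] /andP[? ?].
  by apply/andP; split; lra.
have tve := tv_norm_le nue; have tv0 := tv_norm_ge0 nu.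
rewrite (_ : 2 * (e / 2) = e) in tve; last by field.
have tvf : tv_norm nu \is a fin_num.
  by rewrite ge0_fin_numE//; exact: le_lt_trans tve (ltry _).
exists (fine (tv_norm nu)); first by rewrite fineK.
by rewrite subr0 ger0_norm ?fine_ge0// -lee_fin fineK.
Qed.

End mixing_limits.

Theorem theorem4p2 (R : realType) (r : torus R -> torus R -> R) (r0 : R)
    (gamma : torus R -> R) (k0 : torus R) (tstar : R)
    (hr : admissible_kernel r r0) (hgamma : admissible_rate gamma k0 tstar) :
  (forall (nu0 : probability (torus R) R)
      (d : measure_display) (Omega : measurableType d)
      (P : probability Omega R) (K : R -> {RV P >-> torus R}),
    nu0 `<< torus_m1 R ->
    jump_process P r gamma k0 K ->
    (forall A, measurable A -> distribution P (K 0) A = nu0 A) ->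
    weakly_cvg_pinfty (fun t => distribution P (K t)) (mu_star k0)) /\
  (forall (nu0 nu0' : probability (torus R) R)
      (d : measure_display) (Omega : measurableType d)
      (P : probability Omega R) (K : R -> {RV P >-> torus R})
      (d' : measure_display) (Omega' : measurableType d')
      (P' : probability Omega' R) (K' : R -> {RV P' >-> torus R}),
    nu0 `<< torus_m1 R -> nu0' `<< torus_m1 R ->
    jump_process P r gamma k0 K -> jump_process P' r gamma k0 K' ->
    (forall A, measurable A -> distribution P (K 0) A = nu0 A) ->
    (forall A, measurable A -> distribution P' (K' 0) A = nu0' A) ->
    tv_dist (distribution P (K t)) (distribution P' (K' t))
      @[t --> +oo%R] --> 0%E).
Proof.
split=> [nu0 d Omega P K _ hK _|nu0 nu0' d Omega P K d' Omega' P' K' _ _ hK hK' _ _].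
  exact: (jump_process_weak_limit hr hgamma hK).
exact: (jump_process_tv_limit hr hgamma hK hK').
Qed.
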